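(* Let $d=1$, let $W$ be an admissible interaction potential, and assume that the convexity modulus $\lambda_0$ defined in the context satisfies $\lambda_0>0$. Suppose that $\mu^0\in\mathscr{P}$ has compact support and let $\mu$ be the gradient flow solution of the interaction system with initial datum $\mu^0$. Then, for each $i\in\{1,\ldots,n\}$, $$\lim_{t\to\infty}\mathbf{W}_\infty(\mu_i(t),\mu^\infty_i)=0,$$ where $\mu^\infty:=(p_1\delta_{x^\infty},\ldots,p_n\delta_{x^\infty})$ with $x^\infty:=E\big[\sum_{j=1}^n\frac{p_j}{m_j}\big]^{-1}$ is the unique steady state of the interaction system on $\mathscr{P}$.
   Context: Spatial dimension $d=1$. Let $n\in\mathbb{N}$, $m_1,\ldots,m_n>0$, $p_1,\ldots,p_n>0$, $E\in\mathbb{R}$ be fixed. Admissible interaction potential: a map $W:\mathbb{R}\to\mathbb{R}^{n\times n}$ such that $W(z)$ is a symmetric matrix for each $z$; $W_{ij}\in C^1(\mathbb{R};\mathbb{R})$ for all $i,j$; $W(z)=W(-z)$ for all $z$; there is a matrix $\overline W\in\mathbb{R}^{n\times n}$ with $|W_{ij}(z)|\le\overline W_{ij}(1+|z|^2)$ for all $z,i,j$; and there is a symmetric matrix $\kappa\in\mathbb{R}^{n\times n}$ (the convexity matrix, fixed) such that $z\mapsto W_{ij}(z)-\frac12\kappa_{ij}|z|^2$ is convex for all $i,j$. Interaction system: $\partial_t\mu_i=\partial_x\big[m_i\mu_i\,\partial_x\big(\sum_{j=1}^nW_{ij}*\mu_j\big)\big]$, $i=1,\ldots,n$; it holds in the sense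 of distributions if for all $i$ and all $\varphi\in C_c^\infty((0,\infty)\times\mathbb{R})$: $\int_0^\infty\int_{\mathbb{R}}\big(\partial_t\varphi(t,x)-m_i\partial_x\varphi(t,x)\sum_{j=1}^n\int W_{ij}'(x-y)\,\mathrm{d}\mu_j(t,y)\big)\mathrm{d}\mu_i(t,x)\,\mathrm{d}t=0$. A steady state is an element of $\mathscr{P}$ which, as a constant curve in time, solves the interaction system in the sense of distributions. $\mathscr{P}$ is the set of $n$-tuples $\mu=(\mu_1,\ldots,\mu_n)$ of nonnegative Borel measures on $\mathbb{R}$ with $\mu_j(\mathbb{R})=p_j$, finite second moments, and $\sum_{j=1}^n\frac1{m_j}\int_{\mathbb{R}}x\,\mathrm{d}\mu_j(x)=E$, with the distance $$\mathbf{W}_{\mathscr{P}}(\mu^0,\mu^1)=\Big[\sum_{j=1}^n\frac1{m_j}\inf\Big\{\int|x-y|^2\,\mathrm{d}\gamma_j(x,y):\gamma_j\in\Gamma(\mu^0_j,\mu^1_j)\Big\}\Big]^{1/2},$$ where $\Gamma(\mu^0_j,\mu^1_j)$ is the set of finite Borel measures on $\mathbb{R}\times\mathbb{R}$ with marginals $\mu_j^0,\mu_j^1$. For finite compactly supported measures $\alpha,\beta$ on $\mathbb{R}$ of equal mass, $\mathbf{W}_\infty(\alpha,\beta)=\inf\{\gamma\text{-}\operatorname{ess\,sup}|x-y|:\gamma\in\Gamma(\alpha,\beta)\}$ is the $L^\infty$-Wasserstein distance. ''$\mu^0$ has compact support'' means every component has compact support. $AC^2_{\mathrm{loc}}([0,\infty);(X,\mathbf{d}))$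 is the set of curves $\mu:[0,\infty)\to X$ such that for each $T>0$ there is $\varphi\in L^2([0,T])$ with $\mathbf{d}(\mu(s),\mu(t))\le\int_s^t\varphi(r)\,\mathrm{d}r$ for $0\le s\le t\le T$. The gradient flow solution with initial datum $\mu^0\in\mathscr{P}$ is the (existing and unique) curve in $AC^2_{\mathrm{loc}}([0,\infty);(\mathscr{P},\mathbf{W}_{\mathscr{P}}))$ with $\mu(0)=\mu^0$ for which the interaction system holds in the sense of distributions. Convexity modulus $\lambda_0$: if $n>1$, with $\eta_i:=\min_{j\neq i}\kappa_{ij}m_j$, $$\lambda_0:=\min_{i\in\{1,\ldots,n\}}\left[p_i\min(0,m_i\kappa_{ii}-\eta_i)+\frac12\sum_{j=1}^n p_j\left(\eta_j+\eta_i\frac{m_i}{m_j}\right)\right];$$ if $n=1$, $\lambda_0:=m_1\kappa_{11}p_1$. *)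

(* Defs.v *)
From HB Require Import structures.
From mathcomp Require Export all_boot all_order all_algebra.
From mathcomp Require Export all_classical all_reals all_analysis.
From mathcomp Require Export ess_sup_inf.

Set Implicit Arguments.
Unset Strict Implicit.
Unset Printing Implicit Defensive.

Import Order.TTheory GRing.Theory Num.Theory.
Export numFieldNormedType.Exports.

Local Open Scope classical_set_scope.
Local Open Scope ring_scope.

Notation borelR R := {measure set (measurableTypeR R) -> \bar R}.
Notation borelRR R :=
  {measure set (measurableTypeR R * measurableTypeR R)%type -> \bar R}.

(* Values of a [measure] outside the sigma-algebra are unconstrained, so two
   equal Borel measures need not be Leibniz-equal. *)
Definition measure_eq (R : realType) (mu nu : borelR R) : Prop :=
  forall A, measurable A -> mu A = nu A.

Definition msupport (R : realType) (mu : borelR R) : set R :=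
  [set x | forall U : set R, open U -> U x -> (0 < mu U)%E].

Record admissible (R : realType) (n : nat)
    (W : R -> 'M[R]_n) (kappa : 'M[R]_n) : Prop := {
  adm_sym : forall z, (W z)^T = W z ;
  adm_derivable : forall i j z, derivable (fun z => W z i j) z 1 ;
  adm_continuous : forall i j, continuous (derive1 (fun z => W z i j)) ;
  adm_even : forall z, W z = W (- z) ;
  adm_growth : exists Wbar : 'M[R]_n,
    forall z i j, `|W z i j| <= Wbar i j * (1 + `|z| ^+ 2) ;
  adm_kappa_sym : kappa^T = kappa ;
  adm_convex : forall i j,
    @convex_function R R^o setT
      (fun z => W z i j - 2^-1 * kappa i j * `|z| ^+ 2) }.

Definition in_P (R : realType) (n : nat) (m p : 'I_n -> R) (E : R)
    (mu : 'I_n -> borelR R) : Prop :=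
  [/\ forall j, mu j setT = (p j)%:E,
      forall j, (\int[mu j]_x (x ^+ 2)%:E < +oo)%E &
      \sum_j (m j)^-1 * (\int[mu j]_x x) = E].

Definition couplings (R : realType) (alpha beta : borelR R)
    : set (borelRR R) :=
  [set g | [/\ (g setT < +oo)%E,
      forall A, measurable A -> g (A `*` setT) = alpha A &
      forall B, measurable B -> g (setT `*` B) = beta B]].

Definition wassersteinP (R : realType) (n : nat) (m : 'I_n -> R)
    (mu nu : 'I_n -> borelR R) : \bar R :=
  ((\sum_(j < n) ((m j)^-1)%:E *
     ereal_inf [set \int[g]_z (`|z.1 - z.2| ^+ 2)%:E
               | g in couplings (mu j) (nu j)]) `^ 2^-1)%E.

(* [\bar R]-valued, so no support condition is needed in the definition. *)
Definition wasserstein_oo (R : realType) (alpha beta : borelR R) : \bar R :=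
  ereal_inf [set ess_sup g (fun z => (`|z.1 - z.2|)%:E)
            | g in couplings alpha beta].

Definition AC2loc (R : realType) (X : Type) (dist : X -> X -> \bar R)
    (u : R -> X) : Prop :=
  forall T : R, 0 < T -> exists phi : R -> R,
    [/\ measurable_fun `[0, T] phi,
        (\int[lebesgue_measure]_(r in `[0%R, T]) (phi r ^+ 2)%:E < +oo)%E &
        forall s t, 0 <= s -> s <= t -> t <= T ->
          (dist (u s) (u t) <=
             \int[lebesgue_measure]_(r in `[s, t]) (phi r)%:E)%E].

Fixpoint of_class (R : realType) (k : nat) (f : R * R -> R) : Prop :=
  match k with
  | 0%N => continuous f
  | k'.+1 => [/\ continuous f,
      forall v z, derivable f z v &
      forall v, of_class k' (fun z => 'D_v f z)]
  end.

(* C_c^oo((0,oo) x R), its elements being extended by zero to R x R. *)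
Definition test_function (R : realType) (phi : R * R -> R) : Prop :=
  let supp := closure [set z | phi z != 0] in
  [/\ forall k, of_class k phi, compact supp &
      supp `<=` [set z | 0 < z.1]].

Definition weak_solution (R : realType) (n : nat) (m : 'I_n -> R)
    (W : R -> 'M[R]_n) (mu : R -> 'I_n -> borelR R) : Prop :=
  forall (i : 'I_n) (phi : R * R -> R), test_function phi ->
    (\int[lebesgue_measure]_(t in `]0%R, +oo[)
       \int[mu t i]_x
         ('D_(1, 0) phi (t, x) -
          m i * 'D_(0, 1) phi (t, x) *
            \sum_(j < n)
               (\int[mu t j]_y derive1 (fun z => W z i j) (x - y))%R)%:E
     = 0)%E.

Definition steady_state (R : realType) (n : nat) (m p : 'I_n -> R) (E : R)
    (W : R -> 'M[R]_n) (nu : 'I_n -> borelR R) : Prop :=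
  in_P m p E nu /\ weak_solution m W (fun=> nu).

Definition gradient_flow (R : realType) (n : nat) (m p : 'I_n -> R) (E : R)
    (W : R -> 'M[R]_n) (mu0 : 'I_n -> borelR R)
    (mu : R -> 'I_n -> borelR R) : Prop :=
  [/\ forall t, 0 <= t -> in_P m p E (mu t),
      AC2loc (wassersteinP m) mu,
      forall i, measure_eq (mu 0 i) (mu0 i) &
      weak_solution m W mu].

(* The infima below range over nonempty finite sets, hence are minima; [eta]
   is only used when there are at least two indices.  There are n.+1 species,
   so the first branch of [lambda0] is the single-species case. *)
Definition eta (R : realType) (n : nat) (m : 'I_n -> R) (kappa : 'M[R]_n)
    (i : 'I_n) : R :=
  inf [set kappa i j * m j | j in [set j | j != i]].

Definition lambda0 (R : realType) (n : nat) (m p : 'I_n.+1 -> R)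
    (kappa : 'M[R]_n.+1) : R :=
  if n == 0%N then m ord0 * kappa ord0 ord0 * p ord0
  else inf [set p i * Num.min 0 (m i * kappa i i - eta m kappa i) +
                2^-1 * \sum_j p j *
                   (eta m kappa j + eta m kappa i * (m i / m j))
           | i in [set: 'I_n.+1]].

Definition x_oo (R : realType) (n : nat) (m p : 'I_n -> R) (E : R) : R :=
  E * (\sum_j p j / m j)^-1.

Definition mu_oo (R : realType) (n : nat) (m p : 'I_n -> R)
    (p_gt0 : forall i, 0 < p i) (E : R) (i : 'I_n) : borelR R :=
  mscale (NngNum (ltW (p_gt0 i)))
    (@dirac _ (measurableTypeR R) (x_oo m p E) R).

(* Main.v *)
(* Write c for x_oo and b_i for the drift of species i, the sum over j of the
   integral of W_ij'(x - y) d mu_j(y). Convexity of the potentials makes the drift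
   one-sidedly expanding: m_i (b_i(x) - b_i(c)) (x - c) >= lambda0 |x - c|^2,
   because m_i sum_j kappa_ij p_j >= lambda0. So, once |b_i(c)| is bounded, the
   velocity - m_i b_i points inwards off a large interval, and a cutoff which is
   monotone in |x - c| acts as a barrier: supports stay bounded on bounded times.
   For such measures Phi = sum_i m_i^-1 int |x - c|^2 d mu_i is finite, and
   symmetrizing the double integral gives Phi' <= - 2 lambda0 Phi. Hence b_i(c)
   tends to 0, and then the moments of order 2k about c decay, up to a small
   error, with a rate per power of |x - c| that does not depend on k; letting k
   tend to infinity, the supports shrink to {c}. A steady state is covered too:
   nothing can flow through an annulus where the drift has a strict sign, so its
   support is bounded, and the constant curve concentrates at c. *)
From HB Require Import structures.
Require Import Defs.
From mathcomp Require Import measurable_realfun ring lra.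

Set Implicit Arguments.
Unset Strict Implicit.
Unset Printing Implicit Defensive.

Import Order.TTheory GRing.Theory Num.Theory.
Local Open Scope classical_set_scope.
Local Open Scope ring_scope.

(** * Smooth functions and cutoffs *)

(** The weak formulation gives no time derivative of an integral against [mu t i], so every
    differential inequality passes through a Gronwall lemma for distributional derivatives of
    right-continuous functions. Absolute continuity in time enters through two consequences:
    integrals of functions with a common modulus of continuity vary continuously in time, uniformly,
    and second moments are bounded on bounded times. The order of the estimates is forced. Powers of
    |x - c| are not compactly supported, so bounded supports must precede any moment estimate; and
    the drift at c must be bounded before the supports are, which second moments allow because the
    forces grow at most quadratically. The radius found in this way depends on the time horizon, but
    no decay rate does. The modulus lambda0 serves twice: in the pointwise bound on the drift, and
    as the constant of a quadratic inequality between moments. As the limit is a multiple of a Dirac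
    mass, the radius of the support about c bounds the distance W_oo. *)

Section smooth.
Context {R : realType}.
Implicit Types (f g : R -> R) (k : nat).

Fixpoint smooth_upto k f : Prop :=
  match k with
  | 0%N => continuous f
  | k'.+1 => [/\ continuous f, forall x : R, derivable f x 1 & smooth_upto k' (derive1 f)]
  end.

Definition smooth f := forall k, smooth_upto k f.

Lemma is_derive_continuous f g :
  (forall x : R, is_derive x 1 f (g x)) -> continuous f.
Proof.
move=> fg x; apply: differentiable_continuous; apply/derivable1_diffP.
by have [] := fg x.
Qed.

Lemma is_derive_derive1 f g :
  (forall x : R, is_derive x 1 f (g x)) -> (derive1 f) = g.
Proof. by move=> fg; apply/funext => x; rewrite derive1E; have [] := fg x. Qed.

Lemma smooth_uptoS k f g : (forall x : R, is_derive x 1 f (g x)) ->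
  smooth_upto k g -> smooth_upto k.+1 f.
Proof.
move=> fg sg; split.
- exact: is_derive_continuous fg.
- by move=> x; have [] := fg x.
- by rewrite (is_derive_derive1 fg).
Qed.

Lemma smooth_uptoP k f : smooth_upto k.+1 f ->
  (forall x : R, is_derive x 1 f ((derive1 f) x)) /\ smooth_upto k (derive1 f).
Proof.
case=> _ df sf; split => // x; rewrite derive1E; exact: derivableP.
Qed.

Lemma smooth_uptoW k f : smooth_upto k.+1 f -> smooth_upto k f.
Proof.
elim: k f => [f []//|k IH f].
by move=> [cf df /IH sf]; split.
Qed.

Lemma smooth_upto_cst k (a : R) : smooth_upto k (cst a).
Proof.
elim: k a => [|k IH] a; first exact: cst_continuous.
by apply: (@smooth_uptoS _ _ (cst 0)); last exact: IH.
Qed.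

Lemma smooth_uptoD k f g : smooth_upto k f -> smooth_upto k g ->
  smooth_upto k (fun x => f x + g x).
Proof.
elim: k f g => [f g cf cg|k IH f g].
  by move=> x; apply: continuousD; [exact: cf|exact: cg].
move=> /smooth_uptoP[df sf] /smooth_uptoP[dg sg].
by apply: (@smooth_uptoS _ _ (fun x => (derive1 f) x + (derive1 g) x)); last exact: IH.
Qed.

Lemma smooth_uptoM k f g : smooth_upto k f -> smooth_upto k g ->
  smooth_upto k (fun x => f x * g x).
Proof.
elim: k f g => [f g cf cg|k IH f g].
  by move=> x; apply: continuousM; [exact: cf|exact: cg].
move=> sf' sg'.
have [df sf] := smooth_uptoP sf'; have [dg sg] := smooth_uptoP sg'.
apply: (@smooth_uptoS _ _ (fun x => f x * (derive1 g) x + g x * (derive1 f) x)).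
apply: smooth_uptoD; apply: IH => //; exact: smooth_uptoW.
Qed.

Lemma smooth_uptoV k f : (forall x, f x != 0) -> smooth_upto k f ->
  smooth_upto k (fun x => (f x)^-1).
Proof.
move=> f0; elim: k => [cf x|k IH].
  by apply: continuousV => //; exact: cf.
move=> sf'; have [df sf] := smooth_uptoP sf'.
apply: (@smooth_uptoS _ _ (fun x => ((f x)^-1 * (f x)^-1) * (- 1 * (derive1 f) x))).
  move=> x; have dfx := df x.
  apply: (is_derive_eq (is_deriveV (f0 x) dfx)).
  by rewrite /GRing.scale/= mulN1r mulrN mulNr -expr2 exprVn.
have iV := IH (smooth_uptoW sf').
apply: smooth_uptoM; apply: smooth_uptoM => //; exact: smooth_upto_cst.
Qed.

Lemma is_derive_affine (a b x : R) : is_derive x 1 (fun y => a * y + b) a.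
Proof.
have h := is_deriveD (@is_deriveZ _ _ R id a x 1 1 (is_derive_id x 1)) (is_derive_cst b x 1).
by apply: (is_derive_eq h); rewrite addr0 /GRing.scale/= mulr1.
Qed.

Lemma smooth_upto_affine k f (a b : R) : smooth_upto k f ->
  smooth_upto k (fun x => f (a * x + b)).
Proof.
elim: k f => [f cf x|k IH f].
  apply: (@continuous_comp _ _ _ (fun y => a * y + b) f); last exact: cf.
  exact: (is_derive_continuous (is_derive_affine a b)).
move=> /smooth_uptoP[df sf].
apply: (@smooth_uptoS _ _ (fun x => a * (derive1 f) (a * x + b))).
  move=> x.
  have h := @is_derive1_comp _ f (fun y => a * y + b) x _ _ (df _)
    (is_derive_affine a b x).
  by apply: (is_derive_eq h); rewrite mulrC.
by apply: smooth_uptoM (IH _ sf); exact: smooth_upto_cst.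
Qed.

Lemma smooth_upto_expR k : smooth_upto k (@expR R).
Proof.
elim: k => [|k IH]; first exact: continuous_expR.
by apply: (@smooth_uptoS _ _ expR) IH => x; exact: is_derive_expR.
Qed.

Lemma smooth_cst (a : R) : smooth (cst a).
Proof. by move=> k; exact: smooth_upto_cst. Qed.

Lemma smoothD f g : smooth f -> smooth g -> smooth (fun x => f x + g x).
Proof. by move=> sf sg k; exact: smooth_uptoD. Qed.

Lemma smoothM f g : smooth f -> smooth g -> smooth (fun x => f x * g x).
Proof. by move=> sf sg k; exact: smooth_uptoM. Qed.

Lemma smooth_affine f (a b : R) : smooth f -> smooth (fun x => f (a * x + b)).
Proof. by move=> sf k; exact: smooth_upto_affine. Qed.

Lemma smooth_id : smooth (fun x : R => x).
Proof.
case=> [x|k]; first exact: cvg_id.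
by apply: (@smooth_uptoS _ _ (cst 1)) => //; exact: smooth_upto_cst.
Qed.

Lemma smoothX n : smooth (fun x : R => x ^+ n).
Proof.
elim: n => [|n IH].
  rewrite (_ : (fun _ => _) = cst 1); first exact: smooth_cst.
  by apply/funext => x; rewrite expr0.
under eq_fun do rewrite exprS; exact: smoothM smooth_id IH.
Qed.

Lemma smooth_expM (a : R) : smooth (fun x => expR (a * x)).
Proof.
under eq_fun do rewrite -[a * _]addr0.
by apply: smooth_affine => k; exact: smooth_upto_expR.
Qed.

Lemma smooth_continuous f : smooth f -> continuous f.
Proof. by move=> /(_ 0%N). Qed.

Lemma smooth_derivable f (x : R) : smooth f -> derivable f x 1.
Proof. by move=> /(_ 1%N)[]. Qed.

Lemma smooth_derive f : smooth f -> smooth (derive1 f).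
Proof. by move=> sf k; have [] := sf k.+1. Qed.

Lemma smooth_is_derive f (x : R) : smooth f -> is_derive x 1 f ((derive1 f) x).
Proof. by move=> /(_ 1%N) /smooth_uptoP[]. Qed.

End smooth.

(** * Functions that are flat at the origin *)

Section flat.
Context {R : realType}.
Implicit Types (p : {poly R}).

(** The functions p(1/x) e^(-1/x), extended by zero to x <= 0. Indexing them by a polynomial makes
    the family stable under differentiation, so smoothness becomes an induction on the order. *)
Definition flat p (x : R) : R := if 0 < x then p.[x^-1] * expR (- x^-1) else 0.

Lemma flatD p q x : flat (p + q) x = flat p x + flat q x.
Proof. by rewrite /flat; case: ifP => _; rewrite ?addr0// hornerD mulrDl. Qed.

(** Induction on [p]: passing from p to p X divides the function by x, which is paid for by using
    the bound of [p] with one more power of |x|. For a constant the bound is e^y >= y^n / n! at y =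
    1/x. *)
Lemma flat_bound p n : exists2 C, 0 <= C &
  forall x, `|flat p x| <= C * `|x| ^+ n.
Proof.
elim/poly_ind: p n => [|p c IH] n.
  by exists 0 => // x; rewrite /flat horner0 mul0r if_same normr0 mul0r.
have [C C0 HC] := IH n.+1.
exists (C + `|c| * n`!%:R) => [|x]; first by rewrite addr_ge0 ?mulr_ge0.
rewrite flatD mulrDl (le_trans (ler_normD _ _))// lerD//.
  rewrite /flat; case: ifPn => x0; last by rewrite normr0 mulr_ge0 ?exprn_ge0.
  have := HC x; rewrite /flat x0 hornerMX => h.
  rewrite mulrAC normrM -(ler_pM2r (_ : 0 < `|x|)) ?normr_gt0 ?gt_eqF//.
  by rewrite -mulrA -normrM mulVf ?gt_eqF// normr1 mulr1 -mulrA -exprSr.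
rewrite /flat; case: ifPn => x0.
  rewrite hornerC normrM -mulrA ler_wpM2l// ger0_norm ?expR_ge0//.
  rewrite gtr0_norm// expRN invf_ple ?posrE ?expR_gt0//; last first.
    by rewrite mulr_gt0 ?exprn_gt0// ltr0n fact_gt0.
  case: n {IH HC} => [|n].
    by rewrite fact0 expr0 mulr1 invr1 -expR0 ler_expR invr_ge0 ltW.
  have := @expR_ge1Dxn R x^-1 n; rewrite invr_ge0 (ltW x0) => /(_ isT).
  apply: le_trans; rewrite invfM exprVn mulrC lerDr//.
by rewrite normr0 mulr_ge0 ?exprn_ge0// mulr_ge0.
Qed.

Lemma is_derive_sqr_bound (f : R -> R) (C : R) :
  f 0 = 0 -> (forall x, `|f x| <= C * `|x| ^+ 2) -> is_derive (0 : R) 1 f 0.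
Proof.
move=> f0 fC.
have h : h^-1 *: (f (h *: 1 + 0) - f 0) @[h --> (0:R)^'] --> (0 : R).
  apply/cvgr0Pnorm_le => /= e e0.
  have C1 : 0 < `|C| + 1 by rewrite ltr_wpDl.
  near=> x.
  have x0 : x != 0 by near: x; exact: nbhs_dnbhs_neq.
  rewrite f0 subr0 addr0 /GRing.scale/= mulr1 normrM.
  have xe : `|x| <= e / (`|C| + 1).
    near: x; apply: dnbhs0_le; exact: divr_gt0.
  rewrite normfV ler_pdivrMl ?normr_gt0//.
  apply: (le_trans (fC x)); rewrite expr2 mulrA mulrC ler_wpM2l//.
  apply: (@le_trans _ _ ((`|C| + 1) * `|x|)).
    by rewrite ler_wpM2r// (le_trans (ler_norm _))// lerDl.
  by rewrite mulrC -ler_pdivlMr.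
split; first by apply/cvg_ex; exists 0.
exact/cvg_lim.
Unshelve. all: by end_near. Qed.

Lemma flat_is_derive p (x : R) :
  is_derive x 1 (flat p) (flat ('X^2 * (p - p^`())) x).
Proof.
have [x0|x0|->] := ltgtP x 0.
- rewrite {2}/flat ltNge (ltW x0)/=.
  apply: (@near_eq_is_derive _ _ _ (cst 0)) => //.
  near=> y; rewrite /flat ltNge (_ : y <= 0)// ltW//.
    by near: y; exact: lt_nbhsl.
- rewrite {2}/flat x0.
  apply: (@near_eq_is_derive _ R R (fun y : R => p.[y^-1] * expR (- y^-1))) => //.
    near=> y; rewrite /flat (_ : 0 < y)//.
    by near: y; exact: lt_nbhsr.
  have dV : is_derive x 1 (fun y : R => y^-1) (- (x ^- 2)).
    have xn0 : x != 0 by rewrite gt_eqF.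
    have := @is_deriveV R id x 1 1 xn0 (is_derive_id _ _).
    by move=> h; apply: (is_derive_eq h); rewrite /GRing.scale/= mulr1.
  have dNV : is_derive x 1 (fun y : R => - y^-1) (x ^- 2).
    by apply: (is_derive_eq (is_deriveN dV)); rewrite opprK.
  have h1 := @is_derive1_comp _ (horner p) (fun y : R => y^-1) x _ _ (is_derive_poly p _) dV.
  have h2 := @is_derive1_comp _ expR (fun y : R => - y^-1) x _ _ (is_derive_expR _) dNV.
  apply: (is_derive_eq (is_deriveM h1 h2)).
  rewrite /GRing.scale/= !hornerE -?exprVn /=; ring.
- have [C C0 HC] := flat_bound p 2.
  rewrite {2}/flat ltxx.
  apply: (is_derive_sqr_bound _ HC); by rewrite /flat ltxx.
Unshelve. all: by end_near. Qed.

Lemma smooth_flat p : smooth (flat p).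
Proof.
move=> k; elim: k p => [|k IH] p.
  exact: is_derive_continuous (flat_is_derive p).
by apply: smooth_uptoS (IH _) => x; exact: flat_is_derive.
Qed.

End flat.

(** * A smooth step function *)

Section step.
Context {R : realType}.

Let g : R -> R := flat 1.
Let g' : R -> R := flat 'X^2.

Let g_derive (x : R) : is_derive x 1 g (g' x).
Proof.
have := flat_is_derive 1 x.
by rewrite derivC subr0 mulr1.
Qed.

Let g_gt0 x : 0 < x -> 0 < g x.
Proof. by move=> x0; rewrite /g /flat x0 hornerC mul1r expR_gt0. Qed.

Let g_eq0 x : x <= 0 -> g x = 0.
Proof. by move=> x0; rewrite /g /flat ltNge x0. Qed.

Let g_ge0 x : 0 <= g x.
Proof. by have [/g_eq0->//|/g_gt0/ltW] := leP x 0. Qed.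

Let g'_gt0 x : 0 < x -> 0 < g' x.
Proof.
by move=> x0; rewrite /g' /flat x0 hornerXn mulr_gt0 ?expR_gt0// exprn_gt0 ?invr_gt0.
Qed.

Let g'_eq0 x : x <= 0 -> g' x = 0.
Proof. by move=> x0; rewrite /g' /flat ltNge x0. Qed.

Let g'_ge0 x : 0 <= g' x.
Proof. by have [/g'_eq0->//|/g'_gt0/ltW] := leP x 0. Qed.

Let D x := g x + g (-1 * x + 1).

Let D_gt0 x : 0 < D x.
Proof.
have [x0|x0] := leP x 0; last by rewrite ltr_wpDr ?g_gt0.
by rewrite ltr_wpDl// g_gt0//; lra.
Qed.

Definition step (x : R) : R := g x * (D x)^-1.

Lemma smooth_step : smooth step.
Proof.
apply: smoothM; first exact: smooth_flat.
move=> k; apply: smooth_uptoV => [x|]; first by rewrite gt_eqF.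
apply: smoothD; first exact: smooth_flat.
by apply: smooth_affine; exact: smooth_flat.
Qed.

Lemma step_le0 x : x <= 0 -> step x = 0.
Proof. by move=> x0; rewrite /step g_eq0// mul0r. Qed.

Lemma step_ge1 x : 1 <= x -> step x = 1.
Proof.
move=> x0; rewrite /step /D (g_eq0 (_ : -1 * x + 1 <= 0)); last by lra.
by rewrite addr0 divff// gt_eqF// g_gt0//; lra.
Qed.

Let h (x : R) := (g' x * g (-1 * x + 1) + g x * g' (-1 * x + 1)) / (D x * D x).

Lemma step_derive x : derive1 step x = h x.
Proof.
rewrite derive1E.
have d1 := @is_derive1_comp _ g (fun y => -1 * y + 1) x _ _ (g_derive _)
    (is_derive_affine (-1) 1 x).
have d2 := is_deriveD (g_derive x) d1.
have D0 : (g \+ (g \o (fun y => -1 * y + 1))) x != 0 by rewrite gt_eqF// D_gt0.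
have d3 := is_deriveV D0 d2.
have d4 := is_deriveM (g_derive x) d3.
have -> : step = (g \* (fun y => ((g \+ (g \o (fun y => -1 * y + 1))) y)^-1)).
  by apply/funext.
have [_ ->] := d4.
have D0' : D x != 0 by rewrite gt_eqF.
rewrite /GRing.scale/= -/(D x) /h.
rewrite /D in D0' *; field.
exact: D0'.
Qed.

Lemma step_derive_ge0 x : 0 <= derive1 step x.
Proof.
rewrite step_derive /h divr_ge0//; last by rewrite mulr_ge0// ltW.
by rewrite addr_ge0// mulr_ge0.
Qed.

(** The strict sign passes to [bump_derive_neg], where it lets a vanishing flux of a steady state
    imply that an annulus is null. *)
Lemma step_derive_gt0 x : 0 < x < 1 -> 0 < derive1 step x.
Proof.
move=> /andP[x0 x1]; rewrite step_derive /h divr_gt0 ?mulr_gt0//.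
by rewrite ltr_pwDl ?mulr_ge0// mulr_gt0 ?g'_gt0// g_gt0//; lra.
Qed.

Lemma step_derive_eq0 x : (x <= 0) || (1 <= x) -> derive1 step x = 0.
Proof.
rewrite step_derive /h => /orP[] x0.
  by rewrite (g'_eq0 x0) (g_eq0 x0) !mul0r addr0 mul0r.
rewrite (g'_eq0 (_ : -1 * x + 1 <= 0)); last by lra.
rewrite (g_eq0 (_ : -1 * x + 1 <= 0)); last by lra.
by rewrite !mulr0 addr0 mul0r.
Qed.

Lemma le_step x y : x <= y -> step x <= step y.
Proof.
apply: (@ger0_derive1_ndecry _ step (Num.min x y)) => //.
- by move=> z _; apply: smooth_derivable; exact: smooth_step.
- by move=> z _; exact: step_derive_ge0.
- by apply: continuous_subspaceT; apply: smooth_continuous; exact: smooth_step.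
- by rewrite ge_min lexx.
Qed.

Lemma step_itv x : 0 <= step x <= 1.
Proof.
apply/andP; split; first by rewrite mulr_ge0// invr_ge0 ltW.
by rewrite ler_pdivrMr// mul1r lerDl.
Qed.

End step.

Section cutoff.
Context {R : realType}.
Implicit Types a b c K x y s t h : R.

Lemma derive1_affine (f : R -> R) a b x : derivable f (a * x + b) 1 ->
  is_derive x 1 (fun y => f (a * y + b)) (a * derive1 f (a * x + b)).
Proof.
move=> df; rewrite mulrC; rewrite derive1E.
by have h := @is_derive1_comp _ f (fun y => a * y + b) x _ _ (derivableP df)
    (is_derive_affine a b x).
Qed.

(** A plateau with ramps of width 1/d, on [a, a + 1/d] and on [b, b + 1/d]. Both lie to the right of
    their base point, so that for large [d] the derivative samples values just after [a] and just
    after [b], as right continuity requires. *)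
Definition window (a b d x : R) : R :=
  step (d * x + (- (d * a))) - step (d * x + (- (d * b))).

Lemma smooth_window a b d : smooth (window a b d).
Proof.
apply: smoothD; first exact: smooth_affine smooth_step.
under eq_fun do rewrite -mulN1r.
by apply: smoothM; [exact: smooth_cst|exact: smooth_affine smooth_step].
Qed.

Lemma window_derive a b d x : derive1 (window a b d) x =
  d * (derive1 step (d * (x - a)) - derive1 step (d * (x - b))).
Proof.
rewrite derive1E.
have d1 := derive1_affine (@smooth_derivable _ _ (d * x + (- (d * a))) (@smooth_step R)).
have d2 := derive1_affine (@smooth_derivable _ _ (d * x + (- (d * b))) (@smooth_step R)).
have [_ ->] := is_deriveB d1 d2.
by rewrite -!mulrBr.
Qed.

Lemma window_itv a b d x : 0 < d -> a <= b -> 0 <= window a b d x <= 1.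
Proof.
move=> d0 ab; have /andP[s0 s1] := step_itv (d * x + (- (d * a))).
have /andP[t0 t1] := step_itv (d * x + (- (d * b))).
rewrite /window subr_ge0 le_step /=; first by lra.
by rewrite lerD2l lerN2 ler_pM2l.
Qed.

Lemma window_eq0 a b d x : 0 < d -> a <= b ->
  (x <= a) || (b + d^-1 <= x) -> window a b d x = 0.
Proof.
move=> d0 ab /orP[xa|xb]; rewrite /window -!mulrBr.
  by rewrite !step_le0 ?subrr// pmulr_rle0// subr_le0// (le_trans xa).
rewrite !step_ge1 ?subrr//.
  by rewrite mulrC -ler_pdivrMr// lerBrDr addrC mul1r.
by rewrite mulrC -ler_pdivrMr// lerBrDr addrC mul1r (le_trans _ xb)// lerD2r.
Qed.

Lemma window_eq1 a b d x : 0 < d -> a + d^-1 <= x <= b -> window a b d x = 1.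
Proof.
move=> d0 /andP[xa xb]; rewrite /window -!mulrBr step_ge1 ?step_le0 ?subr0//.
  by rewrite pmulr_rle0// subr_le0.
by rewrite mulrC -ler_pdivrMr// lerBrDr addrC mul1r.
Qed.

End cutoff.

Section bump.
Context {R : realType}.
Variables (c K : R).
Implicit Types x : R.

Definition bump := window (c - K - 1) (c + K) 1.

Lemma smooth_bump : smooth bump. Proof. exact: smooth_window. Qed.

Lemma bump_itv x (K0 : 0 <= K) : 0 <= bump x <= 1.
Proof. by apply: window_itv => //; lra. Qed.

Lemma bump_eq1 x : `|x - c| <= K -> bump x = 1.
Proof.
by rewrite ler_norml => /andP[? ?]; apply: window_eq1 => //; rewrite invr1; lra.
Qed.

Lemma bump_eq0 x (K0 : 0 <= K) : K + 1 <= `|x - c| -> bump x = 0.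
Proof.
rewrite ler_normr => h; apply: window_eq0 => //; rewrite ?invr1; first lra.
by case/orP: h => h; apply/orP; [right|left]; lra.
Qed.

Lemma bump_deriveE x : derive1 bump x =
  derive1 step (x - (c - K - 1)) - derive1 step (x - (c + K)).
Proof. by rewrite window_derive !mul1r. Qed.

Lemma bump_derive_eq0 x (K0 : 0 <= K) : `|x - c| <= K -> derive1 bump x = 0.
Proof.
rewrite ler_norml => /andP[? ?]; rewrite bump_deriveE !step_derive_eq0 ?subrr//.
  by apply/orP; left; lra.
by apply/orP; right; lra.
Qed.

Lemma bump_derive_sign x (K0 : 0 <= K) : (x - c) * derive1 bump x <= 0.
Proof.
rewrite bump_deriveE; have [xc|xc] := leP x c.
  rewrite (step_derive_eq0 (x := x - (c + K))); last by apply/orP; left; lra.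
  by rewrite subr0 mulr_le0_ge0 ?step_derive_ge0//; lra.
rewrite (step_derive_eq0 (x := x - (c - K - 1))); last by apply/orP; right; lra.
by rewrite sub0r mulr_ge0_le0 ?oppr_le0 ?step_derive_ge0//; lra.
Qed.

Lemma bump_derive_neg x (K0 : 0 <= K) : K < `|x - c| < K + 1 -> (x - c) * derive1 bump x < 0.
Proof.
rewrite bump_deriveE; have [xc|xc] := leP x c.
  rewrite ler0_norm; last by lra.
  move=> h; rewrite (step_derive_eq0 (x := x - (c + K))); last by apply/orP; left; lra.
  by rewrite subr0 nmulr_rlt0 ?step_derive_gt0//; lra.
rewrite gtr0_norm; last by lra.
move=> h; rewrite (step_derive_eq0 (x := x - (c - K - 1))); last by apply/orP; right; lra.
by rewrite sub0r pmulr_rlt0 ?oppr_lt0 ?step_derive_gt0//; lra.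
Qed.

End bump.

(** * Products of a function of time and a function of space as test functions *)

Section tensor.
Context {R : realType}.
Implicit Types (f g : R * R -> R) (z v : R * R).

Lemma is_derive_line f z v d :
  is_derive (0 : R) 1 (fun h : R => f (h *: v + z)) d -> is_derive z v f d.
Proof.
move=> [df vdf].
have df' : derivable f z v by apply/derivable1P.
split => //; rewrite -vdf /derive.
set g1 := fun h => h^-1 *: _; set g2 := fun h => h^-1 *: _.
suff -> : g1 = g2 by [].
by rewrite funeqE /g1 /g2 => h /=; rewrite addr0 scale0r add0r [_%:A]mulr1.
Qed.

Lemma is_derive_tensor (th psi : R -> R) z v :
  (forall x : R, derivable th x 1) -> (forall x : R, derivable psi x 1) ->
  is_derive z v (fun z => th z.1 * psi z.2)
   (v.1 * derive1 th z.1 * psi z.2 + th z.1 * (v.2 * derive1 psi z.2)).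
Proof.
move=> dth dpsi; apply: is_derive_line => /=.
have d1 := derive1_affine (dth (v.1 * 0 + z.1)).
have d2 := derive1_affine (dpsi (v.2 * 0 + z.2)).
have d := is_deriveM d1 d2.
have -> : (fun h : R => th (h *: v.1 + z.1) * psi (h *: v.2 + z.2)) =
  ((fun y => th (v.1 * y + z.1)) \* (fun y => psi (v.2 * y + z.2))).
  by apply/funext => h /=; rewrite /GRing.scale/= ![h * _]mulrC.
apply: (is_derive_eq d); rewrite /GRing.scale/= !mulr0 !add0r addrC.
by rewrite [X in X + _]mulrC.
Qed.

Lemma of_classD k f g : of_class k f -> of_class k g ->
  of_class k (fun z => f z + g z).
Proof.
elim: k f g => [f g cf cg|k IH f g [cf df sf] [cg dg sg]].
  by move=> x; apply: continuousD; [exact: cf|exact: cg].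
split.
- by move=> x; apply: continuousD; [exact: cf|exact: cg].
- by move=> v z; exact: derivableD.
- move=> v; rewrite (_ : (fun z => _) = fun z => 'D_v f z + 'D_v g z).
    by apply: IH; [exact: sf|exact: sg].
  by apply/funext => z; rewrite deriveD.
Qed.

(** A directional derivative of a product th(t) psi(x) is a sum of two such products, so the
    induction closes once it is general in [th] and [psi]. *)
Lemma of_class_tensor k (th psi : R -> R) : smooth th -> smooth psi ->
  of_class k (fun z => th z.1 * psi z.2).
Proof.
elim: k th psi => [|k IH] th psi sth spsi.
  move=> z; apply: (@continuousM _ _ (fun z : R * R => th z.1) (fun z : R * R => psi z.2)).
    apply: (@continuous_comp _ _ _ fst th); first exact: cvg_fst.
    exact: smooth_continuous.
  apply: (@continuous_comp _ _ _ snd psi); first exact: cvg_snd.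
  exact: smooth_continuous.
have d z v := is_derive_tensor z v (fun x => @smooth_derivable _ _ x sth)
   (fun x => @smooth_derivable _ _ x spsi).
split.
- move=> z; apply: (@continuousM _ _ (fun z : R * R => th z.1) (fun z : R * R => psi z.2)).
    apply: (@continuous_comp _ _ _ fst th); first exact: cvg_fst.
    exact: smooth_continuous.
  apply: (@continuous_comp _ _ _ snd psi); first exact: cvg_snd.
  exact: smooth_continuous.
- by move=> v z; have [] := d z v.
- move=> v; rewrite (_ : (fun z => _) = fun z =>
    v.1 * derive1 th z.1 * psi z.2 + th z.1 * (v.2 * derive1 psi z.2)); last first.
    by apply/funext => z; have [_ ->] := d z v.
  apply: of_classD.
    apply: (IH (fun x => v.1 * derive1 th x)) => //.
    by apply: smoothM; [exact: smooth_cst|exact: smooth_derive].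
  apply: (IH th (fun x => v.2 * derive1 psi x)) => //.
  by apply: smoothM; [exact: smooth_cst|exact: smooth_derive].
Qed.

Lemma test_function_tensor (th psi : R -> R) (a b a' b' : R) :
  smooth th -> smooth psi -> 0 < a ->
  (forall x, th x != 0 -> x \in `[a, b]) ->
  (forall x, psi x != 0 -> x \in `[a', b']) ->
  test_function (fun z => th z.1 * psi z.2).
Proof.
move=> sth spsi a0 tha psia; split.
- by move=> k; exact: of_class_tensor.
- have C := compact_setX (@segment_compact R a b) (@segment_compact R a' b').
  apply: (subclosed_compact _ C); first exact: closed_closure.
  rewrite [X in _ `<=` X](closure_id _).1; last first.
    by apply: compact_closed C; exact: norm_hausdorff.
  apply: closureS => z /=; rewrite mulf_eq0 negb_or => /andP[/tha ? /psia ?].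
  by split.
- have C := compact_setX (@segment_compact R a b) (@segment_compact R a' b').
  apply: (@subset_trans _ (`[a, b] `*` `[a', b'])).
    rewrite [X in _ `<=` X](closure_id _).1; last first.
      by apply: compact_closed C; exact: norm_hausdorff.
    apply: closureS => z /=; rewrite mulf_eq0 negb_or => /andP[/tha ? /psia ?].
    by split.
  by move=> z [/= /itvP z1 _]; rewrite (lt_le_trans a0)// z1.
Qed.

End tensor.

(** * A Gronwall inequality for weak derivatives *)

(* No measurability is needed: by definition, the integral of a nonnegative
   function is a supremum over the simple functions below it. *)
Lemma integral_mono d (T : measurableType d) (R : realType)
    (mu : {measure set T -> \bar R}) (D : set T) (f g : T -> \bar R) :
  (forall x, D x -> f x <= g x)%E ->
  (\int[mu]_(x in D) f x <= \int[mu]_(x in D) g x)%E.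
Proof.
move=> fg.
have fgD x : ((f \_ D) x <= (g \_ D) x)%E.
  by rewrite !patchE; case: ifPn => // /set_mem; exact: fg.
rewrite /integral; apply: leeB.
  apply: le_ereal_sup => _ [h hf <-]; exists h => // x.
  by apply: (le_trans (hf x)); rewrite !funeposE; rewrite ge_max; apply/andP; split;
    rewrite le_max ?fgD ?lexx ?orbT.
apply: le_ereal_sup => _ [h hf <-]; exists h => // x.
by apply: (le_trans (hf x)); rewrite !funenegE; rewrite ge_max; apply/andP; split;
    rewrite le_max ?leeN2 ?fgD ?lexx ?orbT.
Qed.

Section ftc.
Context {R : realType}.
Local Notation lam := (@lebesgue_measure R).

Lemma smooth_FTC (Q : R -> R) (a b : R) : a < b -> smooth Q ->
  (\int[lam]_(x in `[a, b]) (derive1 Q x)%:E = (Q b - Q a)%:E)%E.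
Proof.
move=> ab sQ; rewrite (@continuous_FTC2 _ _ Q)//.
- by apply: continuous_subspaceT; apply: smooth_continuous; exact: smooth_derive.
- have cQ := smooth_continuous sQ.
  split; first by move=> x _; exact: smooth_derivable.
  + by apply: cvg_at_right_filter; exact: cQ.
  + by apply: cvg_at_left_filter; exact: cQ.
Qed.

Lemma integral_off (A B : set R) (f : R -> \bar R) : A `<=` B ->
  (forall x, B x -> ~ A x -> f x = 0%E) ->
  (\int[lam]_(x in B) f x = \int[lam]_(x in A) f x)%E.
Proof.
move=> AB f0; rewrite integral_mkcond [RHS]integral_mkcond.
congr integral; apply/funext => x; rewrite !patchE.
case: ifPn => [/set_mem Bx|/negP nB]; case: ifPn => [/set_mem Ax|/negP nA] //.
  by apply: f0 => // Ax; apply: nA; rewrite mem_set.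
by exfalso; apply: nB; rewrite mem_set//; exact: AB.
Qed.

End ftc.

Section weak_gronwall.
Context {R : realType}.
Local Notation lam := (@lebesgue_measure R).
Variables (F G : R -> R) (a c T0 T1 : R).

Definition right_continuous_at (H : R -> R) (s : R) :=
  forall e, 0 < e -> exists2 d : R, 0 < d & forall x, s <= x <= s + d -> `|H x - H s| <= e.

Lemma right_continuous_at_cvg (H : R -> R) s :
  H x @[x --> s^'+] --> H s -> right_continuous_at H s.
Proof.
move=> /cvgrPdist_le h e e0.
have [d /= d0 hd] := h e e0.
exists (d / 2) => [|x /andP[sx xs]]; first by rewrite divr_gt0.
move: sx; rewrite le_eqVlt => /predU1P[<-|sx]; first by rewrite subrr normr0 ltW.
rewrite distrC; apply: hd => //=.
rewrite ltr0_norm; last by rewrite subr_lt0.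
rewrite opprB ltrBlDl (le_lt_trans xs)// ltrD2l ltr_pdivrMr// mulr_natr mulr2n.
by rewrite ltrDl.
Qed.

Lemma right_continuous_atM (H K : R -> R) s :
  right_continuous_at H s -> right_continuous_at K s ->
  right_continuous_at (fun x => H x * K x) s.
Proof.
move=> rH rK e e0.
pose e1 := Num.min 1 (e / (1 + `|H s| + `|K s|)).
have D0 : 0 < 1 + `|H s| + `|K s| by rewrite ltr_wpDr// ltr_wpDr.
have e10 : 0 < e1 by rewrite lt_min ltr01 divr_gt0.
have [d1 d10 h1] := rH _ e10; have [d2 d20 h2] := rK _ e10.
exists (Num.min d1 d2) => [|x /andP[sx xs]]; first by rewrite lt_min d10.
have x1 : s <= x <= s + d1 by rewrite sx (le_trans xs)// lerD2l ge_min lexx.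
have x2 : s <= x <= s + d2 by rewrite sx (le_trans xs)// lerD2l ge_min lexx orbT.
have {}h1 := h1 x x1; have {}h2 := h2 x x2.
have -> : H x * K x - H s * K s = (H x - H s) * (K x - K s) +
  H s * (K x - K s) + (H x - H s) * K s by ring.
have : e1 * (1 + `|H s| + `|K s|) <= e by rewrite -ler_pdivlMr// ge_min lexx orbT.
apply: le_trans; rewrite [leRHS]mulrDr [X in _ <= X + _]mulrDr mulr1.
rewrite (le_trans (ler_normD _ _))// lerD//; last by rewrite normrM ler_wpM2r.
rewrite (le_trans (ler_normD _ _))// lerD//; last by rewrite normrM mulrC ler_wpM2r.
rewrite normrM -[e1]mulr1 ler_pM// (le_trans h2)// ge_min lexx//.
Qed.

Hypothesis T00 : 0 <= T0.
Hypothesis rF : forall s, T0 <= s -> right_continuous_at F s.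
Hypothesis GF : forall t, T0 < t -> t < T1 -> G t <= a * (c - F t).
Hypothesis weak : forall (th : R -> R) s t, T0 < s -> s < t -> t < T1 ->
  smooth th -> (forall x, 0 <= th x) -> (forall x, th x != 0 -> x \in `[s, t]) ->
  (0 <= \int[lam]_(x in `]0%R, +oo[) (derive1 th x * F x + th x * G x)%:E)%E.

Let H t := expR (a * t) * (F t - c).

Let rH s : T0 <= s -> right_continuous_at H s.
Proof.
move=> Ts; apply: right_continuous_atM.
  apply: right_continuous_at_cvg; apply: cvg_at_right_filter.
  exact: (smooth_continuous (smooth_expM a)).
move=> e e0; have [d d0 h] := rF Ts e0; exists d => // x /h.
by rewrite opprB addrA subrK.
Qed.

(** Testing with e^(a x) times a window leaves, up to an exact derivative, the derivative of the
    window against [H]: an average of [H] just after [s] minus one just after [t], which must be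
    nonnegative. Since [F] and [G] are arbitrary functions, the integrand is compared pointwise with
    [derive1 Q] for an explicit smooth [Q], whose integral is known. *)
Let weak_gronwall_oo s t : T0 < s -> s < t -> t < T1 -> H t <= H s.
Proof.
move=> Ts st tT; rewrite leNgt; apply/negP => Hst.
(* A third of the gap: each ramp costs one [e], so [Q] changes over [s, t + k] by H s + e + e - H t
   = - e < 0. *)
pose e := (H t - H s) / 3.
have e0 : 0 < e by rewrite divr_gt0// subr_gt0.
have [d1 d10 h1] := rH (ltW Ts) e0.
have [d2 d20 h2] := rH (ltW (lt_trans Ts st)) e0.
pose k : R := Num.min (Num.min d1 d2) (Num.min ((t - s) / 2) ((T1 - t) / 2)).
have k0 : 0 < k by rewrite !lt_min d10 d20 !divr_gt0 ?subr_gt0.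
have kd1 : k <= d1 by rewrite !ge_min lexx.
have kd2 : k <= d2 by rewrite !ge_min lexx orbT.
have kst : k < t - s.
  have : k <= (t - s) / 2 by rewrite !ge_min lexx !orbT.
  by move/le_lt_trans; apply; rewrite ltr_pdivrMr// mulr_natr mulr2n ltrDl subr_gt0.
have ktT : k < T1 - t.
  have : k <= (T1 - t) / 2 by rewrite !ge_min lexx !orbT.
  by move/le_lt_trans; apply; rewrite ltr_pdivrMr// mulr_natr mulr2n ltrDl subr_gt0.
pose d : R := k^-1.
have d0 : 0 < d by rewrite invr_gt0.
pose w := window s t d.
have sw : smooth w by exact: smooth_window.
pose th x := expR (a * x) * w x.
have sth : smooth th by exact: smoothM (smooth_expM a) sw.
(* The first term handles the ramp after [s], where H <= H s + e, the second the ramp after [t],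
   where H >= H t - e, and the third carries the constant [c]. *)
pose Q (x : R) : R := (H s + e) * step (d * x + (- (d * s))) + (e - H t) * step (d * x + (- (d * t))) + c * th x.
have sQ : smooth Q.
  apply: smoothD; last by apply: smoothM => //; exact: smooth_cst.
  apply: smoothD; apply: smoothM; (try exact: smooth_cst);
    exact: smooth_affine smooth_step.
have th_itv x : th x != 0 -> x \in `[s, t + k].
  move=> thx; rewrite in_itv/=; apply/andP; split; rewrite leNgt; apply/negP => hx;
  move/eqP: thx; apply; rewrite /th /w window_eq0 ?mulr0 ?(ltW st)//.
    by rewrite (ltW hx).
  by rewrite /d invrK (ltW hx) orbT.
have dthE x : derive1 th x = expR (a * x) * (a * w x + derive1 w x).
  have de : is_derive x 1 (fun x : R => expR (a * x)) (a * expR (a * x)).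
    have := derive1_affine (@derivable_expR R (a * x + 0)).
    have [_ vE] := is_derive_expR (a * x + 0).
    by rewrite derive1E vE; under eq_fun do rewrite addr0; rewrite addr0.
  have dm : is_derive x 1 th _ := is_deriveM de (smooth_is_derive x sw).
  have [_ vE] := dm; rewrite derive1E vE /GRing.scale/=; ring.
have dQE x : derive1 Q x = (H s + e) * (d * derive1 step (d * (x - s)))
    - (H t - e) * (d * derive1 step (d * (x - t))) + c * derive1 th x.
  have e1 := derive1_affine (@smooth_derivable _ _ (d * x + (- (d * s))) (@smooth_step R)).
  have e2 := derive1_affine (@smooth_derivable _ _ (d * x + (- (d * t))) (@smooth_step R)).
  have e3 := smooth_is_derive x sth.
  have dm : is_derive x 1 Q _ := is_deriveD (is_deriveD (@is_deriveZ _ _ R _ (H s + e) x 1 _ e1)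
    (@is_deriveZ _ _ R _ (e - H t) x 1 _ e2)) (@is_deriveZ _ _ R _ c x 1 _ e3).
  by have [_ vE] := dm; rewrite [LHS]derive1E vE /GRing.scale/= -!mulrBr; ring.
have key x : derive1 th x * F x + th x * (a * (c - F x)) <= derive1 Q x.
  have -> : derive1 th x * F x + th x * (a * (c - F x)) =
    derive1 w x * H x + c * derive1 th x by rewrite dthE /th /H; ring.
  rewrite dQE lerD2r /w window_derive mulrBr mulrBl.
  have dS y : d * (x - y) = (x - y) / k by rewrite mulrC.
  apply: lerB.
    rewrite [leRHS]mulrC; have [xs|xs] := boolP (s <= x <= s + d1).
      apply: ler_wpM2l; first by rewrite mulr_ge0 ?step_derive_ge0 ?ltW.
      by have := h1 x xs; rewrite ler_norml => /andP[_]; rewrite lerBlDl.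
    rewrite step_derive_eq0 ?mulr0 ?mul0r// dS pmulr_lle0 ?invr_gt0// subr_le0.
    move: xs; rewrite negb_and -!ltNge => /orP[/ltW->//|xs].
    by rewrite ler_pdivlMr// mul1r lerBrDl (le_trans _ (ltW xs)) ?orbT// lerD2l.
  rewrite mulrC; have [xs|xs] := boolP (t <= x <= t + d2).
    apply: ler_wpM2l; first by rewrite mulr_ge0 ?step_derive_ge0 ?ltW.
    by have := h2 x xs; rewrite ler_norml => /andP[+ _]; rewrite lerBrDr addrC.
  rewrite step_derive_eq0 ?mulr0 ?mul0r// dS pmulr_lle0 ?invr_gt0// subr_le0.
  move: xs; rewrite negb_and -!ltNge => /orP[/ltW->//|xs].
  by rewrite ler_pdivlMr// mul1r lerBrDl (le_trans _ (ltW xs)) ?orbT// lerD2l.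
have tkT : t + k < T1 by rewrite -ltrBrDl.
have stk : s < t + k by rewrite ltr_wpDr// ltW.
have := weak Ts stk tkT sth _ th_itv.
have th0 x : 0 <= th x.
  by rewrite mulr_ge0 ?expR_ge0//; have /andP[] := window_itv x d0 (ltW st).
move=> /(_ th0); apply/negP; rewrite -ltNge.
have th_off x : ~ `[s, t + k]%classic x -> th x = 0.
  by move=> nx; apply/eqP; apply: contra_notT nx => /th_itv.
rewrite (@integral_off _ `[s, t + k]); first last.
- move=> x _ nx; rewrite th_off// mul0r addr0.
  rewrite dthE; move: (th_off _ nx) => /eqP.
  rewrite mulf_eq0 (gt_eqF (expR_gt0 _))/= => /eqP wx.
  have -> : derive1 w x = 0.
    rewrite /w window_derive !step_derive_eq0 ?subrr ?mulr0//.
      move: nx; rewrite /= in_itv/= => /negP; rewrite negb_and -!ltNge => /orP[xs|xs].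
        by rewrite pmulr_rle0// subr_le0 (ltW (lt_trans xs st)).
      by apply/orP; right; rewrite mulrC ler_pdivlMr// mul1r lerBrDl ltW.
    move: nx; rewrite /= in_itv/= => /negP; rewrite negb_and -!ltNge => /orP[xs|xs].
      by rewrite pmulr_rle0// subr_le0 (ltW xs).
    apply/orP; right; rewrite mulrC ler_pdivlMr// mul1r lerBrDl.
    by rewrite (le_trans _ (ltW xs))// lerD2r ltW.
  by rewrite wx mulr0 addr0 mulr0 mul0r.
- by move=> x /=; rewrite !in_itv/= => /andP[sx _]; rewrite andbT (le_lt_trans T00)// (lt_le_trans Ts).
apply: (@le_lt_trans _ _ (\int[lam]_(x in `[s, (t + k)%R]) (derive1 Q x)%:E)%E).
  apply: integral_mono => x; rewrite /= in_itv/= => /andP[sx xt]; rewrite lee_fin.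
  apply: le_trans (key x); rewrite lerD2l ler_wpM2l// GF//.
    exact: lt_le_trans Ts sx.
  exact: le_lt_trans xt tkT.
rewrite smooth_FTC// lte_fin /Q.
have -> : th (t + k) = 0.
  by rewrite /th /w window_eq0 ?mulr0 ?(ltW st)// /d invrK lexx orbT.
have -> : th s = 0 by rewrite /th /w window_eq0 ?mulr0 ?(ltW st)// lexx.
rewrite -!mulrBr.
rewrite (step_le0 (x := d * (s - s))) ?subrr ?mulr0//.
rewrite (step_le0 (x := d * (s - t))); last by rewrite pmulr_rle0// subr_le0 ltW.
rewrite (step_ge1 (x := d * (t + k - t))); last first.
  by rewrite addrAC subrr add0r mulVf ?gt_eqF.
rewrite (step_ge1 (x := d * (t + k - s))); last first.
  by rewrite mulrC ler_pdivlMr// mul1r lerBrDl lerD2r ltW.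
by rewrite /e; lra.
Qed.

Lemma weak_gronwall s t : T0 <= s -> s <= t -> t < T1 ->
  expR (a * t) * (F t - c) <= expR (a * s) * (F s - c).
Proof.
rewrite -!/(H _) => Ts; rewrite le_eqVlt => /predU1P[->//|st] tT.
have [Ts'|] := ltP T0 s; first exact: weak_gronwall_oo.
(* Here s = T0, where the open version does not apply; it is used from a slightly later time, at
   which [H] is close to [H s]. *)
move=> sT; apply/ler_addgt0Pl => e e0.
have [d d0 h] := rH Ts e0.
pose x := s + Num.min d ((t - s) / 2).
have k0 : 0 < Num.min d ((t - s) / 2) by rewrite lt_min d0 divr_gt0// subr_gt0.
have xt : x < t.
  rewrite /x -ltrBrDl (@le_lt_trans _ _ ((t - s) / 2))// ?ge_min ?lexx ?orbT//.
  by rewrite ltr_pdivrMr// mulr_natr mulr2n ltrDl subr_gt0.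
have sx : s < x by rewrite /x ltrDl.
apply: (le_trans (weak_gronwall_oo (le_lt_trans Ts sx) xt tT)).
have := h x; rewrite (ltW sx) /x lerD2l ge_min lexx => /(_ isT).
by rewrite ler_norml lerBlDr => /andP[_].
Qed.

End weak_gronwall.

(** * The convexity modulus *)

Section convexity_modulus.
Context {R : realType}.

Lemma inf_image_le n (f : 'I_n -> R) (A : set 'I_n) j : A j ->
  inf [set f j | j in A] <= f j.
Proof.
move=> Aj; apply: ge_inf; last by exists j.
exists (- \sum_k `|f k|) => _ [k _ <-].
rewrite lerNl (bigD1 k)//= (le_trans (ler_norm _))// normrN lerDl.
exact: sumr_ge0.
Qed.

Variables (n : nat) (m p : 'I_n.+1 -> R) (kappa : 'M[R]_n.+1).
Hypothesis m_gt0 : forall i, 0 < m i.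
Hypothesis p_gt0 : forall i, 0 < p i.
Hypothesis kappa_sym : kappa^T = kappa.

Let kappaC i j : kappa i j = kappa j i.
Proof. by rewrite -[in LHS]kappa_sym mxE. Qed.

Let eta_le i j : j != i -> eta m kappa i <= kappa i j * m j.
Proof. by move=> ji; exact: (@inf_image_le _ (fun j => kappa i j * m j)). Qed.

Let L i := p i * Num.min 0 (m i * kappa i i - eta m kappa i) +
  2^-1 * \sum_j p j * (eta m kappa j + eta m kappa i * (m i / m j)).

Let lambda0_le i : n != 0%N -> lambda0 m p kappa <= L i.
Proof.
by move=> /negPf n0; rewrite /lambda0 n0; exact: (@inf_image_le _ L).
Qed.

(** The average of two lower bounds for m_i kappa_ij: eta_j, by the symmetry of [kappa], and eta_i
    m_i / m_j. *)
Let kappa_ge i j : j != i ->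
  2^-1 * (eta m kappa j + eta m kappa i * (m i / m j)) <= m i * kappa i j.
Proof.
move=> ji; rewrite mulrC ler_pdivrMr// mulr_natr mulr2n lerD//.
  by rewrite mulrC kappaC eta_le// eq_sym.
by rewrite mulrCA ler_wpM2l ?(ltW (m_gt0 i))// ler_pdivrMr// eta_le.
Qed.

(** The minimum is at most m_i kappa_ii - eta_i, and the diagonal term of the sum contributes p_i
    eta_i, so together they give at most m_i kappa_ii p_i; the other indices are [kappa_ge]. This
    form of the modulus drives all pointwise estimates on the drift. *)
Lemma lambda0_le_sum i : lambda0 m p kappa <= m i * \sum_j kappa i j * p j.
Proof.
have [n0|n0] := eqVneq n 0%N.
  have le1 : (n.+1 <= 1)%N by rewrite n0.
  have I1 : forall j : 'I_n.+1, j = ord0.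
    by move=> j; apply/val_inj => /=; case: j => -[|j] //= /leq_trans/(_ le1).
  rewrite /lambda0 ifT ?n0// (I1 i) (bigD1 ord0)//= big1 ?addr0 ?mulrA//.
  by move=> j; rewrite (I1 j) eqxx.
apply: (le_trans (lambda0_le i n0)); rewrite /L (bigD1 i)//=.
rewrite [X in _ <= _ * X](bigD1 i)//= divff ?gt_eqF// mulr1.
have h1 : p i * Num.min 0 (m i * kappa i i - eta m kappa i) <=
    p i * (m i * kappa i i - eta m kappa i).
  by rewrite ler_wpM2l ?(ltW (p_gt0 i))// ge_min lexx orbT.
have h2 : 2^-1 * \sum_(j < n.+1 | j != i) p j *
      (eta m kappa j + eta m kappa i * (m i / m j)) <=
    m i * \sum_(j < n.+1 | j != i) kappa i j * p j.
  rewrite !mulr_sumr; apply: ler_sum => j ji.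
  rewrite mulrCA [kappa i j * _]mulrC [leRHS]mulrCA.
  by rewrite ler_wpM2l ?(ltW (p_gt0 j))// kappa_ge.
lra.
Qed.

(* [a i] and [S i] are the first and second moments of [nu i] about [x_oo], so
   that [p j * S i + p i * S j - 2 * a i * a j] is the double integral of
   [(x - y) ^+ 2]. Replacing [kappa i j] for [j != i] by the smaller
   [2^-1 * (eta j / m i + eta i / m j)] makes the terms [a i * a j] sum to zero. *)
Lemma lambda0_quadratic (S a : 'I_n.+1 -> R) :
  (forall i j, 0 <= p j * S i + p i * S j - 2 * a i * a j) ->
  \sum_i (m i)^-1 * a i = 0 ->
  2 * lambda0 m p kappa * \sum_i (m i)^-1 * S i <=
  \sum_i \sum_j kappa i j * (p j * S i + p i * S j - 2 * a i * a j).
Proof.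
move=> D0 a0.
pose D i j := p j * S i + p i * S j - 2 * a i * a j.
have S0 i : 0 <= S i.
  have := D0 i i; have := sqr_ge0 (a i); have := p_gt0 i.
  rewrite -mulrA -expr2 => pi ai h.
  have : 0 <= p i * S i by lra.
  by rewrite pmulr_rge0.
have [n0|n0] := eqVneq n 0%N.
  have le1 : (n.+1 <= 1)%N by rewrite n0.
  have I1 : forall j : 'I_n.+1, j = ord0.
    by move=> j; apply/val_inj => /=; case: j => -[|j] //= /leq_trans/(_ le1).
  have sum1 (f : 'I_n.+1 -> R) : \sum_i f i = f ord0.
    by rewrite (bigD1 ord0)//= big1 ?addr0// => j; rewrite (I1 j) eqxx.
  move: a0; rewrite !sum1 => /eqP; rewrite mulf_eq0 invr_eq0 gt_eqF//= => /eqP ->.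
  rewrite /lambda0 ifT ?n0// mulr0 subr0.
  have -> : 2 * (m ord0 * kappa ord0 ord0 * p ord0) * ((m ord0)^-1 * S ord0) =
    (m ord0 * (m ord0)^-1) * (2 * kappa ord0 ord0 * p ord0 * S ord0) by ring.
  by rewrite divff ?gt_eqF//; lra.
pose e := eta m kappa.
pose mn i := Num.min 0 (m i * kappa i i - e i).
(* On the diagonal kappa_ii >= (e_i + mn_i) / m_i; since mn_i <= 0, it may multiply the larger 2 p_i
   S_i in place of [D i i]. *)
apply: (@le_trans _ _ (\sum_i \sum_j (2^-1 * (e j / m i + e i / m j)) * D i j +
   \sum_i mn i / m i * (2 * p i * S i))); last first.
  rewrite -big_split/=; apply: ler_sum => i _.
  rewrite (bigD1 i)//= [leRHS](bigD1 i)//= addrAC lerD//.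
    have -> : 2^-1 * (e i / m i + e i / m i) = e i / m i by lra.
    apply: (@le_trans _ _ (e i / m i * D i i + mn i / m i * D i i)).
      rewrite lerD2l; apply: ler_wnM2l.
        by rewrite pmulr_lle0 ?invr_gt0// /mn ge_min lexx.
      by rewrite /D; have := sqr_ge0 (a i); lra.
    rewrite -mulrDl -mulrDl ler_wpM2r//; first exact: D0.
    rewrite ler_pdivrMr// [leRHS]mulrC -lerBrDl /mn ge_min lexx orbT//.
  apply: ler_sum => j ji; apply: ler_wpM2r; first exact: D0.
  have := kappa_ge ji; rewrite -/e => h.
  rewrite -(ler_pM2l (m_gt0 i)); apply: le_trans h.
  have mi0 : m i != 0 by rewrite gt_eqF.
  have mj0 : m j != 0 by rewrite gt_eqF.
  rewrite le_eqVlt; apply/orP; left; apply/eqP; field; by rewrite mi0 mj0.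
have swap (f : 'I_n.+1 -> 'I_n.+1 -> R) : \sum_i \sum_j f i j = \sum_i \sum_j f j i.
  by rewrite exchange_big.
have -> : \sum_i \sum_j (2^-1 * (e j / m i + e i / m j)) * D i j =
    \sum_i \sum_j e i / m j * D i j.
  transitivity (2^-1 * (\sum_i \sum_j e j / m i * D i j) +
      2^-1 * (\sum_i \sum_j e i / m j * D i j)).
    rewrite !mulr_sumr -big_split/=; apply: eq_bigr => i _.
    rewrite !mulr_sumr -big_split/=; apply: eq_bigr => j _; ring.
  have -> : \sum_i \sum_j e j / m i * D i j = \sum_i \sum_j e i / m j * D i j.
    by rewrite swap; apply: eq_bigr => i _; apply: eq_bigr => j _; rewrite /D; ring.
  by lra.
have -> : \sum_i \sum_j e i / m j * D i j =
    \sum_i \sum_j S i / m i * (p j * (e j + e i * (m i / m j))).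
  transitivity (\sum_i \sum_j e i / m j * (p j * S i) + \sum_i \sum_j e i / m j * (p i * S j)
     - 2 * \sum_i (e i * a i * \sum_j (m j)^-1 * a j)).
    rewrite -big_split/= mulr_sumr -sumrB; apply: eq_bigr => i _.
    rewrite !mulr_sumr -big_split/= -sumrB; apply: eq_bigr => j _.
    rewrite /D; ring.
  rewrite a0; under [X in 2 * X]eq_bigr => i _ do rewrite mulr0.
  rewrite big1_eq mulr0 subr0 [X in _ + X]swap -big_split/=.
  apply: eq_bigr => i _; rewrite -big_split/=; apply: eq_bigr => j _.
  by field; rewrite !gt_eqF.
rewrite -big_split/= !mulr_sumr; apply: ler_sum => i _.
rewrite -mulr_sumr.
have -> : S i / m i * (\sum_j p j * (e j + e i * (m i / m j))) + mn i / m i * (2 * p i * S i)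
  = 2 * (S i / m i) * L i by rewrite /L -/e -/(mn i); lra.
rewrite [X in _ * X]mulrC [leLHS]mulrAC; apply: ler_wpM2l; last exact: lambda0_le.
by rewrite mulr_ge0// divr_ge0// ltW.
Qed.

End convexity_modulus.

(** * The interaction forces *)

Section modulus.
Context {R : realType}.

(* The quadratic term absorbs the pairs of points that are not close. *)
Lemma continuous_modulus (f : R -> R) (K e : R) : continuous f -> 0 < e ->
  exists2 C, 0 <= C & forall x y, `|x| <= K -> `|y| <= K ->
    `|f x - f y| <= e + C * (x - y) ^+ 2.
Proof.
move=> cf e0.
have [K0|K0] := ltP K 0.
  by exists 0 => // x y xK; have := le_lt_trans (le_trans (normr_ge0 x) xK) K0; rewrite ltxx.
(* Otherwise every C = n has a bad pair of points, and these pairs cluster at some (p, q) in the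
   square. Boundedness of [f] makes n (x - y)^2 bounded along them, which forces p = q; continuity
   at p then contradicts the gap [e]. *)
apply: contrapT => H.
have nH (n : nat) : exists z : R * R, [/\ `|z.1| <= K, `|z.2| <= K &
    e + n%:R * (z.1 - z.2) ^+ 2 < `|f z.1 - f z.2|].
  apply: contrapT => nz; apply: H; exists n%:R => // x y xK yK.
  rewrite leNgt; apply/negP => h; apply: nz; exists (x, y); split => //.
pose z n := xget (0, 0) [set z : R * R | [/\ `|z.1| <= K, `|z.2| <= K &
    e + n%:R * (z.1 - z.2) ^+ 2 < `|f z.1 - f z.2|]].
have zP n : [/\ `|(z n).1| <= K, `|(z n).2| <= K &
    e + n%:R * ((z n).1 - (z n).2) ^+ 2 < `|f (z n).1 - f (z n).2|].
  by have := xgetPex (0, 0) (nH n).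
have cpt := compact_setX (@segment_compact R (- K) K) (@segment_compact R (- K) K).
have zin : (z @ \oo) (`[- K, K]%classic `*` `[- K, K]%classic).
  exists 0%N => // n _; have [h1 h2 _] := zP n.
  by split; rewrite /= in_itv/= -ler_norml.
have [[p q] [_ pq]] := cpt (z @ \oo) _ zin.
have [M M0 fM] : exists2 M, 0 < M & forall x, `|x| <= K -> `|f x| <= M.
  have [M [Mr hM]] := compact_bounded (continuous_compact (continuous_subspaceT cf)
     (@segment_compact R (- K) K)).
  exists (`|M| + 1) => [|x xK]; first by rewrite ltr_wpDl.
  apply: hM; first by rewrite (le_lt_trans (ler_norm M))// ltrDl.
  by exists x => //=; rewrite in_itv/= -ler_norml.
have pqE : p = q.
  apply/eqP; rewrite -subr_eq0; apply/eqP; apply: contrapT => /eqP pq0.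
  pose d := `|p - q| / 4.
  have d0 : 0 < d by rewrite divr_gt0// normr_gt0.
  pose N := (Num.truncn (2 * M / d ^+ 2)).+1.
  have [] := pq [set z n | n in [set n | (N <= n)%N]] (ball p d `*` ball q d).
  - by exists N => // n /= Nn; exists n.
  - exists (ball p d, ball q d) => //=; split; exact: nbhsx_ballx.
  move=> _ [[n /= Nn <-] [/= hp hq]].
  have [h1 h2] := zP n; apply/negP; rewrite -leNgt.
  have : `|f (z n).1 - f (z n).2| <= 2 * M.
    by rewrite (le_trans (ler_normB _ _))// mulr_natl mulr2n lerD// fM.
  move=> /le_trans; apply.
  have dn : d <= `|(z n).1 - (z n).2|.
    have : `|p - q| <= `|p - (z n).1| + `|(z n).1 - (z n).2| + `|(z n).2 - q|.
      have -> : p - q = (p - (z n).1 + ((z n).1 - (z n).2)) + ((z n).2 - q) by ring.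
      by rewrite (le_trans (ler_normD _ _))// lerD2r ler_normD.
    move: hp hq; rewrite /ball/= => hp; rewrite distrC => hq.
    have -> : `|p - q| = 4 * d by rewrite /d; lra.
    by move=> h; lra.
  rewrite ler_wpDl ?(ltW e0)//.
  have d2 : d ^+ 2 <= ((z n).1 - (z n).2) ^+ 2.
    rewrite -[leRHS]real_normK ?num_real//; apply: lerXn2r; rewrite ?nnegrE//.
    exact: ltW.
  have nN : 2 * M / d ^+ 2 <= n%:R.
    rewrite ltW// (lt_le_trans (truncnS_gt _))// ler_nat.
    exact: Nn.
  rewrite (@le_trans _ _ (n%:R * d ^+ 2))//; last by rewrite ler_wpM2l.
  by rewrite -ler_pdivrMr// exprn_gt0.
have e20 : 0 < e / 2 by rewrite divr_gt0.
have /cvgrPdist_lt/(_ _ e20) fp := cf p.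
have [] := pq (range z) ([set x | `|f p - f x| < e / 2] `*` [set x | `|f p - f x| < e / 2]).
- by exists 0%N => // n _; exists n.
- by exists ([set x | `|f p - f x| < e / 2], [set x | `|f p - f x| < e / 2]) => //=; split => //; rewrite -pqE.
move=> _ [[n _ <-] [/= hp hq]].
have [_ _] := zP n; apply/negP; rewrite -leNgt.
have : `|f (z n).1 - f (z n).2| <= `|f p - f (z n).1| + `|f p - f (z n).2|.
  have -> : f (z n).1 - f (z n).2 = (f p - f (z n).2) - (f p - f (z n).1) by ring.
  by rewrite [leRHS]addrC ler_normB.
have : 0 <= n%:R * ((z n).1 - (z n).2) ^+ 2 by rewrite mulr_ge0// sqr_ge0.
by move=> h1 h2; lra.
Qed.

(** Near 0 continuity gives [e]; at distance at least d the constant 1 in the growth bound is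
    absorbed by z^2 / d^2. *)
Lemma continuous_vanish_bound (f : R -> R) (C e : R) : continuous f -> f 0 = 0 ->
  0 <= C -> (forall z, `|f z| <= C * (1 + z ^+ 2)) -> 0 < e ->
  exists2 B, 0 <= B & forall z, `|f z| <= e + B * z ^+ 2.
Proof.
move=> cf f0 C0 fC e0.
have /cvgrPdist_lt/(_ _ e0) [d /= d0 fd] := cf 0.
exists (C * (1 + d ^- 2)) => [|z].
  by rewrite mulr_ge0// addr_ge0// invr_ge0 exprn_ge0// ltW.
have [zd|zd] := ltP `|z| d.
  have := fd z; rewrite /= sub0r normrN => /(_ zd); rewrite f0 sub0r normrN => /ltW h.
  by rewrite (le_trans h)// lerDl mulr_ge0 ?sqr_ge0// mulr_ge0// addr_ge0// invr_ge0 exprn_ge0// ltW.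
rewrite (le_trans (fC z))// ler_wpDl ?(ltW e0)// -mulrA ler_wpM2l// mulrDl mul1r addrC lerD2l.
rewrite mulrC ler_pdivlMr ?exprn_gt0// mul1r -[leRHS]real_normK ?num_real//.
by apply: lerXn2r; rewrite ?nnegrE// ltW.
Qed.

End modulus.

Lemma fin_uniform (R : realType) n (P : 'I_n -> R -> Prop) :
  (forall i C D, C <= D -> P i C -> P i D) ->
  (forall i, exists2 C, 0 <= C & P i C) -> exists2 C, 0 <= C & forall i, P i C.
Proof.
move=> mono ex.
have /choice[C HC] : forall i, exists C, 0 <= C /\ P i C.
  by move=> i; have [C C0 PC] := ex i; exists C.
exists (\sum_i C i) => [|i]; first by apply: sumr_ge0 => i _; have [] := HC i.
apply: mono (HC i).2; rewrite (bigD1 i)//= lerDl.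
by apply: sumr_ge0 => j _; have [] := HC j.
Qed.

Section admissible.
Context {R : realType}.
Variables (n : nat) (W : R -> 'M[R]_n) (kappa : 'M[R]_n).
Hypothesis W_adm : admissible W kappa.

Definition force i j : R -> R := derive1 (fun z => W z i j).

Lemma force_continuous i j : continuous (force i j).
Proof. exact: (adm_continuous W_adm). Qed.

Lemma forceC i j : force i j = force j i.
Proof.
rewrite /force; congr derive1; apply/funext => z.
by rewrite -[in LHS](adm_sym W_adm) mxE.
Qed.

Lemma forceN i j z : force i j (- z) = - force i j z.
Proof.
rewrite /force [X in derive1 X _ = _](_ : _ = (fun z => W z i j) \o -%R); last first.
  by apply/funext => y /=; rewrite -(adm_even W_adm).
rewrite derive1_comp//; last exact: (adm_derivable W_adm).
by rewrite derive1N// derive1_id opprK mulrN1.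
Qed.

Lemma force0 i j : force i j 0 = 0.
Proof. by have := forceN i j 0; rewrite oppr0 => h; lra. Qed.

Let f i j z : R := W z i j - 2^-1 * kappa i j * `|z| ^+ 2.

(** By convexity, the difference quotients from x towards y are at most f y - f x, and their limit
    from the right is the derivative in the direction y - x. *)
Let f_tangent i j x y : f i j x + (force i j x - kappa i j * x) * (y - x) <= f i j y.
Proof.
have dW := @adm_derivable _ _ _ _ W_adm i j x.
have df : is_derive x 1 (f i j) (force i j x - kappa i j * x).
  have dW' : is_derive x 1 (fun z => W z i j) (force i j x).
    by rewrite /force derive1E; exact: derivableP.
  have dX := @is_deriveZ _ _ R _ (- (2^-1 * kappa i j)) x 1 _ (is_deriveX 2 (is_derive_id x (1 : R))).
  have dD := is_deriveD dW' dX.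
  rewrite (_ : f i j = (fun z => W z i j) + (- (2^-1 * kappa i j) \*: (id ^+ 2))); last first.
    by apply/funext => z; rewrite /f real_normK ?num_real// -mulNr.
  apply: (is_derive_eq dD); rewrite /GRing.scale/=; lra.
have [dfx vE] := df.
have fder := (derivable1_diffP _ _).1 dfx.
have dv : derivable (f i j) x (y - x) := diff_derivable fder.
have vy : 'D_(y - x) (f i j) x = (force i j x - kappa i j * x) * (y - x).
  have yE : y - x = (y - x) *: (1 : R) by rewrite /GRing.scale/= mulr1.
  by rewrite deriveE// [in LHS]yE linearZ/= -deriveE// vE /GRing.scale/= mulrC.
rewrite -vy addrC -lerBrDr.
have cv : h^-1 *: (f i j (h *: (y - x) + x) - f i j x) @[h --> (0:R)^'+] -->
    'D_(y - x) (f i j) x.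
  exact: cvg_dnbhs_at_right dv.
apply: (cvgr_to_le cv).
near=> h.
have h0 : 0 < h by [].
have h1 : h <= 1 by near: h; apply: nbhs_right_le.
rewrite /GRing.scale/= ler_pdivrMl//.
have h01 : (0 <= h <= 1) by rewrite (ltW h0).
pose t : {i01 R} := Itv01 (ltW h0) h1.
have := @adm_convex _ _ _ _ W_adm i j t y x (in_setT _) (in_setT _).
rewrite (_ : conv t (y : convex_lmodType R^o) x = h * (y - x) + x); last first.
  by rewrite /conv/= /GRing.scale/= /unstable.onem; ring.
rewrite convRE /= /unstable.onem /f => hc.
rewrite -subr_ge0; lra.
Unshelve. all: by end_near. Qed.

Lemma force_mono i j x y :
  kappa i j * (x - y) ^+ 2 <= (force i j x - force i j y) * (x - y).
Proof. by have := f_tangent i j x y; have := f_tangent i j y x; lra. Qed.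

(** The growth assumption bounds [W] but not its derivative. The tangent inequality at z, evaluated
    at z + 1 and z - 1, bounds the slope by values of [f], at most B (4 + 3 z^2); adding kappa_ij z,
    at most B (1 + z^2), gives the factor 5. *)
Let force_growth1 i j : exists2 C, 0 <= C &
  forall z, `|force i j z| <= C * (1 + z ^+ 2).
Proof.
have [Wb HW] := adm_growth W_adm.
pose B := `|Wb i j| + `|kappa i j|.
have B0 : 0 <= B by rewrite addr_ge0.
have fB z : `|f i j z| <= B * (1 + z ^+ 2).
  rewrite /f /B mulrDl (le_trans (ler_normB _ _))// lerD//.
    have := HW z i j; rewrite [`|z| ^+ 2]real_normK ?num_real// => /le_trans; apply.
    by rewrite ler_wpM2r ?ler_norm// addr_ge0// sqr_ge0.
  rewrite real_normK ?num_real// normrM (ger0_norm (sqr_ge0 z)) normrM.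
  rewrite (@ger0_norm _ 2^-1) ?invr_ge0//.
  have := sqr_ge0 z; have := normr_ge0 (kappa i j); nra.
have kB : `|kappa i j| <= B by rewrite lerDr.
exists (5 * B) => [|z]; first by rewrite mulr_ge0.
have t1 := f_tangent i j z (z + 1); have t2 := f_tangent i j z (z - 1).
have := fB z; have := fB (z + 1); have := fB (z - 1).
rewrite !ler_norml => /andP[? ?] /andP[? ?] /andP[? ?].
have kz : `|kappa i j * z| <= B * (1 + z ^+ 2).
  rewrite normrM ler_pM// -[z ^+ 2]real_normK ?num_real//.
  by have := sqr_ge0 (`|z| - 1); have := sqr_ge0 `|z|; lra.
move: kz; rewrite ler_norml => /andP[? ?].
have z1 : B * (1 + (z + 1) ^+ 2) <= B * (3 + 2 * z ^+ 2).
  by apply: ler_wpM2l => //; have := sqr_ge0 (z - 1); lra.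
have z2 : B * (1 + (z - 1) ^+ 2) <= B * (3 + 2 * z ^+ 2).
  by apply: ler_wpM2l => //; have := sqr_ge0 (z + 1); lra.
have Bz : 0 <= B * z ^+ 2 by rewrite mulr_ge0// sqr_ge0.
by apply/andP; split; lra.
Qed.

Lemma force_growth : exists2 C, 0 <= C &
  forall i j z, `|force i j z| <= C * (1 + z ^+ 2).
Proof.
apply: (@fin_uniform R n (fun i C => forall j z, `|force i j z| <= C * (1 + z ^+ 2))).
  move=> i C D CD h j z; rewrite (le_trans (h j z))// ler_wpM2r//.
  by rewrite addr_ge0// sqr_ge0.
move=> i.
apply: (@fin_uniform R n (fun j C => forall z, `|force i j z| <= C * (1 + z ^+ 2))) => [j C D CD h z|j].
  by rewrite (le_trans (h z))// ler_wpM2r// addr_ge0// sqr_ge0.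
exact: force_growth1.
Qed.

Lemma force_small e : 0 < e -> exists2 B, 0 <= B &
  forall i j z, `|force i j z| <= e + B * z ^+ 2.
Proof.
move=> e0.
apply: (@fin_uniform R n (fun i B => forall j z, `|force i j z| <= e + B * z ^+ 2)).
  by move=> i C D CD h j z; rewrite (le_trans (h j z))// lerD2l ler_wpM2r// sqr_ge0.
move=> i.
apply: (@fin_uniform R n (fun j B => forall z, `|force i j z| <= e + B * z ^+ 2)) => [j C D CD h z|j].
  by rewrite (le_trans (h z))// lerD2l ler_wpM2r// sqr_ge0.
have [C C0 HC] := force_growth1 i j.
exact: (continuous_vanish_bound (@force_continuous i j) (force0 i j) C0 HC e0).
Qed.

Lemma force_modulus K e : 0 < e -> exists2 C, 0 <= C &
  forall i j x y, `|x| <= K -> `|y| <= K ->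
    `|force i j x - force i j y| <= e + C * (x - y) ^+ 2.
Proof.
move=> e0.
apply: (@fin_uniform R n (fun i C => forall j x y, `|x| <= K -> `|y| <= K ->
    `|force i j x - force i j y| <= e + C * (x - y) ^+ 2)).
  move=> i C D CD h j x y xK yK.
  by rewrite (le_trans (h j x y xK yK))// lerD2l ler_wpM2r// sqr_ge0.
move=> i.
apply: (@fin_uniform R n (fun j C => forall x y, `|x| <= K -> `|y| <= K ->
    `|force i j x - force i j y| <= e + C * (x - y) ^+ 2)) => [j C D CD h x y xK yK|j].
  by rewrite (le_trans (h x y xK yK))// lerD2l ler_wpM2r// sqr_ge0.
exact: (continuous_modulus K (@force_continuous i j) e0).
Qed.

End admissible.

(** * Integration of bounded functions *)

Section bounded_measurable.
Context d {T : measurableType d} {R : realType}.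
Implicit Types f g : T -> R.

Definition bmeas f := measurable_fun setT f /\ exists B, forall x, `|f x| <= B.

Lemma bmeas_cst (a : R) : bmeas (cst a).
Proof. by split; [exact: measurable_cst|exists `|a|]. Qed.

Lemma bmeasD f g : bmeas f -> bmeas g -> bmeas (fun x => f x + g x).
Proof.
move=> [mf [A fA]] [mg [B gB]]; split; first exact: measurable_funD.
by exists (A + B) => x; rewrite (le_trans (ler_normD _ _))// lerD.
Qed.

Lemma bmeasM f g : bmeas f -> bmeas g -> bmeas (fun x => f x * g x).
Proof.
move=> [mf [A fA]] [mg [B gB]]; split; first exact: measurable_funM.
by exists (A * B) => x; rewrite normrM ler_pM.
Qed.

Lemma bmeasB f g : bmeas f -> bmeas g -> bmeas (fun x => f x - g x).
Proof.
move=> bf bg; under eq_fun do rewrite -mulN1r.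
by apply: bmeasD => //; apply: bmeasM => //; exact: bmeas_cst.
Qed.

Lemma bmeas_sum n (F : 'I_n -> T -> R) :
  (forall i, bmeas (F i)) -> bmeas (fun x => \sum_i F i x).
Proof.
elim: n F => [F _|n IH F bF].
  by under eq_fun do rewrite big_ord0; exact: bmeas_cst.
by under eq_fun do rewrite big_ord_recl; apply: bmeasD => //; exact: IH.
Qed.

Variable mu : {measure set T -> \bar R}.
Hypothesis mu_fin : (mu setT < +oo)%E.

Lemma bmeas_integrable f : bmeas f -> mu.-integrable setT (EFin \o f).
Proof.
move=> [mf [B fB]]; apply: measurable_bounded_integrable => //.
exists B; split; first exact: num_real.
by move=> M /ltW BM x _ /=; exact: le_trans (fB x) BM.
Qed.

Lemma Rintegral_bound f B : measurable_fun setT f -> (forall x, `|f x| <= B) ->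
  `|\int[mu]_x f x| <= B * fine (mu setT).
Proof.
move=> mf fB.
have B0 : 0 <= B \/ forall x : T, False.
  have [x|nT] := pselect (exists x : T, True); last first.
    by right => x; apply: nT; exists x.
  by case: x => x _; left; exact: le_trans (fB x).
have if' : mu.-integrable setT (EFin \o f).
  by apply: bmeas_integrable; split => //; exists B.
apply: (le_trans (le_normr_Rintegral measurableT if')).
rewrite -Rintegral_cst//.
apply: le_Rintegral => //; first exact: integrable_norm.
by apply: bmeas_integrable; exact: bmeas_cst.
Qed.

End bounded_measurable.

Section Rintegral_sum.
Context d {T : measurableType d} {R : realType}.
Variable mu : {measure set T -> \bar R}.

Lemma Rintegral_sum n (F : 'I_n -> T -> R) :
  (forall i, mu.-integrable setT (EFin \o F i)) ->
  \int[mu]_x (\sum_i F i x) = \sum_i \int[mu]_x F i x.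
Proof.
elim: n F => [F _|n IH F iF].
  rewrite big_ord0; under eq_Rintegral do rewrite big_ord0.
  by rewrite Rintegral_cst// mul0r.
rewrite big_ord_recl; under eq_Rintegral do rewrite big_ord_recl.
rewrite RintegralD//; first by rewrite IH.
rewrite (_ : EFin \o _ = (fun x => \sum_(i < n) (F (lift ord0 i) x)%:E)%E); last first.
  by apply/funext => x /=; rewrite sumEFin.
by apply: integrable_sum => // i _; exact: iF.
Qed.

Lemma Rintegral_EFin f : mu.-integrable setT (EFin \o f) ->
  (\int[mu]_x (f x)%:E = (\int[mu]_x f x)%:E)%E.
Proof. by move=> i; rewrite /Rintegral fineK//; exact: integrable_fin_num. Qed.

End Rintegral_sum.

(** * Fubini's theorem for bounded functions and measures of finite mass *)

Section fubini.
Context d1 d2 {T1 : measurableType d1} {T2 : measurableType d2} {R : realType}.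
Variables (mu : {measure set T1 -> \bar R}) (nu : {measure set T2 -> \bar R}).
Hypothesis mu_fin : (mu setT < +oo)%E.
Hypothesis nu_fin : (nu setT < +oo)%E.
Variable f : T1 * T2 -> R.
Hypothesis bf : bmeas f.

Lemma bmeas_slice1 x : bmeas (fun y => f (x, y)).
Proof.
have [mf [B fB]] := bf; split; last by exists B => y; exact: fB.
exact: measurableT_comp.
Qed.

Lemma bmeas_slice2 y : bmeas (fun x => f (x, y)).
Proof.
have [mf [B fB]] := bf; split; last by exists B => x; exact: fB.
by apply: (measurableT_comp mf).
Qed.

(** Restricting to the whole space leaves the values on measurable sets unchanged and carries the
    finite measure structure on which the product measure is built. *)
Let mu' : {finite_measure set T1 -> \bar R} := mfrestr measurableT mu_fin.
Let nu' : {finite_measure set T2 -> \bar R} := mfrestr measurableT nu_fin.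

Let mu'E A : measurable A -> mu A = mu' A.
Proof. by move=> mA; rewrite /mu' /= /mfrestr /mrestr setIT. Qed.

Let nu'E A : measurable A -> nu A = nu' A.
Proof. by move=> mA; rewrite /nu' /= /mfrestr /mrestr setIT. Qed.

Let f_int : (mu' \x nu')%E.-integrable setT (EFin \o f).
Proof.
apply: bmeas_integrable bf; rewrite -setXTT [ltLHS](product_measure1E mu' nu' measurableT measurableT).
apply: (@le_lt_trans _ _ (mu setT * nu setT)%E); first by rewrite mu'E// nu'E.
apply: lte_mul_pinfty => //.
by rewrite ge0_fin_numE.
Qed.

Lemma bmeas_Rintegral1 : bmeas (fun x => \int[nu]_y f (x, y)).
Proof.
have [mf [B fB]] := bf; split; last first.
  by exists (B * fine (nu setT)) => x; apply: Rintegral_bound => //; have [] := bmeas_slice1 x.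
apply/measurable_EFinP; rewrite (_ : EFin \o _ = fun x => (\int[nu']_y (f (x, y))%:E)%E).
  exact: (measurable_fubini_F f_int).
apply/funext => x /=; rewrite -(Rintegral_EFin (bmeas_integrable nu_fin (bmeas_slice1 x))).
by apply: eq_measure_integral => A /nu'E.
Qed.

Lemma bmeas_Rintegral2 : bmeas (fun y => \int[mu]_x f (x, y)).
Proof.
have [mf [B fB]] := bf; split; last first.
  by exists (B * fine (mu setT)) => y; apply: Rintegral_bound => //; have [] := bmeas_slice2 y.
apply/measurable_EFinP; rewrite (_ : EFin \o _ = fun y => (\int[mu']_x (f (x, y))%:E)%E).
  exact: (measurable_fubini_G f_int).
apply/funext => y /=; rewrite -(Rintegral_EFin (bmeas_integrable mu_fin (bmeas_slice2 y))).
by apply: eq_measure_integral => A /mu'E.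
Qed.

Lemma bmeas_Fubini :
  \int[mu]_x (\int[nu]_y f (x, y)) = \int[nu]_y (\int[mu]_x f (x, y)).
Proof.
apply: EFin_inj.
rewrite -(Rintegral_EFin (bmeas_integrable mu_fin bmeas_Rintegral1)).
rewrite -(Rintegral_EFin (bmeas_integrable nu_fin bmeas_Rintegral2)).
under eq_integral do rewrite -(Rintegral_EFin (bmeas_integrable nu_fin (bmeas_slice1 _))).
under [RHS]eq_integral do rewrite -(Rintegral_EFin (bmeas_integrable mu_fin (bmeas_slice2 _))).
rewrite (eq_measure_integral mu'); last by move=> A /mu'E.
rewrite [RHS](eq_measure_integral nu'); last by move=> A /nu'E.
under eq_integral => x _.
  rewrite (eq_measure_integral nu'); last by move=> A /nu'E.
  over.
under [RHS]eq_integral => y _.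
  rewrite (eq_measure_integral mu'); last by move=> A /mu'E.
  over.
exact: (Fubini f_int).
Qed.

End fubini.

(** * Measures supported in an interval *)

Section clamp.
Context {R : realType}.
Implicit Types c K x y : R.

(* A continuous integrand composed with [clamp c K] is bounded, and has the same
   integral against a measure living on [[c - K, c + K]]. *)
Definition clamp c K x := Num.max (c - K) (Num.min (c + K) x).

Lemma clamp_id c K x : `|x - c| <= K -> clamp c K x = x.
Proof.
rewrite ler_norml => /andP[h1 h2]; rewrite /clamp min_r; last by lra.
by rewrite max_r//; lra.
Qed.

Lemma clamp_itv c K x (K0 : 0 <= K) : `|clamp c K x - c| <= K.
Proof.
rewrite /clamp ler_norml; apply/andP; split.
  by rewrite lerBrDr le_max; apply/orP; left; lra.
rewrite lerBlDr ge_max ge_min; apply/andP; split; first lra.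
by apply/orP; left; lra.
Qed.

Lemma clamp_far c K L x : L <= K -> L <= `|x - c| -> L <= `|clamp c K x - c|.
Proof.
move=> LK Lx; have [xK|] := leP `|x - c| K; first by rewrite clamp_id.
rewrite /clamp ltr_normr => /orP[xK|xK].
  have [K0|K0] := leP 0 K.
    by rewrite min_l ?max_r; [rewrite addrAC subrr add0r (le_trans LK)// ler_norm|lra..].
  by rewrite (le_trans LK)// (le_trans (ltW K0)).
have [K0|K0] := leP 0 K.
  rewrite min_r ?max_l; [|lra..].
  by rewrite addrAC subrr add0r normrN (le_trans LK)// ler_norm.
by rewrite (le_trans LK)// (le_trans (ltW K0)).
Qed.

Lemma clamp_lip c K x y : `|clamp c K x - clamp c K y| <= `|x - y|.
Proof.
wlog xy : x y / x <= y.
  move=> H; have [/H//|/ltW/H] := leP x y.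
  by rewrite distrC [leRHS]distrC.
rewrite distrC [leRHS]distrC (@ger0_norm _ (y - x)) ?subr_ge0// /clamp.
have mxy : Num.min (c + K) x <= Num.min (c + K) y by rewrite le_min !ge_min lexx xy orbT.
rewrite ger0_norm; last by rewrite subr_ge0 ge_max !le_max lexx mxy orbT.
have h1 : Num.min (c + K) y - Num.min (c + K) x <= y - x.
  have [cx|] := boolP (c + K <= x).
    by rewrite !min_l ?(le_trans cx)// subrr subr_ge0.
  rewrite -ltNge => /ltW xc; rewrite (min_r xc).
  by rewrite lerD2r ge_min lexx orbT.
apply: le_trans h1.
have [cx|] := boolP (c - K <= Num.min (c + K) x).
  by rewrite !max_r// (le_trans cx).
rewrite -ltNge => /ltW xc; rewrite (max_l xc) lerBlDr ge_max lerBlDr.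
by apply/andP; split; lra.
Qed.

Lemma clamp_continuous c K : continuous (clamp c K).
Proof.
move=> x; apply/cvgrPdist_lt => e e0.
exists e => //= y xy; exact: le_lt_trans (clamp_lip _ _ _ _) xy.
Qed.

Lemma continuous_bounded_on (f : R -> R) c K : continuous f ->
  exists2 B, 0 <= B & forall x, `|x - c| <= K -> `|f x| <= B.
Proof.
move=> cf.
have [M [Mr hM]] := compact_bounded (continuous_compact (continuous_subspaceT cf)
     (@segment_compact R (c - K) (c + K))).
exists (`|M| + 1) => [|x xK]; first by rewrite addr_ge0.
apply: hM; first by rewrite (le_lt_trans (ler_norm M))// ltrDl.
exists x => //=; rewrite in_itv/=; move: xK; rewrite ler_norml => /andP[? ?].
by apply/andP; split; lra.
Qed.

Lemma bmeas_clamp (f : R -> R) c K : continuous f -> 0 <= K ->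
  bmeas (fun x : measurableTypeR R => f (clamp c K x)).
Proof.
move=> cf K0; split.
  apply: continuous_measurable_fun => x.
  by apply: continuous_comp; [exact: clamp_continuous|exact: cf].
have [B B0 fB] := continuous_bounded_on c K cf.
by exists B => x; apply: fB; exact: clamp_itv.
Qed.

Lemma bmeas_compact_support (f : R -> R) c K : continuous f ->
  (forall x, K <= `|x - c| -> f x = 0) -> bmeas (f : measurableTypeR R -> R).
Proof.
move=> cf f0; split; first exact: continuous_measurable_fun.
have [B B0 fB] := continuous_bounded_on c K cf.
exists B => x; have [xK|/ltW xK] := leP `|x - c| K; first exact: fB.
by rewrite f0// normr0.
Qed.

End clamp.

Lemma negligible_countable d (T : measurableType d) (R : realType)
    (mu : {measure set T -> \bar R}) (I : countType) (F : I -> set T) :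
  (forall i, mu.-negligible (F i)) -> mu.-negligible (\bigcup_i F i).
Proof.
move=> F0; apply: (@negligibleS _ _ _ _ (\bigcup_n oapp F set0 (unpickle n))).
  by move=> x [i _ Fx]; exists (pickle i) => //=; rewrite pickleK.
by apply: negligible_bigcup => n; case: unpickle => //=; exact: negligible_set0.
Qed.

Section line_measure.
Context {R : realType}.
Variables (mu : borelR R) (p : R).
Hypothesis mass : mu setT = p%:E.
Implicit Types (c K x : R) (f g : R -> R).

Let mu_fin : (mu setT < +oo)%E. Proof. by rewrite mass ltry. Qed.

Lemma Rintegral_cst_mass (a : R) : \int[mu]_x a = a * p.
Proof. by rewrite Rintegral_cst// mass. Qed.

Lemma Rintegral_bound_mass f B : bmeas (f : measurableTypeR R -> R) ->
  (forall x, `|f x| <= B) -> `|\int[mu]_x f x| <= B * p.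
Proof. by move=> bf fB; have := Rintegral_bound mu_fin (proj1 bf) fB; rewrite mass. Qed.

Lemma Rintegral_markov f (a : R) (A : set R) :
  bmeas (f : measurableTypeR R -> R) -> (forall x, 0 <= f x) -> 0 < a ->
  measurable (A : set (measurableTypeR R)) -> (forall x, A x -> a <= f x) ->
  (mu A <= (a^-1 * \int[mu]_x f x)%:E)%E.
Proof.
move=> bf f0 a0 mA Af.
rewrite -[A]setIT -integral_indic//.
have -> : ((a^-1 * \int[mu]_x f x)%:E = \int[mu]_x (a^-1 * f x)%:E)%E.
  rewrite -RintegralZl//; last exact: bmeas_integrable.
  rewrite Rintegral_EFin//; apply: bmeas_integrable => //.
  by apply: bmeasM => //; exact: bmeas_cst.
apply: integral_mono => x _; rewrite lee_fin indicE; case: (boolP (x \in A)) => [/set_mem Ax|_].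
  by rewrite ler_pdivlMl// mulr1 Af.
by rewrite mulr_ge0// invr_ge0 ltW.
Qed.

Lemma quadratic_integrable f (C : R) : (\int[mu]_x (x ^+ 2)%:E < +oo)%E ->
  continuous f -> (forall x, `|f x| <= C * (1 + x ^+ 2)) ->
  mu.-integrable setT (EFin \o f).
Proof.
move=> m2 cf fC.
have i2 : mu.-integrable setT (EFin \o (fun x : measurableTypeR R => x ^+ 2)).
  apply/integrableP; split.
    apply/measurable_EFinP; apply: continuous_measurable_fun.
    exact: exprn_continuous.
  by under eq_integral do rewrite /= ger0_norm ?sqr_ge0//.
have i1 : mu.-integrable setT (EFin \o (fun x : measurableTypeR R => C * (1 + x ^+ 2))).
  rewrite (_ : EFin \o _ = (fun x : measurableTypeR R => C%:E * (1%:E + (x ^+ 2)%:E))%E).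
    apply: integrableZl => //; apply: integrableD => //.
    by have := bmeas_integrable mu_fin (bmeas_cst (1 : R)).
  by apply/funext => x /=; rewrite EFinM EFinD.
apply: le_integrable i1 => //.
  by apply/measurable_EFinP; exact: continuous_measurable_fun.
move=> x _; rewrite lee_fin (le_trans (fC x))// ler_norm//.
Qed.

Definition supported c K := mu [set x | K < `|x - c|] = 0%E.

Lemma measurable_off c K :
  measurable ([set x | K < `|x - c|] : set (measurableTypeR R)).
Proof.
have cf : continuous (fun x : R => `|x - c|).
  move=> x; apply: (@continuous_comp R R R (fun y => y - c) Num.norm).
    by apply: continuousB; [exact: cvg_id|exact: cvg_cst].
  exact: norm_continuous.
have := continuous_measurable_fun cf measurableT (measurable_itv `]K, +oo[).
by rewrite setTI; congr measurable; apply/seteqP; split => x /=; rewrite in_itv/= andbT.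
Qed.

Lemma supported_le c K L : K <= L -> supported c K -> supported c L.
Proof.
move=> KL sK; apply: subset_measure0 sK => //; [exact: measurable_off..|].
by move=> x /=; exact: le_lt_trans.
Qed.

Section supported.
Variables (c K : R).
Hypotheses (K0 : 0 <= K) (sup : supported c K).

Lemma supported_eq f g : measurable_fun setT (f : measurableTypeR R -> R) ->
  measurable_fun setT (g : measurableTypeR R -> R) ->
  (forall x, `|x - c| <= K -> f x = g x) -> \int[mu]_x f x = \int[mu]_x g x.
Proof.
move=> mf mg fg; rewrite /Rintegral; congr fine.
apply: ae_eq_integral => //; [exact/measurable_EFinP..|].
exists [set x | K < `|x - c|]; split => //; first exact: measurable_off.
move=> x /= /not_implyP[_ nfg]; rewrite ltNge; apply/negP => xK.
by apply: nfg; rewrite fg.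
Qed.

Lemma supported_clamp f : continuous f ->
  \int[mu]_x f x = \int[mu]_x f (clamp c K x).
Proof.
move=> cf; apply: supported_eq; first exact: continuous_measurable_fun.
  by have [] := bmeas_clamp c cf K0.
by move=> x xK; rewrite clamp_id.
Qed.

Lemma supported_integrable f : continuous f -> mu.-integrable setT (EFin \o f).
Proof.
move=> cf.
have mf : measurable_fun setT (f : measurableTypeR R -> R) by exact: continuous_measurable_fun.
apply/(negligible_integrable (measurable_off c K)) => //; first exact/measurable_EFinP.
have h := bmeas_integrable mu_fin (bmeas_clamp c cf K0).
have mD : measurable (setT `\` [set x | K < `|x - c|] : set (measurableTypeR R)).
  by apply: measurableD => //; exact: measurable_off.
have := integrableS measurableT mD (@subsetT _ _) h.
apply: eq_integrable => // x; rewrite inE => -[_ /= /negP]; rewrite -leNgt => xK.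
by rewrite clamp_id.
Qed.

Lemma supported_Rintegral_le f g : continuous f -> continuous g ->
  (forall x, `|x - c| <= K -> f x <= g x) -> \int[mu]_x f x <= \int[mu]_x g x.
Proof.
move=> cf cg fg; rewrite supported_clamp// [leRHS]supported_clamp//.
apply: le_Rintegral => //; try by apply: bmeas_integrable => //; exact: bmeas_clamp.
by move=> x _; apply: fg; exact: clamp_itv.
Qed.

End supported.

(** A Lindelof argument: each point outside the support lies in a null open set, hence in a null
    interval with rational endpoints, and there are countably many of these. *)
Lemma compact_msupport c : compact (msupport mu) -> exists2 K, 0 <= K & supported c K.
Proof.
move=> cpt.
have [M [Mr hM]] := compact_bounded cpt.
pose K := `|M| + 1 + `|c|.
have K0 : 0 <= K by rewrite !addr_ge0.
exists K => //; rewrite /supported.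
pose I (q : rat * rat) : set R := `]ratr q.1, ratr q.2[%classic.
pose N (q : rat * rat) : set (measurableTypeR R) := if mu (I q) == 0%E then I q else set0.
have mN q : measurable (N q).
  by rewrite /N; case: ifP => _; [exact: measurable_itv|exact: measurable0].
have N0 q : mu (N q) = 0%E.
  by rewrite /N; case: ifP => [/eqP//|_]; exact: measure0.
have NU : mu.-negligible (\bigcup_q N q).
  by apply: negligible_countable => q; exists (N q); split.
apply/negligibleP; first exact: measurable_off.
apply: negligibleS NU => x /= xK.
have : ~ msupport mu x.
  move=> sx; have := hM _ _ x sx.
  move=> /(_ (`|M| + 1)) h.
  have : `|x| <= `|M| + 1 by apply: h; rewrite (le_lt_trans (ler_norm M))// ltrDl.
  apply/negP; rewrite -ltNge.
  have := ler_normB x c; rewrite /K in xK; lra.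
move=> /existsNP[U] /not_implyP[oU] /not_implyP[Ux] /negP; rewrite -leNgt => mU.
have [e /= e0 eU] : nbhs x U by exact: open_nbhs_nbhs.
have [q1] := @rat_in_itvoo R (x - e) x (ltac:(by rewrite ltrBlDr ltrDl)).
rewrite in_itv/= => /andP[q11 q12].
have [q2] := @rat_in_itvoo R x (x + e) (ltac:(by rewrite ltrDl)).
rewrite in_itv/= => /andP[q21 q22].
exists (q1, q2) => //; rewrite /N ifT; first by rewrite /I /= in_itv/= q12 q21.
rewrite -measure_le0 (le_trans _ mU)// le_measure ?inE//.
- exact: measurable_itv.
- exact: open_measurable.
- move=> y; rewrite /I/= in_itv/= => /andP[y1 y2]; apply: eU => /=.
  rewrite /ball/= ltr_norml; apply/andP; split; lra.
Qed.

End line_measure.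

(** * The drift *)

Lemma continuous_sum (R : realType) n (F : 'I_n -> R -> R) :
  (forall i, continuous (F i)) -> continuous (fun x => \sum_i F i x).
Proof.
elim: n F => [F _|n IH F cF] x.
  by under eq_fun do rewrite big_ord0; exact: cvg_cst.
under eq_fun do rewrite big_ord_recl.
by apply: continuousD; [exact: cF|exact: IH].
Qed.

Section drift.
Context {R : realType} {n : nat}.
Variables (p : 'I_n -> R) (W : R -> 'M[R]_n) (kappa : 'M[R]_n).
Hypothesis W_adm : admissible W kappa.

Definition drift (nu : 'I_n -> borelR R) i x :=
  \sum_j \int[nu j]_y force W i j (x - y).

Variable nu : 'I_n -> borelR R.
Hypothesis mass : forall j, nu j setT = (p j)%:E.
Hypothesis mom2 : forall j, (\int[nu j]_x (x ^+ 2)%:E < +oo)%E.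

Let sub_continuous x : continuous (fun y : R => x - y).
Proof. by move=> y; apply: continuousB; [exact: cvg_cst|exact: cvg_id]. Qed.

Lemma force_sub_continuous i j x : continuous (fun y : R => force W i j (x - y)).
Proof.
move=> y; apply: (@continuous_comp R R R (fun y => x - y) (force W i j)).
  exact: sub_continuous.
exact: (force_continuous W_adm).
Qed.

Lemma force_integrable i j x :
  (nu j).-integrable setT (EFin \o (fun y => force W i j (x - y))).
Proof.
have [C C0 fC] := force_growth W_adm.
apply: (@quadratic_integrable _ _ _ (mass j) _ (C * (2 + 2 * x ^+ 2)) (mom2 j)).
  exact: force_sub_continuous.
move=> y; rewrite (le_trans (fC i j _))// -mulrA ler_wpM2l//.
have := sqr_ge0 (x + y); have := sqr_ge0 x; have := sqr_ge0 y.
have : 0 <= x ^+ 2 * y ^+ 2 by rewrite mulr_ge0 ?sqr_ge0.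
by lra.
Qed.

Lemma sqr_integrable j (c : R) :
  (nu j).-integrable setT (EFin \o (fun y : R => (y - c) ^+ 2)).
Proof.
apply: (@quadratic_integrable _ _ _ (mass j) _ (2 + 2 * c ^+ 2) (mom2 j)).
  move=> y; apply: (@continuous_comp R R R (fun y => y - c) (fun y => y ^+ 2)).
    by apply: continuousB; [exact: cvg_id|exact: cvg_cst].
  exact: exprn_continuous.
move=> y; rewrite ger0_norm ?sqr_ge0//.
have := sqr_ge0 (c + y); have := sqr_ge0 c; have := sqr_ge0 y.
have : 0 <= c ^+ 2 * y ^+ 2 by rewrite mulr_ge0 ?sqr_ge0.
by lra.
Qed.

Lemma drift_continuous i : continuous (drift nu i).
Proof.
have [C C0 fC] := force_growth W_adm.
have cj j : continuous (fun x => \int[nu j]_y force W i j (x - y)).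
  move=> x.
  pose M := `|x| + 1.
  (* Dominates the force at z - y for all |z| < M at once, since (z - y)^2 <= 2 z^2 + 2 y^2. *)
  pose g (y : R) := C * (1 + 2 * M ^+ 2 + 2 * y ^+ 2).
  have M1 : 1 <= M by rewrite lerDr.
  have ig : (nu j).-integrable setT (EFin \o g).
    apply: (@quadratic_integrable _ _ _ (mass j) _ (C * (1 + 2 * M ^+ 2)) (mom2 j)).
      apply: smooth_continuous; apply: smoothM; first exact: smooth_cst.
      apply: smoothD; first exact: smooth_cst.
      by apply: smoothM; [exact: smooth_cst|exact: smoothX].
    move=> y; rewrite ger0_norm; last by rewrite /g; have := sqr_ge0 M; have := sqr_ge0 y; nra.
    rewrite /g -mulrA ler_wpM2l//.
    have : 0 <= (M ^+ 2 - 1) * y ^+ 2.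
      by rewrite mulr_ge0 ?sqr_ge0// subr_ge0 expr_ge1// (le_trans _ M1).
    by have := sqr_ge0 y; lra.
  have := @continuity_under_integral R _ _ (nu j) (fun x y => force W i j (x - y))
    setT measurableT (- M) M.
  move=> /(_ (fun x _ => force_integrable i j x)).
  have ae1 : {ae nu j, forall y, [set: R] y ->
      {in `]- M, M[%classic, continuous (fun x => force W i j (x - y))}}.
    apply: aeW => y _ z _.
    apply: (@continuous_comp R R R (fun x => x - y) (force W i j)).
      by apply: continuousB; [exact: cvg_id|exact: cvg_cst].
    exact: (force_continuous W_adm).
  move=> /(_ ae1 g ig).
  have ae2 z : `]- M, M[%classic z ->
      {ae nu j, forall y, [set: R] y -> `|force W i j (z - y)| <= g y}.
    rewrite /= in_itv/= -ltr_norml => zM; apply: aeW => y _.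
    rewrite (le_trans (fC i j _))// /g ler_wpM2l//.
    have : z ^+ 2 <= M ^+ 2.
      rewrite -[leLHS]real_normK ?num_real//; apply: lerXn2r; rewrite ?nnegrE ?(ltW zM)//.
      by rewrite (le_trans _ M1).
    by have := sqr_ge0 (z + y); lra.
  move=> /(_ ae2) /(_ x); apply.
  by rewrite inE/= in_itv/= -ltr_norml ltrDl.
exact: continuous_sum.
Qed.

Lemma drift_mono i x c :
  (\sum_j kappa i j * p j) * (x - c) ^+ 2 <=
  (drift nu i x - drift nu i c) * (x - c).
Proof.
rewrite /drift -sumrB !mulr_suml; apply: ler_sum => j _.
have iB : (nu j).-integrable setT
    (EFin \o (fun y => force W i j (x - y) - force W i j (c - y))).
  exact: integrableB (force_integrable i j x) (force_integrable i j c).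
rewrite -RintegralB//; try exact: force_integrable.
rewrite -RintegralZr//.
rewrite mulrAC -(Rintegral_cst_mass (mass j)).
apply: le_Rintegral => //.
- apply: bmeas_integrable; first by rewrite mass ltry.
  exact: bmeas_cst.
- have := integrableZr measurableT (x - c) iB.
  by apply: eq_integrable.
- move=> y _; have := force_mono W_adm i j (x - y) (c - y).
  by rewrite opprB addrA subrK.
Qed.

Lemma drift_bound i c e B : (forall j z, `|force W i j z| <= e + B * z ^+ 2) ->
  `|drift nu i c| <= \sum_j (e * p j + B * \int[nu j]_y (y - c) ^+ 2).
Proof.
move=> fB; rewrite /drift (le_trans (ler_norm_sum _ _ _))//.
apply: ler_sum => j _.
rewrite (le_trans (le_normr_Rintegral measurableT (force_integrable i j c)))//.
have icst : (nu j).-integrable setT (EFin \o (fun=> e)).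
  apply: bmeas_integrable; first by rewrite mass ltry.
  exact: bmeas_cst.
have iB := integrableZl measurableT B (sqr_integrable j c).
rewrite -(Rintegral_cst_mass (mass j)) -RintegralZl//; last exact: sqr_integrable.
rewrite -RintegralD//.
apply: le_Rintegral => //.
- exact: integrable_norm (force_integrable i j c).
- by have := integrableD measurableT icst iB; apply: eq_integrable.
- by move=> y _; rewrite (le_trans (fB j _))// -(sqrrN (y - c)) opprB.
Qed.

End drift.

(** * Propagation of supports *)

Section off_support.
Context {R : realType}.
Implicit Types (h : R -> R) (c K : R).

Lemma derive1_off h c K x : (forall x, K <= `|x - c| -> h x = 0) ->
  K < `|x - c| -> derive1 h x = 0.
Proof.
move=> h0 xK; rewrite derive1E.
have nh : \near x, h x = cst 0 x.
  have cf : {for x, continuous (fun y : R => `|y - c|)}.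
    apply: (@continuous_comp R R R (fun y => y - c) Num.norm).
      by apply: continuousB; [exact: cvg_id|exact: cvg_cst].
    exact: norm_continuous.
  have [e /= e0 he] := cvgr_gt _ cf _ xK.
  by exists e => // y ye; apply: h0; apply: ltW; exact: he.
by rewrite (near_eq_derive _ nh) derive_cst.
Qed.

(** A function vanishing off the interval is unchanged by composition with [clamp c K], which is
    1-Lipschitz; so the modulus on a compact interval holds globally. *)
Lemma compact_support_modulus h c K e : continuous h -> 0 <= K ->
  (forall x, K <= `|x - c| -> h x = 0) -> 0 < e ->
  exists2 C, 0 <= C & forall x y, `|h x - h y| <= e + C * (x - y) ^+ 2.
Proof.
move=> ch K0 h0 e0.
have [C C0 hC] := continuous_modulus (K + `|c|) ch e0.
have hE x : h x = h (clamp c K x).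
  have [xK|xK] := leP `|x - c| K; first by rewrite clamp_id.
  rewrite h0 ?ltW// h0// /clamp.
  move: xK; rewrite ltr_normr => /orP[xK|xK].
    by rewrite min_l ?max_r; [rewrite addrAC subrr add0r ler_norm|lra..].
  rewrite min_r ?max_l; [|lra..].
  by rewrite addrAC subrr add0r normrN ler_norm.
exists C => // x y; rewrite hE [h y]hE.
have cl z : `|clamp c K z| <= K + `|c|.
  by rewrite -lerBlDr (le_trans (lerB_dist _ _))// clamp_itv.
rewrite (le_trans (hC _ _ (cl x) (cl y)))// lerD2l ler_wpM2l//.
rewrite -[leLHS]real_normK ?num_real// -[leRHS]real_normK ?num_real//.
by apply: lerXn2r; rewrite ?nnegrE// clamp_lip.
Qed.

End off_support.

Section weakly_continuous.
Context {R : realType} {n : nat}.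

(* Continuity in time of the integrals [int h dmu_j(t)], uniformly over the
   integrands having a given modulus of continuity. *)
Definition weakly_continuous (p : 'I_n -> R) (mu : R -> 'I_n -> borelR R) :=
  forall s rho : R, 0 <= s -> 0 < rho -> exists2 del : R, 0 < del &
    forall (t : R) j (h : R -> R) (e C : R), 0 <= t -> `|t - s| <= del ->
      continuous h -> 0 <= e -> 0 <= C ->
      (forall x y, `|h x - h y| <= e + C * (x - y) ^+ 2) ->
      `|\int[mu t j]_x h x - \int[mu s j]_x h x| <= e * p j + C * rho.

Variables (p : 'I_n -> R) (mu : R -> 'I_n -> borelR R).
Hypothesis p_gt0 : forall j, 0 < p j.
Hypothesis wc : weakly_continuous p mu.

Lemma Rintegral_time_continuous h c K j s e : continuous h -> 0 <= K ->
  (forall x, K <= `|x - c| -> h x = 0) -> 0 <= s -> 0 < e ->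
  exists2 del : R, 0 < del & forall t : R, 0 <= t -> `|t - s| <= del ->
    `|\int[mu t j]_x h x - \int[mu s j]_x h x| <= e.
Proof.
move=> ch K0 h0 s0 e0.
have e1 : 0 < e / 2 / p j by rewrite !divr_gt0.
have [C C0 hC] := compact_support_modulus ch K0 h0 e1.
have C1 : 0 < C + 1 by rewrite ltr_wpDl.
have r0 : 0 < e / 2 / (C + 1) by rewrite !divr_gt0.
have [del del0 H] := wc s0 r0.
exists del => // t t0 ts; rewrite (le_trans (H t j h _ _ t0 ts ch (ltW e1) C0 hC))//.
rewrite divfK ?gt_eqF//.
have : C * (e / 2 / (C + 1)) <= e / 2.
  by rewrite mulrCA ler_piMr ?divr_ge0 ?(ltW e0)// ler_pdivrMr// mul1r lerDl.
by lra.
Qed.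

End weakly_continuous.

(** * The weak equation for integrals in space *)

Section curve.
Context {R : realType} {n : nat}.
Variables (m p : 'I_n -> R) (E : R) (W : R -> 'M[R]_n) (kappa : 'M[R]_n).
Hypothesis W_adm : admissible W kappa.

Variable mu : R -> 'I_n -> borelR R.
Hypothesis muP : forall t : R, 0 <= t -> in_P m p E (mu t).
Hypothesis weak : weak_solution m W mu.

Let mass (t : R) j : 0 <= t -> mu t j setT = (p j)%:E.
Proof. by move=> /muP[]. Qed.

Let mom2 (t : R) j : 0 <= t -> (\int[mu t j]_x (x ^+ 2)%:E < +oo)%E.
Proof. by move=> /muP[]. Qed.

Let mu_fin (t : R) j : 0 <= t -> (mu t j setT < +oo)%E.
Proof. by move=> t0; rewrite mass// ltry. Qed.

Lemma bmeas_derive_drift (psi : R -> R) c K t i : 0 <= t -> smooth psi ->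
  (forall x, K <= `|x - c| -> psi x = 0) ->
  bmeas (fun x : measurableTypeR R => derive1 psi x * drift W (mu t) i x).
Proof.
move=> t0 spsi psi0; apply: (@bmeas_compact_support _ _ c (K + 1)).
  move=> x; apply: continuousM; first exact: (smooth_continuous (smooth_derive spsi)).
  exact: (drift_continuous W_adm (fun j => mass j t0) (fun j => mom2 j t0)).
by move=> x xK; rewrite (derive1_off psi0) ?mul0r// (lt_le_trans _ xK)// ltrDl.
Qed.

(** In the sense of distributions on (0, oo), the integral of [psi] against mu_i(t) has derivative -
    m_i times the integral of psi' b_i, with b_i the drift. *)
Lemma weak_product i (psi th : R -> R) c K a b :
  smooth psi -> (forall x, K <= `|x - c| -> psi x = 0) ->
  0 < a -> smooth th -> (forall t, th t != 0 -> t \in `[a, b]) ->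
  (\int[lebesgue_measure]_(t in `]0%R, +oo[)
     (derive1 th t * (\int[mu t i]_x psi x) +
      th t * (- m i * \int[mu t i]_x (derive1 psi x * drift W (mu t) i x)))%:E = 0)%E.
Proof.
move=> spsi psi0 a0 sth thab.
have psiK x : psi x != 0 -> x \in `[c - K, c + K].
  move=> px; have : `|x - c| < K by rewrite ltNge; apply: contra px => /psi0 ->.
  rewrite ltr_norml in_itv/= => /andP[? ?]; apply/andP; split; lra.
rewrite -[RHS](weak i (test_function_tensor sth spsi a0 thab psiK)).
apply: eq_integral => t; rewrite inE/= in_itv/= andbT => t0.
have bpsi : bmeas (psi : measurableTypeR R -> R).
  exact: bmeas_compact_support (smooth_continuous spsi) psi0.
have bdr := bmeas_derive_drift i (ltW t0) spsi psi0.
have d1 x := is_derive_tensor (t, x) (1, 0) (fun y => @smooth_derivable _ _ y sth)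
   (fun y => @smooth_derivable _ _ y spsi).
have d2 x := is_derive_tensor (t, x) (0, 1) (fun y => @smooth_derivable _ _ y sth)
   (fun y => @smooth_derivable _ _ y spsi).
transitivity (\int[mu t i]_x (derive1 th t * psi x +
    (th t * - m i) * (derive1 psi x * drift W (mu t) i x))%:E)%E; last first.
  apply: eq_integral => x _; congr EFin.
  have [_ ->] := d1 x; have [_ ->] := d2 x => /=.
  by rewrite /drift; ring.
have i1 := bmeas_integrable (mu_fin i (ltW t0)) bpsi.
have i2 := bmeas_integrable (mu_fin i (ltW t0)) bdr.
have i1' := bmeas_integrable (mu_fin i (ltW t0)) (bmeasM (bmeas_cst (derive1 th t)) bpsi).
have i2' := bmeas_integrable (mu_fin i (ltW t0)) (bmeasM (bmeas_cst (th t * - m i)) bdr).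
rewrite Rintegral_EFin; last first.
  by have := integrableD measurableT i1' i2'; apply: eq_integrable.
by rewrite RintegralD// !RintegralZl// mulrA.
Qed.

End curve.

(** Here [v] and [v0] stand for the drift at x and at c, [u] for x - c, and [S] for the sum of
    kappa_ij p_j. The term D |u| is the error due to the drift not vanishing at c. *)
Lemma inward_drift_le (R : realType) (m S v v0 u D lam : R) : 0 < m ->
  lam <= m * S -> S * u ^+ 2 <= (v - v0) * u -> m * `|v0| <= D ->
  lam * `|u| ^+ 2 - D * `|u| <= m * v * u.
Proof.
move=> m0 lamS h hD; rewrite real_normK ?num_real//.
have h2 : lam * u ^+ 2 <= m * S * u ^+ 2 by rewrite ler_wpM2r ?sqr_ge0.
have h3 : m * (S * u ^+ 2) <= m * ((v - v0) * u) by rewrite ler_wpM2l// ltW.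
have h4 : - (m * v0 * u) <= D * `|u|.
  by rewrite (le_trans (ler_norm _))// normrN 2!normrM (gtr0_norm m0) ler_wpM2r.
lra.
Qed.

Section curve_support.
Context {R : realType} {n : nat}.
Variables (m p : 'I_n -> R) (E : R) (W : R -> 'M[R]_n) (kappa : 'M[R]_n).
Hypothesis m_gt0 : forall i, 0 < m i.
Hypothesis p_gt0 : forall i, 0 < p i.
Hypothesis W_adm : admissible W kappa.
Variable lam : R.
Hypothesis lam_gt0 : 0 < lam.
Hypothesis lam_le : forall i, lam <= m i * \sum_j kappa i j * p j.

Lemma drift_inward (nu : 'I_n -> borelR R) i c D x :
  (forall j, nu j setT = (p j)%:E) ->
  (forall j, (\int[nu j]_x (x ^+ 2)%:E < +oo)%E) ->
  m i * `|drift W nu i c| <= D ->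
  lam * `|x - c| ^+ 2 - D * `|x - c| <= m i * drift W nu i x * (x - c).
Proof.
move=> mass mom2 hD.
exact: inward_drift_le (m_gt0 i) (lam_le i) (drift_mono W_adm mass mom2 i x c) hD.
Qed.

(* Beyond radius [K] the drift points towards [c], where [bump c K] increases. *)
Lemma bump_derive_drift_le0 (nu : 'I_n -> borelR R) i c D K x :
  (forall j, nu j setT = (p j)%:E) ->
  (forall j, (\int[nu j]_x (x ^+ 2)%:E < +oo)%E) ->
  m i * `|drift W nu i c| <= D -> 0 <= K -> D <= lam * K ->
  derive1 (bump c K) x * drift W nu i x <= 0.
Proof.
move=> mass mom2 hD K0 DK.
have [xK|xK] := leP `|x - c| K; first by rewrite bump_derive_eq0// mul0r.
have x0 : 0 < (x - c) ^+ 2.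
  by rewrite -real_normK ?num_real// exprn_gt0// (le_lt_trans K0).
have := drift_inward x mass mom2 hD => h.
have h1 : 0 <= m i * drift W nu i x * (x - c).
  apply: le_trans h; rewrite expr2 mulrA -mulrBl mulr_ge0// subr_ge0.
  by rewrite (le_trans DK)// ler_wpM2l// ltW.
have h2 := bump_derive_sign c x K0.
rewrite -(pmulr_rle0 _ (m_gt0 i)) -(pmulr_rle0 _ x0).
rewrite (_ : _ * _ = ((x - c) * derive1 (bump c K) x) * (m i * drift W nu i x * (x - c))).
  exact: mulr_le0_ge0.
ring.
Qed.

Variable mu : R -> 'I_n -> borelR R.
Hypothesis muP : forall t : R, 0 <= t -> in_P m p E (mu t).
Hypothesis weak : weak_solution m W mu.
Hypothesis wc : weakly_continuous p mu.

Let mass (t : R) j : 0 <= t -> mu t j setT = (p j)%:E.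
Proof. by move=> /muP[]. Qed.

Let mom2 (t : R) j : 0 <= t -> (\int[mu t j]_x (x ^+ 2)%:E < +oo)%E.
Proof. by move=> /muP[]. Qed.

Let mu_fin (t : R) j : 0 <= t -> (mu t j setT < +oo)%E.
Proof. by move=> t0; rewrite mass// ltry. Qed.

Lemma time_right_continuous_at (F : R -> R) s :
  (forall e, 0 < e -> exists2 del : R, 0 < del & forall t : R, 0 <= t -> `|t - s| <= del ->
    `|F t - F s| <= e) -> 0 <= s -> right_continuous_at F s.
Proof.
move=> cF s0 e e0; have [del del0 H] := cF e e0; exists del => // x /andP[sx xs].
apply: H; first exact: le_trans sx.
by rewrite ger0_norm ?subr_ge0// lerBlDl.
Qed.

Lemma curve_gronwall i (psi : R -> R) c K a c0 T0 T1 :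
  smooth psi -> 0 <= K -> (forall x, K <= `|x - c| -> psi x = 0) -> 0 <= T0 ->
  (forall t, T0 < t -> t < T1 ->
    - m i * \int[mu t i]_x (derive1 psi x * drift W (mu t) i x) <=
    a * (c0 - \int[mu t i]_x psi x)) ->
  forall s t, T0 <= s -> s <= t -> t < T1 ->
  expR (a * t) * (\int[mu t i]_x psi x - c0) <=
  expR (a * s) * (\int[mu s i]_x psi x - c0).
Proof.
move=> spsi K0 psi0 T00 GF s t Ts st tT.
apply: (@weak_gronwall R (fun t => \int[mu t i]_x psi x)
  (fun t => - m i * \int[mu t i]_x (derive1 psi x * drift W (mu t) i x)) a c0 T0 T1) => //.
- move=> r Tr; have r0 := le_trans T00 Tr.
  apply: time_right_continuous_at => // e e0.
  exact: (Rintegral_time_continuous p_gt0 wc i (smooth_continuous spsi) K0 psi0 r0 e0).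
- move=> th s' t' Ts' st' tT' sth th0 thst.
  rewrite (weak_product W_adm muP weak i spsi psi0 _ sth thst)//.
  exact: le_lt_trans Ts'.
Qed.

(** The Gronwall lemma bounds integrals from above; a lower bound on the mass seen by [bump] is
    obtained by testing with its opposite. *)
Lemma smooth_Nbump (c K : R) : smooth (fun x => -1 * bump c K x).
Proof. by apply: smoothM; [exact: smooth_cst|exact: smooth_bump]. Qed.

Lemma derive1_Nbump (c K x : R) :
  derive1 (fun x => -1 * bump c K x) x = - derive1 (bump c K) x.
Proof.
have sb := @smooth_bump R c K.
have dm := @is_deriveZ _ _ R _ (-1) x 1 _ (smooth_is_derive x sb).
by rewrite derive1E; have [_ ->] := dm; rewrite scaleN1r.
Qed.

Lemma bump_continuous (c K : R) : continuous (bump c K).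
Proof. exact: smooth_continuous (@smooth_bump R c K). Qed.

Lemma bmeas_bump c K : 0 <= K -> bmeas (bump c K : measurableTypeR R -> R).
Proof.
move=> K0; apply: (bmeas_compact_support (c := c) (K := K + 1)).
  exact: bump_continuous.
by move=> x; exact: bump_eq0.
Qed.

(** With rate a = 0 the integral of [bump c K] cannot decrease. It starts at the full mass p_i, so 1
    - bump keeps integral zero, and this function equals 1 beyond radius K + 1. *)
Lemma supported_propagation i c D K T : 0 <= K -> D <= lam * K ->
  (forall t : R, 0 <= t -> t < T -> m i * `|drift W (mu t) i c| <= D) ->
  supported (mu 0 i) c K ->
  forall t : R, 0 <= t -> t < T -> supported (mu t i) c (K + 1).
Proof.
move=> K0 DK hD sup0 t t0 tT.
have K1 : 0 <= K + 1 by rewrite addr_ge0.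
have psi0 x : K + 1 <= `|x - c| -> -1 * bump c K x = 0.
  by move=> xK; rewrite bump_eq0// mulr0.
have := curve_gronwall (i := i) (a := 0) (c0 := 0) (T0 := 0) (T1 := T) (smooth_Nbump c K) K1 psi0 (lexx 0).
have H (r : R) : 0 < r -> r < T -> - m i *
    \int[mu r i]_x (derive1 (fun x : R => -1 * bump c K x) x * drift W (mu r) i x) <=
    0 * (0 - \int[mu r i]_x (-1 * bump c K x)).
  move=> r0 rT; rewrite mul0r mulNr oppr_le0 mulr_ge0 ?(ltW (m_gt0 i))//.
  apply: Rintegral_ge0 => x _; rewrite derive1_Nbump mulNr oppr_ge0.
  exact: (bump_derive_drift_le0 x (fun j => mass j (ltW r0)) (fun j => mom2 j (ltW r0)) (hD _ (ltW r0) rT) K0 DK).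
move=> /(_ H 0 t (lexx 0) t0 tT); rewrite !mul0r expR0 !mul1r !subr0.
have bb := bmeas_bump c K0.
have iZ (r : R) : 0 <= r -> \int[mu r i]_x (-1 * bump c K x) = - \int[mu r i]_x bump c K x.
  move=> r0; rewrite RintegralZl//; first by rewrite mulN1r.
  by have := bmeas_integrable (mu_fin i r0) bb.
rewrite !iZ// lerN2 => h.
have ge_p : p i <= \int[mu 0 i]_x bump c K x.
  rewrite -[p i]mul1r -(Rintegral_cst_mass (mass i (lexx 0))).
  apply: (supported_Rintegral_le (mass i (lexx 0)) K0 sup0).
  - exact: cst_continuous.
  - exact: bump_continuous.
  - by move=> x xK; rewrite bump_eq1.
have bB : bmeas (fun x : measurableTypeR R => 1 - bump c K x).
  by apply: bmeasB bb; exact: bmeas_cst.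
have z : \int[mu t i]_x (1 - bump c K x) <= 0.
  rewrite RintegralB//; last 2 first.
    by have := bmeas_integrable (mu_fin i t0) (bmeas_cst (1 : R)).
    by have := bmeas_integrable (mu_fin i t0) bb.
  by rewrite (Rintegral_cst_mass (mass i t0)) mul1r subr_le0 (le_trans ge_p).
rewrite /supported; apply/eqP; rewrite -measure_le0.
apply: le_trans (Rintegral_markov (mass i t0) bB _ ltr01 (measurable_off c (K + 1)) _) _.
- by move=> x; rewrite subr_ge0; have /andP[] := bump_itv c x K0.
- by move=> x /= /ltW xK; rewrite bump_eq0// subr0.
- by rewrite lee_fin invr1 mul1r.
Qed.

End curve_support.

(** * Decay of the second moment *)

Section dissipation.
Context {R : realType} {n : nat}.
Variables (m p : 'I_n.+1 -> R) (W : R -> 'M[R]_n.+1) (kappa : 'M[R]_n.+1).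
Hypothesis m_gt0 : forall i, 0 < m i.
Hypothesis p_gt0 : forall i, 0 < p i.
Hypothesis W_adm : admissible W kappa.
Variables (nu : 'I_n.+1 -> borelR R) (c K : R).
Hypothesis mass : forall j, nu j setT = (p j)%:E.
Hypothesis K0 : 0 <= K.
Hypothesis sup : forall j, supported (nu j) c K.

Let nu_fin j : (nu j setT < +oo)%E. Proof. by rewrite mass ltry. Qed.

Let X (x : R) : R := clamp c K x - c.
Let f i j (z : R * R) : R := force W i j (clamp c K z.1 - clamp c K z.2).

Let bX : bmeas (X : measurableTypeR R -> R).
Proof.
apply: (@bmeas_clamp _ (fun y => y - c) c K) => // x.
by apply: continuousB; [exact: cvg_id|exact: cvg_cst].
Qed.

Let bX1 : bmeas (fun z : measurableTypeR R * measurableTypeR R => X z.1).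
Proof.
have [mX [B XB]] := bX; split; last by exists B => z; exact: XB.
by apply: (measurableT_comp mX).
Qed.

Let bX2 : bmeas (fun z : measurableTypeR R * measurableTypeR R => X z.2).
Proof.
have [mX [B XB]] := bX; split; last by exists B => z; exact: XB.
by apply: (measurableT_comp mX).
Qed.

Let bf i j : bmeas (f i j : measurableTypeR R * measurableTypeR R -> R).
Proof.
split.
  have mf : measurable_fun setT (force W i j : measurableTypeR R -> R).
    by apply: continuous_measurable_fun; exact: (force_continuous W_adm).
  apply: (measurableT_comp mf).
  have -> : (fun z : measurableTypeR R * measurableTypeR R =>
      clamp c K z.1 - clamp c K z.2) = (fun z => X z.1 - X z.2).
    by apply/funext => z; rewrite /X; ring.
  by have [] := bmeasB bX1 bX2.
have [B B0 fB] := continuous_bounded_on 0 (2 * K) (@force_continuous _ _ _ _ W_adm i j).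
exists B => z; apply: fB; rewrite subr0.
have -> : clamp c K z.1 - clamp c K z.2 = X z.1 - X z.2 by rewrite /X; ring.
by rewrite (le_trans (ler_normB _ _))// mulr_natl mulr2n lerD// clamp_itv.
Qed.

Let dint i j (g : measurableTypeR R * measurableTypeR R -> R) : R :=
  \int[nu i]_x (\int[nu j]_y g (x, y)).

Let dintB i j g h : bmeas g -> bmeas h ->
  dint i j (fun z => g z - h z) = dint i j g - dint i j h.
Proof.
move=> bg bh; rewrite /dint -RintegralB//; first last.
- by have := bmeas_integrable (nu_fin i) (bmeas_Rintegral1 (nu_fin i) (nu_fin j) bh).
- by have := bmeas_integrable (nu_fin i) (bmeas_Rintegral1 (nu_fin i) (nu_fin j) bg).
apply: eq_Rintegral => x _; rewrite RintegralB//.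
- by have := bmeas_integrable (nu_fin j) (bmeas_slice1 bg x).
- by have := bmeas_integrable (nu_fin j) (bmeas_slice1 bh x).
Qed.

Let le_dint i j g h : bmeas g -> bmeas h -> (forall z, g z <= h z) ->
  dint i j g <= dint i j h.
Proof.
move=> bg bh gh; apply: le_Rintegral => //.
- by have := bmeas_integrable (nu_fin i) (bmeas_Rintegral1 (nu_fin i) (nu_fin j) bg).
- by have := bmeas_integrable (nu_fin i) (bmeas_Rintegral1 (nu_fin i) (nu_fin j) bh).
move=> x _; apply: le_Rintegral => //.
- by have := bmeas_integrable (nu_fin j) (bmeas_slice1 bg x).
- by have := bmeas_integrable (nu_fin j) (bmeas_slice1 bh x).
Qed.

Let S i := \int[nu i]_x (X x ^+ 2).
Let A i := \int[nu i]_x (X x).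

Let bX2X : bmeas (fun x : measurableTypeR R => X x ^+ 2).
Proof. exact: bmeasM bX bX. Qed.

Let dint_sqr i j : dint i j (fun z => (X z.1 - X z.2) ^+ 2) =
  p j * S i + p i * S j - 2 * A i * A j.
Proof.
rewrite /dint.
have i1 k := bmeas_integrable (nu_fin k) bX.
have i2 k := bmeas_integrable (nu_fin k) bX2X.
have ic k (a : R) := bmeas_integrable (nu_fin k) (bmeas_cst (d := _) (T := measurableTypeR R) a).
transitivity (\int[nu i]_x (p j * X x ^+ 2 + S j - (2 * A j) * X x)).
  apply: eq_Rintegral => x _.
  transitivity (\int[nu j]_y (X x ^+ 2 + X y ^+ 2 - (2 * X x) * X y)).
    by apply: eq_Rintegral => y _ /=; ring.
  rewrite RintegralB//; last 2 first.
    by have := bmeas_integrable (nu_fin j) (bmeasD (bmeas_cst (X x ^+ 2)) bX2X).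
    by have := bmeas_integrable (nu_fin j) (bmeasM (bmeas_cst (2 * X x)) bX).
  rewrite RintegralD//; last by have := ic j (X x ^+ 2).
  rewrite RintegralZl// (Rintegral_cst_mass (mass j)) -/(S j) -/(A j).
  ring.
have b1 : bmeas (fun x : measurableTypeR R => p j * X x ^+ 2).
  by apply: bmeasM => //; exact: bmeas_cst.
rewrite RintegralB//; last 2 first.
  by have := bmeas_integrable (nu_fin i) (bmeasD b1 (bmeas_cst (S j))).
  by have := bmeas_integrable (nu_fin i) (bmeasM (bmeas_cst (2 * A j)) bX).
rewrite RintegralD//; last 2 first.
  by have := bmeas_integrable (nu_fin i) b1.
  by have := ic i (S j).
rewrite !RintegralZl// (Rintegral_cst_mass (mass i)) -/(S i) -/(A i).
ring.
Qed.

Let bXf i j : bmeas (fun z : measurableTypeR R * measurableTypeR R => X z.1 * f i j z).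
Proof. exact: bmeasM bX1 (bf i j). Qed.

Let bYf i j : bmeas (fun z : measurableTypeR R * measurableTypeR R => X z.2 * f i j z).
Proof. exact: bmeasM bX2 (bf i j). Qed.

(* Newton's third law. *)
Let dint_swap i j : dint i j (fun z => X z.2 * f i j z) =
  - dint j i (fun z => X z.1 * f j i z).
Proof.
rewrite /dint (bmeas_Fubini (nu_fin i) (nu_fin j) (bYf i j)).
have E0 (z : R) : - z = -1 * z by rewrite mulN1r.
rewrite [RHS]E0 -RintegralZl//; last first.
  by have := bmeas_integrable (nu_fin j) (bmeas_Rintegral1 (nu_fin j) (nu_fin i) (bXf j i)).
apply: eq_Rintegral => y _; rewrite -RintegralZl//; last first.
  by have := bmeas_integrable (nu_fin i) (bmeas_slice1 (bXf j i) y).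
apply: eq_Rintegral => x _; rewrite /f/= mulN1r -mulrN -(forceN W_adm) opprB.
by rewrite (forceC W_adm).
Qed.

Let drift_dint i : \int[nu i]_x (2 * (x - c) * drift W nu i x) =
  2 * \sum_j dint i j (fun z => X z.1 * f i j z).
Proof.
have bI j : bmeas (fun x : measurableTypeR R => \int[nu j]_y f i j (x, y)).
  by have := bmeas_Rintegral1 (nu_fin i) (nu_fin j) (bf i j).
have bs : bmeas (fun x : measurableTypeR R => \sum_j \int[nu j]_y f i j (x, y)).
  exact: bmeas_sum.
have b2X : bmeas (fun x : measurableTypeR R => 2 * X x).
  by apply: bmeasM => //; exact: bmeas_cst.
have mom2 j : (\int[nu j]_x (x ^+ 2)%:E < +oo)%E.
  have := supported_integrable (mass j) K0 (sup j) (@exprn_continuous R 2).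
  by move=> /(integrable_fin_num measurableT); rewrite fin_numElt => /andP[].
rewrite (@supported_eq _ (nu i) c K (sup i) _ (fun x => 2 * X x * \sum_j \int[nu j]_y f i j (x, y))).
- have ij j : (nu i).-integrable setT (EFin \o (fun x : measurableTypeR R =>
      (2 * X x) * \int[nu j]_y f i j (x, y))).
    by have := bmeas_integrable (nu_fin i) (bmeasM b2X (bI j)).
  rewrite mulr_sumr; under eq_Rintegral do rewrite mulr_sumr.
  rewrite Rintegral_sum//; apply: eq_bigr => j _.
  have h := bmeas_integrable (nu_fin i) (bmeas_Rintegral1 (nu_fin i) (nu_fin j) (bXf i j)).
  rewrite /dint -(RintegralZl 2 measurableT h).
  apply: eq_Rintegral => x _; rewrite -mulrA; congr (2 * _); rewrite -RintegralZl//.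
  by have := bmeas_integrable (nu_fin j) (bmeas_slice1 (bf i j) x).
- apply: continuous_measurable_fun => x.
  apply: (@continuousM R R (fun x => 2 * (x - c)) (drift W nu i)).
    apply: (@continuousM R R (cst 2) (fun x => x - c)); first exact: cvg_cst.
    by apply: continuousB; [exact: cvg_id|exact: cvg_cst].
  exact: (drift_continuous W_adm mass mom2).
- by have [] := bmeasM b2X bs.
- move=> x xK; have xE := clamp_id xK.
  have -> : drift W nu i x = \sum_j \int[nu j]_y f i j (x, y).
    apply: eq_bigr => j _.
    rewrite (supported_clamp K0 (sup j) (@force_sub_continuous _ _ _ _ W_adm i j x)).
    by apply: eq_Rintegral => y _; rewrite /f [(x, y).1]/= xE.
  by rewrite {1}/X xE.
Qed.

Hypothesis center : \sum_i (m i)^-1 * \int[nu i]_x (x - c) = 0.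

(** Pairing (i, j) with (j, i) through [dint_swap] turns the factor x - c into x - y, and
    [force_mono] at x - y and 0 bounds the product with the force below by kappa_ij (x - y)^2.
    Expanded by [dint_sqr], this is the quadratic form of [lambda0_quadratic], whose linear
    constraint is [center]. *)
Lemma dissipation : 2 * lambda0 m p kappa *
    \sum_i (m i)^-1 * \int[nu i]_x ((x - c) ^+ 2) <=
  \sum_i \int[nu i]_x (2 * (x - c) * drift W nu i x).
Proof.
have SE i : \int[nu i]_x ((x - c) ^+ 2) = S i.
  rewrite (supported_clamp K0 (sup i))// => x.
  apply: (@continuous_comp R R R (fun y => y - c) (fun y => y ^+ 2)).
    by apply: continuousB; [exact: cvg_id|exact: cvg_cst].
  exact: exprn_continuous.
have AE i : \int[nu i]_x (x - c) = A i.
  rewrite (supported_clamp K0 (sup i))// => x.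
  by apply: continuousB; [exact: cvg_id|exact: cvg_cst].
under eq_bigr do rewrite SE.
have bd : bmeas (fun z : measurableTypeR R * measurableTypeR R => (X z.1 - X z.2) ^+ 2).
  exact: bmeasM (bmeasB bX1 bX2) (bmeasB bX1 bX2).
have D0 i j : 0 <= p j * S i + p i * S j - 2 * A i * A j.
  rewrite -dint_sqr; apply: Rintegral_ge0 => x _.
  by apply: Rintegral_ge0 => y _; exact: sqr_ge0.
have A0 : \sum_i (m i)^-1 * A i = 0.
  by rewrite -[RHS]center; apply: eq_bigr => i _; rewrite AE.
apply: (le_trans (lambda0_quadratic m_gt0 p_gt0 (adm_kappa_sym W_adm) D0 A0)).
under [leRHS]eq_bigr do rewrite drift_dint.
rewrite -mulr_sumr.
pose a i j := dint i j (fun z => X z.1 * f i j z).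
have -> : 2 * \sum_i \sum_j dint i j (fun z => X z.1 * f i j z) =
    \sum_i \sum_j (a i j + a j i).
  rewrite mulr_natl mulr2n [X in _ + X]exchange_big/= -big_split/=.
  by apply: eq_bigr => i _; rewrite -big_split.
apply: ler_sum => i _; apply: ler_sum => j _.
have -> : a j i = - dint i j (fun z => X z.2 * f i j z) by rewrite dint_swap opprK.
rewrite /a -dintB; [|exact: bXf|exact: bYf].
have -> : kappa i j * (p j * S i + p i * S j - 2 * A i * A j) =
    dint i j (fun z => kappa i j * (X z.1 - X z.2) ^+ 2).
  rewrite -dint_sqr /dint -RintegralZl//; last first.
    by have := bmeas_integrable (nu_fin i) (bmeas_Rintegral1 (nu_fin i) (nu_fin j) bd).
  apply: eq_Rintegral => x _; rewrite RintegralZl//.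
  by have := bmeas_integrable (nu_fin j) (bmeas_slice1 bd x).
apply: le_dint.
- by apply: bmeasM bd; exact: bmeas_cst.
- exact: bmeasB (bXf i j) (bYf i j).
move=> z; have := force_mono W_adm i j (X z.1 - X z.2) 0.
rewrite (force0 W_adm) !subr0 -mulrBl mulrC => h; apply: le_trans h _.
rewrite mulrC /f; have -> : clamp c K z.1 - clamp c K z.2 = X z.1 - X z.2 by rewrite /X; ring.
by [].
Qed.

End dissipation.

(** * Continuity in time on [0, T) *)

Section time_continuity.
Context {R : realType}.

Definition time_continuous (T : R) (H : R -> R) := forall s e : R, 0 <= s -> s < T -> 0 < e ->
  exists2 del : R, 0 < del & forall t : R, 0 <= t -> t < T -> `|t - s| <= del ->
    `|H t - H s| <= e.

Lemma time_continuous_within T H a b : 0 < a -> b < T -> time_continuous T H ->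
  {within `[a, b], continuous H}.
Proof.
move=> a0 bT cH; apply: continuous_in_subspaceT => s; rewrite inE/= in_itv/= => /andP[as_ sb].
have s0 : 0 < s := lt_le_trans a0 as_.
have sT : s < T := le_lt_trans sb bT.
apply/cvgrPdist_le => e e0.
have [del del0 h] := cH s e (ltW s0) sT e0.
exists (Num.min del (Num.min s (T - s))); first by rewrite /= !lt_min del0 s0 subr_gt0.
move=> t /=; rewrite !lt_min => /and3P[td ts tT].
rewrite distrC; apply: h; last by rewrite distrC ltW.
  by move: ts; rewrite ltr_norml => /andP[_]; lra.
by move: tT; rewrite ltr_norml => /andP[+ _]; lra.
Qed.

Lemma time_continuousW T H : continuous H -> time_continuous T H.
Proof.
move=> cH s e _ _ e0; have /cvgrPdist_lt/(_ _ e0) [d /= d0 hd] := cH s.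
exists (d / 2) => [|t _ _ ts]; first by rewrite divr_gt0.
rewrite distrC ltW//; apply: hd => /=; rewrite distrC (le_lt_trans ts)//.
by rewrite ltr_pdivrMr// mulr_natr mulr2n ltrDl.
Qed.

Lemma time_continuousD T H K : time_continuous T H -> time_continuous T K ->
  time_continuous T (fun t => H t + K t).
Proof.
move=> cH cK s e s0 sT e0; have e2 : 0 < e / 2 by rewrite divr_gt0.
have [d1 d10 h1] := cH s _ s0 sT e2; have [d2 d20 h2] := cK s _ s0 sT e2.
exists (Num.min d1 d2) => [|t t0 tT]; first by rewrite lt_min d10.
rewrite le_min => /andP[td1 td2]; have := h1 t t0 tT td1; have := h2 t t0 tT td2.
have -> : H t + K t - (H s + K s) = (H t - H s) + (K t - K s) by ring.
by have := ler_normD (H t - H s) (K t - K s); lra.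
Qed.

Lemma time_continuousM T H K : time_continuous T H -> time_continuous T K ->
  time_continuous T (fun t => H t * K t).
Proof.
move=> cH cK s e s0 sT e0.
have D0 : 0 < 1 + `|H s| + `|K s| by rewrite ltr_wpDr// ltr_wpDr.
pose e1 := Num.min 1 (e / (1 + `|H s| + `|K s|)).
have e10 : 0 < e1 by rewrite lt_min ltr01 divr_gt0.
have [d1 d10 h1] := cH s _ s0 sT e10; have [d2 d20 h2] := cK s _ s0 sT e10.
exists (Num.min d1 d2) => [|t t0 tT]; first by rewrite lt_min d10.
rewrite le_min => /andP[td1 td2]; have {}h1 := h1 t t0 tT td1; have {}h2 := h2 t t0 tT td2.
have -> : H t * K t - H s * K s = (H t - H s) * (K t - K s) +
  H s * (K t - K s) + (H t - H s) * K s by ring.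
have : e1 * (1 + `|H s| + `|K s|) <= e by rewrite -ler_pdivlMr// ge_min lexx orbT.
apply: le_trans; rewrite [leRHS]mulrDr [X in _ <= X + _]mulrDr mulr1.
rewrite (le_trans (ler_normD _ _))// lerD//; last by rewrite normrM ler_wpM2r.
rewrite (le_trans (ler_normD _ _))// lerD//; last by rewrite normrM mulrC ler_wpM2r.
by rewrite normrM -[e1]mulr1 ler_pM// (le_trans h2)// ge_min lexx.
Qed.

Lemma right_continuous_at_sum n (F : 'I_n -> R -> R) s :
  (forall i, right_continuous_at (F i) s) ->
  right_continuous_at (fun t => \sum_i F i t) s.
Proof.
elim: n F => [F _|n IH F cF] e e0.
  by exists 1 => // x _; rewrite !big_ord0 subrr normr0 ltW.
have e2 : 0 < e / 2 by rewrite divr_gt0.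
have [d1 d10 h1] := cF ord0 _ e2.
have [d2 d20 h2] := IH (fun i => F (lift ord0 i)) (fun i => cF _) _ e2.
exists (Num.min d1 d2) => [|x /andP[sx xd]]; first by rewrite lt_min d10.
rewrite !big_ord_recl.
have x1 : s <= x <= s + d1 by rewrite sx (le_trans xd)// lerD2l ge_min lexx.
have x2 : s <= x <= s + d2 by rewrite sx (le_trans xd)// lerD2l ge_min lexx orbT.
have {}h1 := h1 x x1; have {}h2 := h2 x x2.
set A := \sum_i _ in h2 *; set B := \sum_i _ in h2 *.
have -> : F ord0 x + A - (F ord0 s + B) = (F ord0 x - F ord0 s) + (A - B) by ring.
by have := ler_normD (F ord0 x - F ord0 s) (A - B); lra.
Qed.

End time_continuity.

Section second_moment.
Context {R : realType} {n : nat}.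
Variables (m p : 'I_n.+1 -> R) (E : R) (W : R -> 'M[R]_n.+1) (kappa : 'M[R]_n.+1).
Hypothesis m_gt0 : forall i, 0 < m i.
Hypothesis p_gt0 : forall i, 0 < p i.
Hypothesis W_adm : admissible W kappa.

Variable mu : R -> 'I_n.+1 -> borelR R.
Hypothesis muP : forall t : R, 0 <= t -> in_P m p E (mu t).
Hypothesis weak : weak_solution m W mu.
Hypothesis wc : weakly_continuous p mu.

Let mass (t : R) j : 0 <= t -> mu t j setT = (p j)%:E.
Proof. by move=> /muP[]. Qed.

Let mom2 (t : R) j : 0 <= t -> (\int[mu t j]_x (x ^+ 2)%:E < +oo)%E.
Proof. by move=> /muP[]. Qed.

Variables (c K T : R).
Hypothesis K0 : 0 <= K.
Hypothesis sup : forall (t : R) j, 0 <= t -> t < T -> supported (mu t j) c K.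

(** Uniformity in x on the interval holds because the integrands y -> W_ij'(x - clamp y) share one
    modulus, and the bound in [weakly_continuous] depends on the integrand through its modulus only.
    The two halves of [e] pay for the additive part of the modulus, summed against the masses, and
    for its quadratic part, summed over the n + 1 species. *)
Lemma drift_time_continuous (s e : R) i : 0 <= s -> s < T -> 0 < e ->
  exists2 del : R, 0 < del & forall t x : R, 0 <= t -> t < T -> `|t - s| <= del ->
    `|x - c| <= K -> `|drift W (mu t) i x - drift W (mu s) i x| <= e.
Proof.
move=> s0 sT e0.
have P0 : 0 < \sum_j p j.
  rewrite (bigD1 i)//= ltr_wpDr// sumr_ge0// => j _; exact: ltW.
have e1 : 0 < e / 2 / \sum_j p j by rewrite !divr_gt0.
have [C C0 hC] := force_modulus W_adm (2 * K) e1.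
have N0 : 0 < n.+1%:R * C + 1 by rewrite ltr_wpDl// mulr_ge0.
have r0 : 0 < e / 2 / (n.+1%:R * C + 1) by rewrite !divr_gt0.
have [del del0 H] := wc s0 r0.
exists del => // t x t0 tT ts xK.
rewrite /drift -sumrB (le_trans (ler_norm_sum _ _ _))//.
apply: (@le_trans _ _ (\sum_j ((e / 2 / \sum_j p j) * p j + C * (e / 2 / (n.+1%:R * C + 1))))).
  apply: ler_sum => j _.
  rewrite (supported_clamp K0 (sup j t0 tT)); last exact: (force_sub_continuous W_adm).
  rewrite (supported_clamp K0 (sup j s0 sT)); last exact: (force_sub_continuous W_adm).
  apply: (H t j (fun y => force W i j (x - clamp c K y))) => //; last 2 first.
  - exact: ltW.
  - move=> y z.
    have cl y' : `|x - clamp c K y'| <= 2 * K.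
      have -> : x - clamp c K y' = (x - c) - (clamp c K y' - c) by ring.
      by rewrite (le_trans (ler_normB _ _))// mulr_natl mulr2n lerD// clamp_itv.
    rewrite (le_trans (hC i j _ _ (cl y) (cl z)))// lerD2l ler_wpM2l//.
    have -> : x - clamp c K y - (x - clamp c K z) = - (clamp c K y - clamp c K z) by ring.
    rewrite sqrrN -[leLHS]real_normK ?num_real// -[leRHS]real_normK ?num_real//.
    by apply: lerXn2r; rewrite ?nnegrE// clamp_lip.
  - move=> y; apply: (@continuous_comp R R R (clamp c K) (fun y => force W i j (x - y))).
      exact: clamp_continuous.
    exact: (force_sub_continuous W_adm).
rewrite big_split/= -mulr_sumr divfK ?gt_eqF// sumr_const card_ord -mulr_natl.
have : n.+1%:R * (C * (e / 2 / (n.+1%:R * C + 1))) <= e / 2.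
  rewrite mulrA mulrCA ler_piMr ?divr_ge0 ?(ltW e0)// ler_pdivrMr// mul1r lerDl//.
by lra.
Qed.

(** The difference is split into a change of drift against [mu t i], small uniformly on the support,
    and a change of measure for the fixed integrand at time [s]. The continuity makes the flux
    integrable in time, so that the equations of the species can be added. *)
Lemma flux_time_continuous i (psi : R -> R) (L : R) : smooth psi -> 0 <= L ->
  (forall x, L <= `|x - c| -> psi x = 0) ->
  time_continuous T (fun t => \int[mu t i]_x (derive1 psi x * drift W (mu t) i x)).
Proof.
move=> spsi L0 psi0 s e s0 sT e0.
have cpsi := smooth_continuous (smooth_derive spsi).
have cd (t : R) : 0 <= t -> continuous (drift W (mu t) i).
  by move=> t0; exact: (drift_continuous W_adm (fun j => mass j t0) (fun j => mom2 j t0)).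
have cM (t : R) : 0 <= t -> continuous (fun x => derive1 psi x * drift W (mu t) i x).
  by move=> t0 x; apply: continuousM; [exact: cpsi|exact: cd].
have [B B0 hB] := continuous_bounded_on c K cpsi.
have BP : 0 < B * p i + 1 by rewrite ltr_wpDl// mulr_ge0// ltW.
have e1 : 0 < e / 2 / (B * p i + 1) by rewrite !divr_gt0.
have [d1 d10 h1] := drift_time_continuous i s0 sT e1.
have e2 : 0 < e / 2 by rewrite divr_gt0.
have off x : L + 1 <= `|x - c| -> derive1 psi x * drift W (mu s) i x = 0.
  by move=> xL; rewrite (derive1_off psi0) ?mul0r// (lt_le_trans _ xL)// ltrDl.
have L1 : 0 <= L + 1 by rewrite addr_ge0.
have [d2 d20 h2] := Rintegral_time_continuous p_gt0 wc i (cM s s0) L1 off s0 e2.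
exists (Num.min d1 d2) => [|t t0 tT]; first by rewrite lt_min d10.
rewrite le_min => /andP[td1 td2].
have {}h2 := h2 t t0 td2.
have -> : e = e / 2 + e / 2 by lra.
set Its := \int[mu t i]_x _ in h2; set Is := \int[mu s i]_x _ in h2 *.
set It := \int[mu t i]_x _.
have -> : It - Is = (It - Its) + (Its - Is) by ring.
rewrite (le_trans (ler_normD _ _))// lerD//.
rewrite /It /Its -RintegralB//; try exact: (supported_integrable (mass i t0) K0 (sup i t0 tT) (cM _ _)).
have cB : continuous (fun x => derive1 psi x * drift W (mu t) i x - derive1 psi x * drift W (mu s) i x).
  move=> x; apply: (@continuousB _ _ _ (fun x => derive1 psi x * drift W (mu t) i x)
    (fun x => derive1 psi x * drift W (mu s) i x)); exact: cM.
rewrite (supported_clamp K0 (sup i t0 tT) cB).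
apply: (le_trans (@Rintegral_bound_mass _ _ _ (mass i t0) _ (B * (e / 2 / (B * p i + 1))) (bmeas_clamp c cB K0) _)).
  move=> x; rewrite -mulrBr normrM ler_pM//; first by apply: hB; exact: clamp_itv.
  by apply: h1 => //; exact: clamp_itv.
rewrite mulrAC mulrCA ler_piMr ?divr_ge0 ?(ltW e0)// ler_pdivrMr// mul1r lerDl//.
Qed.

Hypothesis cE : c = x_oo m p E.

Lemma centered (nu : 'I_n.+1 -> borelR R) : in_P m p E nu ->
  \sum_i (m i)^-1 * \int[nu i]_x (x - c) = 0.
Proof.
move=> [mass' mom' cen].
have -> : \sum_i (m i)^-1 * \int[nu i]_x (x - c) =
    \sum_i ((m i)^-1 * (\int[nu i]_x x) - c * (p i / m i)).
  apply: eq_bigr => i _; rewrite RintegralB//; last 2 first.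
  - apply: (@quadratic_integrable _ _ _ (mass' i) (fun x => x) 1 (mom' i)).
      by move=> x; exact: cvg_id.
    move=> x; rewrite mul1r; have := sqr_ge0 (`|x| - 1).
    by rewrite -[x ^+ 2]real_normK ?num_real//; have := normr_ge0 x; have := sqr_ge0 `|x|; lra.
  - have nf : (nu i setT < +oo)%E by rewrite mass' ltry.
    by have := bmeas_integrable nf (bmeas_cst c).
  by rewrite (Rintegral_cst_mass (mass' i)); ring.
rewrite sumrB cen -mulr_sumr cE /x_oo mulfVK ?subrr// gt_eqF//.
by rewrite big_ord_recl ltr_wpDr ?divr_gt0// sumr_ge0// => j _; rewrite divr_ge0// ltW.
Qed.

(** The squared distance in the weighted Wasserstein metric from [mu t] to the Dirac state at
    [c]. *)
Definition Phi t := \sum_i (m i)^-1 * \int[mu t i]_x ((x - c) ^+ 2).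

Let psi (x : R) := bump c K x * (x - c) ^+ 2.

Let spsi : smooth psi.
Proof.
apply: smoothM; first exact: smooth_bump.
have h := @smooth_affine R _ 1 (- c) (@smoothX R 2).
by move: h; under eq_fun do rewrite mul1r.
Qed.

Let psi0 x : K + 1 <= `|x - c| -> psi x = 0.
Proof. by move=> h; rewrite /psi bump_eq0// mul0r. Qed.

Let psi_derive x : `|x - c| <= K -> derive1 psi x = 2 * (x - c).
Proof.
move=> xK.
have h1 := @smooth_is_derive _ _ x (@smooth_bump R c K).
have h2 : is_derive x 1 (fun y : R => (y - c) ^+ 2) (2 * (x - c)).
  have h := derive1_affine (smooth_derivable (x := 1 * x + (- c)) (@smoothX R 2)).
  move: h; rewrite !mul1r exp_derive1 expr1 /GRing.scale/=; under eq_fun do rewrite mul1r.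
  exact.
have hM : is_derive x 1 psi _ := is_deriveM h1 h2.
rewrite derive1E; have [_ ->] := hM.
by rewrite bump_derive_eq0// bump_eq1// /GRing.scale/= mul1r mulr0 addr0.
Qed.

Let Fi i t := \int[mu t i]_x psi x.
Let Gi i t := - m i * \int[mu t i]_x (derive1 psi x * drift W (mu t) i x).

Let K10 : 0 <= K + 1. Proof. by rewrite addr_ge0. Qed.

Let cFi i : time_continuous T (Fi i).
Proof.
move=> s e s0 sT e0.
have [d d0 h] := Rintegral_time_continuous p_gt0 wc i (smooth_continuous spsi) K10 psi0 s0 e0.
by exists d => // t t0 _; exact: h.
Qed.

Let cpsi' i t : 0 <= t -> continuous (fun x => derive1 psi x * drift W (mu t) i x).
Proof.
move=> t0 x; apply: continuousM; first exact: (smooth_continuous (smooth_derive spsi)).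
exact: (drift_continuous W_adm (fun j => mass j t0) (fun j => mom2 j t0)).
Qed.

Let PhiE t : 0 <= t -> t < T -> Phi t = \sum_i (m i)^-1 * Fi i t.
Proof.
move=> t0 tT; apply: eq_bigr => i _; congr (_ * _); apply: (supported_eq (sup i t0 tT)).
- apply: continuous_measurable_fun => x.
  apply: (@continuous_comp R R R (fun y => y - c) (fun y => y ^+ 2)).
    by apply: continuousB; [exact: cvg_id|exact: cvg_cst].
  exact: exprn_continuous.
- by apply: continuous_measurable_fun; exact: smooth_continuous spsi.
- by move=> x xK; rewrite /psi bump_eq1// mul1r.
Qed.

(** The weak equation holds for each species, the dissipation estimate only for the weighted sum.
    The sum is therefore taken inside the time integral, which is legitimate because each summand
    [fi i] is continuous, hence integrable, on [a, b]. The truncated square [psi] agrees with (x -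
    c)^2 on the supports. *)
Lemma second_moment_decay (s t : R) : 0 <= s -> s <= t -> t < T ->
  expR (2 * lambda0 m p kappa * t) * Phi t <= expR (2 * lambda0 m p kappa * s) * Phi s.
Proof.
move=> s0 st tT.
have t0 := le_trans s0 st.
have sT := le_lt_trans st tT.
have := @weak_gronwall R (fun t => \sum_i (m i)^-1 * Fi i t)
  (fun t => \sum_i (m i)^-1 * Gi i t) (2 * lambda0 m p kappa) 0 0 T (lexx 0).
have H1 r : 0 <= r -> right_continuous_at (fun t => \sum_i (m i)^-1 * Fi i t) r.
  move=> r0; apply: (right_continuous_at_sum (F := fun i t => (m i)^-1 * Fi i t)) => i.
  apply: right_continuous_atM.
    by move=> e e0; exists 1 => // x _; rewrite subrr normr0 ltW.
  apply: time_right_continuous_at => // e e0.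
  exact: (Rintegral_time_continuous p_gt0 wc i (smooth_continuous spsi) K10 psi0 r0 e0).
have H2 r : 0 < r -> r < T -> \sum_i (m i)^-1 * Gi i r <=
    2 * lambda0 m p kappa * (0 - \sum_i (m i)^-1 * Fi i r).
  move=> r0 rT; rewrite -PhiE ?(ltW r0)// sub0r mulrN lerNr.
  have := dissipation m_gt0 p_gt0 W_adm (fun j => mass j (ltW r0)) K0
    (fun j => sup j (ltW r0) rT) (centered (muP (ltW r0))).
  move=> /le_trans; apply; rewrite -sumrN; apply: ler_sum => i _.
  rewrite /Gi mulNr mulrN opprK mulrA mulVf ?gt_eqF// mul1r.
  rewrite le_eqVlt; apply/orP; left; apply/eqP.
  apply: (supported_eq (sup i (ltW r0) rT)).
  - apply: continuous_measurable_fun => x.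
    apply: (@continuousM R R (fun x => 2 * (x - c)) (drift W (mu r) i)).
      apply: (@continuousM R R (cst 2) (fun x => x - c)); first exact: cvg_cst.
      by apply: continuousB; [exact: cvg_id|exact: cvg_cst].
    exact: (drift_continuous W_adm (fun j => mass j (ltW r0)) (fun j => mom2 j (ltW r0))).
  - by apply: continuous_measurable_fun; apply: cpsi'; exact: ltW.
  - by move=> x xK; rewrite psi_derive.
move=> /(_ H1 H2) H.
rewrite !PhiE//.
have := H _ s t s0 st tT; rewrite !subr0; apply.
move=> th a b a0 ab bT sth th0 thab.
pose fi i r := derive1 th r * Fi i r + th r * Gi i r.
have off r : `]0%R, +oo[%classic r -> ~ `[a, b]%classic r -> derive1 th r = 0 /\ th r = 0.
  move=> _ nr; split; last by apply/eqP; apply: contra_notT nr => /thab.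
  have thc x : (b - a) / 2 <= `|x - (a + b) / 2| -> x \notin `]a, b[.
    rewrite in_itv/= ler_normr => /orP[] h; apply/negP => /andP[]; lra.
  have [d d0 hd] : exists2 d, 0 < d & forall x, `|r - x| < d -> th x = 0.
    have : ~ (a <= r <= b) by move=> h; apply: nr; rewrite /= in_itv.
    move=> /negP; rewrite negb_and -!ltNge => /orP[ra|br].
      exists (a - r); first by rewrite subr_gt0.
      move=> x; rewrite ltr_norml => /andP[h1 h2]; apply/eqP.
      apply: contraT => /thab; rewrite in_itv/= => /andP[h3 _]; lra.
    exists (r - b); first by rewrite subr_gt0.
    move=> x; rewrite ltr_norml => /andP[h1 h2]; apply/eqP.
    apply: contraT => /thab; rewrite in_itv/= => /andP[_ h3]; lra.
  rewrite derive1E.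
  have nh : \near r, th r = cst 0 r by exists d.
  by rewrite (near_eq_derive _ nh) derive_cst.
have int0 i : (\int[lebesgue_measure]_(r in `[a, b]) (fi i r)%:E = 0)%E.
  rewrite -[RHS](weak_product W_adm muP weak i spsi psi0 a0 sth thab).
  rewrite (@integral_off _ `[a, b] `]0%R, +oo[)//.
    by move=> x /=; rewrite !in_itv/= andbT => /andP[ax _]; exact: lt_le_trans ax.
  by move=> r r0 nr; have [-> ->] := off r r0 nr; rewrite !mul0r addr0.
have ci i : {within `[a, b], continuous (fi i)}.
  apply: (@time_continuous_within _ T) => //.
  apply: time_continuousD; apply: time_continuousM.
  - exact: time_continuousW (smooth_continuous (smooth_derive sth)).
  - exact: cFi.
  - exact: time_continuousW (smooth_continuous sth).
  - apply: time_continuousM; first exact: time_continuousW (@cst_continuous _ _ _).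
    exact: flux_time_continuous spsi K10 psi0.
have inti i : lebesgue_measure.-integrable `[a, b] (EFin \o (fi i)).
  by apply: continuous_compact_integrable; [exact: segment_compact|exact: ci].
rewrite (@integral_off _ `[a, b] `]0%R, +oo[)//; last 2 first.
- by move=> x /=; rewrite !in_itv/= andbT => /andP[ax _]; exact: lt_le_trans ax.
- by move=> r r0 nr; have [-> ->] := off r r0 nr; rewrite !mul0r addr0.
rewrite (_ : (\int[_]_(x in _) _)%E =
   (\int[lebesgue_measure]_(r in `[a, b]) (\sum_i ((m i)^-1)%:E * (fi i r)%:E))%E); last first.
  apply: eq_integral => r _; under [RHS]eq_bigr do rewrite -EFinM.
  rewrite sumEFin; congr EFin; rewrite !mulr_sumr -big_split/=.
  by apply: eq_bigr => i _; rewrite /fi; ring.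
rewrite integral_sum//; last by move=> i; apply: integrableZl => //; exact: inti.
by rewrite big1// => i _; rewrite integralZl ?int0 ?mule0//; exact: inti.
Qed.

End second_moment.

(** * Concentration of the supports *)

Lemma expR_small (R : realType) (C a e : R) : 0 <= C -> 0 < a -> 0 < e ->
  exists2 T : R, 0 <= T & forall t : R, T <= t -> C * expR (- (a * t)) <= e.
Proof.
move=> C0 a0 e0; exists (C / e / a) => [|t Tt]; first by rewrite !divr_ge0// ltW.
rewrite expRN ler_pdivrMr ?expR_gt0//.
have h : C <= e * (a * t).
  by move: Tt; rewrite ler_pdivrMr// ler_pdivrMr// mulrC [t * a]mulrC.
apply: (le_trans h); rewrite ler_wpM2l ?(ltW e0)//.
by rewrite (le_trans _ (expR_ge1Dx _))// lerDr.
Qed.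

Lemma even_expr_norm (R : realType) (u : R) j : u ^+ (2 * j) = `|u| ^+ (2 * j).
Proof. by rewrite !exprM real_normK ?num_real. Qed.

Lemma even_expr_normS (R : realType) (u : R) j :
  u ^+ (2 * j).+2 = `|u| ^+ (2 * j).+2.
Proof. by have := even_expr_norm u j.+1; rewrite mulnS. Qed.

(* The pointwise estimate behind the decay of the moments of order [2 j + 2]:
   where [|u| <= r] the possibly outward force is absorbed by [r ^+ (2 j + 2)]. *)
Lemma moment_drift_le (R : realType) (lam r D mv u : R) j : 0 < lam -> 0 <= r ->
  2 * D <= lam * r -> lam * `|u| ^+ 2 - D * `|u| <= mv * u ->
  - ((2 * j).+2%:R * u ^+ (2 * j).+1 * mv) <=
  (2 * j).+2%:R / 2 * lam * (r ^+ (2 * j).+2 - u ^+ (2 * j).+2).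
Proof.
move=> l0 r0 Dr h.
rewrite (even_expr_normS u).
rewrite (exprSr u) (even_expr_norm u j).
set a := `|u| in h *; have a0 : 0 <= a by rewrite /a.
set N := ((2 * j).+2)%:R; have N0 : 0 <= N :> R by rewrite ler0n.
set b := a ^+ (2 * j); have b0 : 0 <= b by rewrite exprn_ge0.
(* Half of lam a^2 is kept for the decay. The other half competes with D a <= lam r a / 2 and leaves
   b (r a - a^2), which is negative for a > r and at most r^(2 j + 2) otherwise. *)
have k1 : b * (r * a - a ^+ 2) <= r ^+ (2 * j).+2.
  have [ar|ra] := leP a r.
    apply: (@le_trans _ _ (b * (r * r))).
      apply: ler_wpM2l => //.
      by rewrite (@le_trans _ _ (r * a)) ?ler_wpM2l// lerBlDr lerDl sqr_ge0.
    rewrite -[(2 * j).+2]addn2 exprD expr2 ler_wpM2r ?mulr_ge0//.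
    by apply: lerXn2r.
  apply: (@le_trans _ _ 0); last by rewrite exprn_ge0.
  by rewrite mulr_ge0_le0// expr2 -mulrBl mulr_le0_ge0// subr_le0 ltW.
have k2 : b * (lam * a ^+ 2 - D * a) <= b * (mv * u) by rewrite ler_wpM2l.
have k3 : 2 * D * (a * b) <= lam * r * (a * b) by rewrite ler_wpM2r// mulr_ge0.
have -> : a ^+ (2 * j).+2 = b * a ^+ 2 by rewrite -[(2 * j).+2]addn2 exprD.
have k4 : lam * (b * (r * a - a ^+ 2)) <= lam * r ^+ (2 * j).+2 by rewrite ler_wpM2l// ltW.
have k5 : - (b * (mv * u)) <= 2^-1 * lam * (r ^+ (2 * j).+2 - b * a ^+ 2).
  move: k2 k3 k4; clear; set rN := r ^+ _; move: rN => rN; set mu_ := mv * u.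
  by move=> k2 k3 k4; lra.
have := ler_wpM2l N0 k5.
move: k5; clear; set rN := r ^+ _; move: rN => rN; lra.
Qed.

(** * Moments of high order about the centre *)

Section high_moments.
Context {R : realType} {n : nat}.
Variables (m p : 'I_n -> R) (E : R) (W : R -> 'M[R]_n) (kappa : 'M[R]_n).
Hypothesis m_gt0 : forall i, 0 < m i.
Hypothesis p_gt0 : forall i, 0 < p i.
Hypothesis W_adm : admissible W kappa.
Variable lam : R.
Hypothesis lam_gt0 : 0 < lam.
Hypothesis lam_le : forall i, lam <= m i * \sum_j kappa i j * p j.

Variable mu : R -> 'I_n -> borelR R.
Hypothesis muP : forall t : R, 0 <= t -> in_P m p E (mu t).
Hypothesis weak : weak_solution m W mu.
Hypothesis wc : weakly_continuous p mu.

Let mass (t : R) j : 0 <= t -> mu t j setT = (p j)%:E.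
Proof. by move=> /muP[]. Qed.

Let mom2 (t : R) j : 0 <= t -> (\int[mu t j]_x (x ^+ 2)%:E < +oo)%E.
Proof. by move=> /muP[]. Qed.

Variables (c K D r T T1 : R) (i : 'I_n).
Hypothesis K0 : 0 <= K.
Hypothesis r0 : 0 < r.
Hypothesis Dr : 2 * D <= lam * r.
Hypothesis T0 : 0 <= T.
Hypothesis sup : forall t : R, T <= t -> t < T1 -> supported (mu t i) c K.
Hypothesis hD : forall t : R, T <= t -> t < T1 -> m i * `|drift W (mu t) i c| <= D.

Let psi j (x : R) := bump c K x * (x - c) ^+ (2 * j).+2.

Let spsi j : smooth (psi j).
Proof.
apply: smoothM; first exact: smooth_bump.
have h := @smooth_affine R _ 1 (- c) (@smoothX R (2 * j).+2).
by move: h; under eq_fun do rewrite mul1r.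
Qed.

Let psi0 j x : K + 1 <= `|x - c| -> psi j x = 0.
Proof. by move=> h; rewrite /psi bump_eq0// mul0r. Qed.

Let psi_derive j x : `|x - c| <= K ->
  derive1 (psi j) x = (2 * j).+2%:R * (x - c) ^+ (2 * j).+1.
Proof.
move=> xK.
have h1 := @smooth_is_derive _ _ x (@smooth_bump R c K).
have h2 : is_derive x 1 (fun y : R => (y - c) ^+ (2 * j).+2) ((2 * j).+2%:R * (x - c) ^+ (2 * j).+1).
  have h := derive1_affine (smooth_derivable (x := 1 * x + (- c)) (@smoothX R (2 * j).+2)).
  move: h; rewrite !mul1r exp_derive1 /GRing.scale/=; under eq_fun do rewrite mul1r.
  exact.
have hM : is_derive x 1 (psi j) _ := is_deriveM h1 h2.
rewrite derive1E; have [_ ->] := hM.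
by rewrite bump_derive_eq0// bump_eq1// /GRing.scale/= mul1r mulr0 addr0.
Qed.

Let F j t := \int[mu t i]_x psi j x.

(** The rate is proportional to the order 2 j + 2 and the level [c0] is a power of the same order;
    after taking roots of that order, the rate lam / 2 and the radius [r] are left for every j. *)
Let moment_gronwall j (t a c0 : R) : T <= t -> t < T1 ->
  a = (2 * j).+2%:R / 2 * lam -> c0 = p i * r ^+ (2 * j).+2 ->
  expR (a * t) * (F j t - c0) <= expR (a * T) * (F j T - c0).
Proof.
move=> Tt tT1 aE c0E.
have K10 : 0 <= K + 1 by rewrite addr_ge0.
apply: (curve_gronwall p_gt0 W_adm muP weak wc (spsi j) K10 (@psi0 j) T0 _ (lexx T) Tt tT1).
move=> s Ts sT1; have s0 : 0 <= s := le_trans T0 (ltW Ts).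
have sup_s := sup (ltW Ts) sT1.
have cdr := drift_continuous W_adm (fun k => mass k s0) (fun k => mom2 k s0) (i := i).
have cflux : continuous (fun x => derive1 (psi j) x * drift W (mu s) i x).
  by move=> x; apply: continuousM; [exact: (smooth_continuous (smooth_derive (spsi j)))|exact: cdr].
have cpsi := smooth_continuous (spsi j).
have i1 := supported_integrable (mass i s0) K0 sup_s cflux.
have i2 := supported_integrable (mass i s0) K0 sup_s cpsi.
have cR : continuous (cst (r ^+ (2 * j).+2) : R -> R) by exact: cst_continuous.
have i3 := supported_integrable (mass i s0) K0 sup_s cR.
have cB : continuous (fun x => r ^+ (2 * j).+2 - psi j x).
  move=> x; apply: (@continuousB _ _ _ (cst (r ^+ (2 * j).+2)) (psi j)).
    exact: cvg_cst.
  exact: cpsi.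
have i4 := supported_integrable (mass i s0) K0 sup_s cB.
have -> : a * (c0 - \int[mu s i]_x psi j x) = \int[mu s i]_x (a * (r ^+ (2 * j).+2 - psi j x)).
  by rewrite RintegralZl// RintegralB// c0E (Rintegral_cst_mass (mass i s0)) (mulrC (p i)).
rewrite -RintegralZl//.
apply: (supported_Rintegral_le (mass i s0) K0 sup_s).
- move=> x; apply: (@continuousM R R (cst (- m i)) (fun x => derive1 (psi j) x * drift W (mu s) i x)).
    exact: cvg_cst.
  exact: cflux.
- move=> x; apply: (@continuousM R R (cst a) (fun x => r ^+ (2 * j).+2 - psi j x)).
    exact: cvg_cst.
  exact: cB.
move=> x xK.
rewrite psi_derive// /psi bump_eq1// mul1r mulNr aE.
have := drift_inward m_gt0 W_adm lam_le x (fun k => mass k s0) (fun k => mom2 k s0) (hD (ltW Ts) sT1).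
move=> /(moment_drift_le j lam_gt0 (ltW r0) Dr); apply: le_trans.
rewrite le_eqVlt; apply/orP; left; apply/eqP; ring.
Qed.

(* Chebyshev's inequality for the moments of order [2 j + 2], as [j] grows. *)
Lemma supported_shrink (L t : R) : T <= t -> t < T1 -> 0 <= L ->
  supported (mu T i) c L -> L * expR (- (lam / 2 * (t - T))) <= r ->
  2 * r <= K -> supported (mu t i) c (2 * r).
Proof.
move=> Tt tT1 L0 supT Lr rK.
have t0 : 0 <= t := le_trans T0 Tt.
have sup_t := sup Tt tT1.
have FT j : F j T <= p i * L ^+ (2 * j).+2.
  rewrite mulrC -(Rintegral_cst_mass (mass i T0)).
  apply: (supported_Rintegral_le (mass i T0) L0 supT).
  - exact: smooth_continuous (spsi j).
  - exact: cst_continuous.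
  - move=> x xL; rewrite /psi -[leRHS]mul1r.
    have /andP[b0 b1] := bump_itv c x K0.
    rewrite even_expr_normS ler_pM ?exprn_ge0//.
    exact: lerXn2r.
(* With N = 2 j + 2, the moment is at most p_i r^N plus the decayed initial moment p_i (L e^(- lam
   (t - T) / 2))^N, and the waiting time makes the second term at most the first. *)
have Ft j : F j t <= 2 * p i * r ^+ (2 * j).+2.
  have TT1 : T < T1 := le_lt_trans Tt tT1.
  have := moment_gronwall Tt tT1 (erefl ((2 * j).+2%:R / 2 * lam)) (erefl (p i * r ^+ (2 * j).+2)).
  set N := (2 * j).+2; set a := N%:R / 2 * lam.
  rewrite mulrC -ler_pdivlMr ?expR_gt0//.
  rewrite mulrAC -expRB => h.
  have e1 : expR (a * T - a * t) = expR (- (lam / 2 * (t - T))) ^+ N.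
    by rewrite -expRM_natl; congr expR; rewrite /a; field.
  have h2 : expR (a * T - a * t) * (F j T - p i * r ^+ N) <= p i * r ^+ N.
    rewrite e1; apply: (@le_trans _ _ (expR (- (lam / 2 * (t - T))) ^+ N * (p i * L ^+ N))).
      rewrite ler_wpM2l ?exprn_ge0 ?expR_ge0// lerBlDr (le_trans (FT j))// lerDl.
      by rewrite mulr_ge0 ?exprn_ge0// ltW.
    rewrite mulrCA ler_wpM2l ?(ltW (p_gt0 i))// mulrC -exprMn; apply: lerXn2r => //.
      by rewrite nnegrE mulr_ge0 ?expR_ge0.
    by rewrite nnegrE ltW.
  have := le_trans h h2; rewrite lerBlDr => /le_trans; apply.
  by rewrite -mulrA mulr_natl mulr2n.
pose g j (x : R) := (clamp c K x - c) ^+ (2 * j).+2.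
have bg j : bmeas (g j : measurableTypeR R -> R).
  apply: (@bmeas_clamp _ (fun y => (y - c) ^+ (2 * j).+2) c K) => // x.
  apply: (@continuous_comp R R R (fun y => y - c) (fun y => y ^+ (2 * j).+2)).
    by apply: continuousB; [exact: cvg_id|exact: cvg_cst].
  exact: exprn_continuous.
have gE j : \int[mu t i]_x g j x = F j t.
  apply: (supported_eq sup_t).
  - by have [] := bg j.
  - by apply: continuous_measurable_fun; exact: smooth_continuous (spsi j).
  - by move=> x xK; rewrite /g /psi clamp_id// bump_eq1// mul1r.
have r20 : 0 < 2 * r by rewrite mulr_gt0.
(* At radius 2 r the quotient of r^N by (2 r)^N is 4^(-(j + 1)), so the mass outside is bounded by a
   null sequence. *)
have key j : (mu t i [set x | (2 * r < `|x - c|)%R] <= (2 * p i * (4^-1) ^+ j.+1)%:E)%E.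
  have pos : 0 < (2 * r) ^+ (2 * j).+2 by rewrite exprn_gt0.
  apply: le_trans (Rintegral_markov (mass i t0) (bg j) _ pos (measurable_off c (2 * r)) _) _.
  - by move=> x; rewrite /g even_expr_normS exprn_ge0.
  - move=> x /= /ltW xr; rewrite /g (even_expr_normS (clamp c K x - c)).
    apply: lerXn2r; rewrite ?nnegrE ?(ltW r20)//.
    exact: clamp_far.
  rewrite lee_fin gE ler_pdivrMl// (le_trans (Ft j))//.
  rewrite exprMn [leRHS]mulrCA ler_wpM2l ?mulr_ge0 ?(ltW (p_gt0 i))//.
  rewrite mulrAC -[leLHS]mul1r ler_wpM2r ?exprn_ge0 ?(ltW r0)//.
  have -> : (2 * j).+2 = (2 * j.+1)%N by rewrite mulnS.
  rewrite exprM -exprMn (_ : 2 ^+ 2 * 4^-1 = 1) ?expr1n//.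
  by rewrite -natrX divff.
have fm : mu t i [set x | (2 * r < `|x - c|)%R] \is a fin_num.
  rewrite ge0_fin_numE//; apply: le_lt_trans (key 0%N) _; exact: ltry.
rewrite /supported -(fineK fm); congr EFin; apply/eqP.
rewrite eq_le fine_ge0// andbT.
apply/ler_addgt0Pl => e e0; rewrite addr0.
(* With this j, 2 p_i / e < j + 1 <= 4^(j + 1). *)
pose j := Num.truncn (2 * p i / e).
have := key j; rewrite -(fineK fm) lee_fin => /le_trans; apply.
rewrite exprVn ler_pdivrMr ?exprn_gt0// [leRHS]mulrC -ler_pdivrMr//.
rewrite ltW// (lt_le_trans (truncnS_gt _))// -natrX ler_nat.
by rewrite ltnW// ltn_expl.
Qed.

End high_moments.

(** * From bounded supports to shrinking supports *)

Section localization.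
Context {R : realType} {n : nat}.
Variables (m p : 'I_n.+1 -> R) (E : R) (W : R -> 'M[R]_n.+1) (kappa : 'M[R]_n.+1).
Hypothesis m_gt0 : forall i, 0 < m i.
Hypothesis p_gt0 : forall i, 0 < p i.
Hypothesis W_adm : admissible W kappa.
Hypothesis lambda0_gt0 : 0 < lambda0 m p kappa.
Notation lam := (lambda0 m p kappa).
Notation c := (x_oo m p E).

Let lam_le i : lam <= m i * \sum_j kappa i j * p j.
Proof. exact: lambda0_le_sum (adm_kappa_sym W_adm) _. Qed.

Let summ_ge i : m i <= \sum_k m k.
Proof. by rewrite (bigD1 i)//= lerDl sumr_ge0// => k _; exact: ltW. Qed.

Let summ_gt0 : 0 < \sum_k m k.
Proof. exact: lt_le_trans (summ_ge ord0). Qed.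

Let sump_ge0 : 0 <= \sum_k p k.
Proof. by apply: sumr_ge0 => k _; exact: ltW. Qed.

Lemma sqr_shift_le (nu : 'I_n.+1 -> borelR R) j : in_P m p E nu ->
  \int[nu j]_x ((x - c) ^+ 2) <= 2 * \int[nu j]_x (x ^+ 2) + 2 * c ^+ 2 * p j.
Proof.
move=> [mass mom2 _].
have i0 := sqr_integrable mass mom2 j 0.
have {}i0 : (nu j).-integrable setT (EFin \o (fun x : measurableTypeR R => x ^+ 2)).
  by move: i0; apply: eq_integrable => // x _ /=; rewrite subr0.
have nf : (nu j setT < +oo)%E by rewrite mass ltry.
have ic := bmeas_integrable nf (bmeas_cst (d := _) (T := measurableTypeR R) (2 * c ^+ 2)).
rewrite -(Rintegral_cst_mass (mass j)) -RintegralZl// -RintegralD//; last first.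
  by have := integrableZl measurableT 2 i0; apply: eq_integrable.
apply: le_Rintegral => //.
- exact: (sqr_integrable mass mom2).
- have := integrableD measurableT (integrableZl measurableT 2 i0) ic.
  by apply: eq_integrable.
- by move=> x _; have := sqr_ge0 (x + c); lra.
Qed.

Variable mu : R -> 'I_n.+1 -> borelR R.
Hypothesis muP : forall t : R, 0 <= t -> in_P m p E (mu t).
Hypothesis weak : weak_solution m W mu.
Hypothesis wc : weakly_continuous p mu.
Hypothesis m2loc : forall T : R, exists B, forall (t : R) j, 0 <= t -> t <= T ->
  \int[mu t j]_x (x ^+ 2) <= B.

Let mass (t : R) j : 0 <= t -> mu t j setT = (p j)%:E.
Proof. by move=> /muP[]. Qed.

Let mom2 (t : R) j : 0 <= t -> (\int[mu t j]_x (x ^+ 2)%:E < +oo)%E.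
Proof. by move=> /muP[]. Qed.

(** This bound comes before any control of the supports: the forces grow at most quadratically, so
    bounded second moments suffice. *)
Lemma drift_locally_bounded (T : R) : exists2 D, 0 <= D & forall (t : R) i,
  0 <= t -> t <= T -> m i * `|drift W (mu t) i c| <= D.
Proof.
have [B hB] := m2loc T.
have [C C0 hC] := force_growth W_adm.
pose S := \sum_(j < n.+1) (C * p j + C * (2 * `|B| + 2 * c ^+ 2 * p j)).
have S0 : 0 <= S.
  apply: sumr_ge0 => j _; have pj := ltW (p_gt0 j).
  apply: addr_ge0; first exact: mulr_ge0.
  apply: mulr_ge0 => //; apply: addr_ge0; first by rewrite mulr_ge0.
  by apply: mulr_ge0 => //; apply: mulr_ge0 => //; exact: sqr_ge0.
exists ((\sum_k m k) * S) => [|t i t0 tT]; first by rewrite mulr_ge0// ltW.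
apply: ler_pM => //; first exact: ltW.
have fC j z : `|force W i j z| <= C + C * z ^+ 2.
  by rewrite (le_trans (hC i j z))// mulrDr mulr1.
rewrite (le_trans (drift_bound W_adm (fun j => mass j t0) (fun j => mom2 j t0) c fC))//.
apply: ler_sum => j _; rewrite lerD2l ler_wpM2l//.
rewrite (le_trans (sqr_shift_le j (muP t0)))// lerD2r ler_wpM2l//.
exact: le_trans (hB t j t0 tT) (ler_norm _).
Qed.

Hypothesis sup0 : forall i, exists2 K, 0 <= K & supported (mu 0 i) c K.

(** Beyond distance D / lam from c the velocity points inwards, and adding [K0] covers the initial
    supports. *)
Lemma locally_supported (T : R) : exists2 K, 0 <= K & forall (t : R) i,
  0 <= t -> t < T -> supported (mu t i) c K.
Proof.
have [K0 K00 hK0] : exists2 K, 0 <= K & forall i, supported (mu 0 i) c K.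
  apply: (@fin_uniform R n.+1 (fun i K => supported (mu 0 i) c K)) => // i C D.
  exact: supported_le.
have [D D0 hD] := drift_locally_bounded T.
pose K := K0 + D / lam.
have KD : 0 <= D / lam by rewrite divr_ge0// ltW.
have KK : 0 <= K by rewrite addr_ge0.
exists (K + 1) => [|t i t0 tT]; first by rewrite addr_ge0.
apply: (supported_propagation m_gt0 p_gt0 W_adm lambda0_gt0 lam_le muP weak wc (D := D) KK _ _ _ t0 tT).
- by rewrite /K mulrDr [lam * (D / _)]mulrC divfK ?gt_eqF// lerDr mulr_ge0// ltW.
- by move=> s s0 sT; apply: hD => //; exact: ltW.
- by apply: supported_le (hK0 i); rewrite lerDl.
Qed.

Let Phi_mu := Phi m mu c.

(** The support radius depends on the horizon t + 1, but it does not appear in the decay estimate,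
    which is therefore global in time. *)
Lemma Phi_decay (t : R) : 0 <= t -> Phi_mu t <= expR (- (2 * lam * t)) * Phi_mu 0.
Proof.
move=> t0.
have [K K0 sup] := locally_supported (t + 1).
have tt : t < t + 1 by rewrite ltrDl.
have := second_moment_decay m_gt0 p_gt0 W_adm muP weak wc K0 (fun s j => @sup s j) (erefl c) (lexx 0) t0 tt.
by rewrite mulr0 expR0 mul1r expRN -ler_pdivlMl ?expR_gt0.
Qed.

(** A force vanishes at 0, so it is bounded by a small constant plus a multiple of z^2. At c, the
    constant contributes at most D / 2 after integration, and the quadratic part is controlled by
    [Phi], which decays exponentially. The sum of the m_k is the common bound for the weights. *)
Lemma drift_vanishes D : 0 < D -> exists2 T : R, 0 <= T & forall (t : R) i,
  T <= t -> m i * `|drift W (mu t) i c| <= D.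
Proof.
move=> D0.
pose M := \sum_k m k; pose P := \sum_k p k.
have MP : 0 < M * P + 1 by rewrite ltr_wpDl// mulr_ge0// ltW.
have e0 : 0 < D / 2 / (M * P + 1) by rewrite !divr_gt0.
have [B B0 hB] := force_small W_adm e0.
have Phi0 t : 0 <= Phi_mu t.
  apply: sumr_ge0 => j _; rewrite mulr_ge0 ?invr_ge0 ?(ltW (m_gt0 j))//.
  by apply: Rintegral_ge0 => x _; exact: sqr_ge0.
have C0 : 0 <= M * (B * M) * Phi_mu 0 by rewrite !mulr_ge0// ltW.
have l2 : 0 < 2 * lam by rewrite mulr_gt0.
have D2 : 0 < D / 2 by rewrite divr_gt0.
have [T T0 hT] := expR_small C0 l2 D2.
exists T => // t i Tt; have t0 := le_trans T0 Tt.
have h1 := drift_bound W_adm (fun j => mass j t0) (fun j => mom2 j t0) c (hB i).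
have h2 : \sum_j \int[mu t j]_y (y - c) ^+ 2 <= M * Phi_mu t.
  rewrite /Phi_mu /Phi mulr_sumr; apply: ler_sum => j _.
  rewrite mulrA ler_peMl//; first by apply: Rintegral_ge0 => x _; exact: sqr_ge0.
  by rewrite ler_pdivlMr// mul1r summ_ge.
move: h1; rewrite big_split/= -!mulr_sumr -/P => h1.
apply: (@le_trans _ _ (M * (D / 2 / (M * P + 1) * P + B * (M * Phi_mu t)))).
  apply: ler_pM => //; first exact: ltW.
  by rewrite (le_trans h1)// lerD2l ler_wpM2l.
have h3 : M * (D / 2 / (M * P + 1) * P) <= D / 2.
  rewrite [leLHS](_ : _ = D / 2 * (M * P / (M * P + 1))); last by ring.
  by rewrite ler_piMr ?(ltW D2)// ler_pdivrMr// mul1r lerDl.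
have h4 : M * (B * (M * Phi_mu t)) <= D / 2.
  rewrite (mulrA B) mulrA; apply: le_trans (hT t Tt).
  rewrite -[leRHS]mulrA ler_wpM2l ?mulr_ge0 ?(ltW summ_gt0)//.
  by rewrite [leRHS]mulrC; exact: Phi_decay.
by rewrite mulrDr; lra.
Qed.

(** The choice of [D] gives 2 D = lam r. The radius [L] is taken at time T, independently of t, so
    the time [T'] needed to contract it to [r] is fixed; only the auxiliary radius [K] depends on t,
    and [supported_shrink] does not lose anything through it. It is enlarged by 2 r to contain the
    target interval. *)
Lemma eventually_supported (eps : R) : 0 < eps -> exists2 T : R, 0 <= T &
  forall (t : R) i, T <= t -> supported (mu t i) c eps.
Proof.
move=> eps0; pose r := eps / 2.
have r0 : 0 < r by rewrite divr_gt0.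
pose D := lam * r / 2.
have D0 : 0 < D by rewrite divr_gt0// mulr_gt0.
have [T T0 hT] := drift_vanishes D0.
have [L L0 hL] := locally_supported (T + 1).
have l2 : 0 < lam / 2 by rewrite divr_gt0.
have [T' T'0 hT'] := expR_small L0 l2 r0.
exists (T + T') => [|t i Tt]; first by rewrite addr_ge0.
have Tlt : T <= t by rewrite (le_trans _ Tt)// lerDl.
have [K K0 hK] := locally_supported (t + 1).
have -> : eps = 2 * r by rewrite /r; field.
have K'0 : 0 <= K + 2 * r by rewrite addr_ge0// mulr_ge0// ltW.
have tt : t < t + 1 by rewrite ltrDl.
apply: (@supported_shrink R n.+1 m p E W kappa m_gt0 p_gt0 W_adm lam lambda0_gt0
  lam_le mu muP weak wc c (K + 2 * r) D r T (t + 1) i K'0 r0 _ T0 _ _ L t Tlt tt L0).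
- by rewrite /D mulrC divfK.
- move=> s Ts st; apply: supported_le (hK s i (le_trans T0 Ts) st).
  by rewrite lerDl mulr_ge0// ltW.
- by move=> s Ts _; exact: hT.
- by apply: hL => //; rewrite ltrDl.
- by apply: hT'; rewrite lerBrDl.
- by rewrite lerDr.
Qed.

End localization.

(** * Supports of steady states *)

Section steady.
Context {R : realType} {n : nat}.
Variables (m p : 'I_n -> R) (E : R) (W : R -> 'M[R]_n) (kappa : 'M[R]_n).
Hypothesis m_gt0 : forall i, 0 < m i.
Hypothesis p_gt0 : forall i, 0 < p i.
Hypothesis W_adm : admissible W kappa.
Variable lam : R.
Hypothesis lam_gt0 : 0 < lam.
Hypothesis lam_le : forall i, lam <= m i * \sum_j kappa i j * p j.
Variable nu : 'I_n -> borelR R.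
Hypothesis nuP : in_P m p E nu.
Hypothesis weak : weak_solution m W (fun=> nu).

Lemma weakly_continuous_cst : weakly_continuous p (fun=> nu).
Proof.
move=> s rho _ rho0; exists 1 => // t j h e C _ _ _ e0 C0 _.
by rewrite subrr normr0 addr_ge0 ?mulr_ge0// ltW.
Qed.

(** For a constant curve, the Gronwall lemma with rate 1 and level g plus the integral of [psi]
    reads - e g <= - g with e = exp(1), which excludes g < 0. *)
Lemma steady_flux_ge0 i (psi : R -> R) c K : smooth psi -> 0 <= K ->
  (forall x, K <= `|x - c| -> psi x = 0) ->
  0 <= - m i * \int[nu i]_x (derive1 psi x * drift W nu i x).
Proof.
move=> spsi K0 psi0; rewrite leNgt; apply/negP.
set g := - m i * _ => g0.
have GF (t : R) : 0 < t -> t < 2 -> g <= 1 * ((g + \int[nu i]_x psi x) - \int[nu i]_x psi x).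
  by rewrite mul1r addrK.
have := curve_gronwall p_gt0 W_adm (fun _ _ => nuP) weak weakly_continuous_cst spsi K0 psi0 (lexx 0) GF.
have ltr12' : 1 < 2 :> R by rewrite ltr1n.
move=> /(_ 0 1 (lexx 0) ler01 ltr12').
rewrite mulr0 expR0 !mul1r opprD addrCA subrr addr0.
rewrite -subr_ge0 -{1}[- g]mul1r -mulrBl pmulr_lge0 ?oppr_gt0// subr_ge0.
by rewrite leNgt expR_gt1 ltr01.
Qed.

(* In the annulus the drift does not vanish, but the flux through it, which has a
   sign, integrates to zero. *)
Lemma steady_annulus i c D K : m i * `|drift W nu i c| <= D -> 0 <= K -> D <= lam * K ->
  (nu i).-negligible [set x | K < `|x - c| < K + 1].
Proof.
move=> hD K0 DK.
have [mass mom2 _] := nuP.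
have K1 : 0 <= K + 1 by rewrite addr_ge0.
have psi0 x : K + 1 <= `|x - c| -> -1 * bump c K x = 0.
  by move=> xK; rewrite bump_eq0// mulr0.
have h := steady_flux_ge0 i (@smooth_Nbump R c K) K1 psi0.
have nf : (nu i setT < +oo)%E by rewrite mass ltry.
pose f (x : R) := derive1 (fun x => -1 * bump c K x) x * drift W nu i x.
have f0 x : 0 <= f x.
  rewrite /f derive1_Nbump mulNr oppr_ge0.
  exact: (bump_derive_drift_le0 m_gt0 W_adm lam_gt0 lam_le x mass mom2 hD K0 DK).
have bf : bmeas (f : measurableTypeR R -> R).
  exact: (bmeas_derive_drift W_adm (mu := fun=> nu) (fun _ _ => nuP) i (lexx 0) (@smooth_Nbump R c K) psi0).
have If : (\int[nu i]_x `|(f x)%:E| = 0)%E.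
  under eq_integral do rewrite gee0_abs ?lee_fin//.
  rewrite Rintegral_EFin; last exact: bmeas_integrable.
  congr EFin; apply/eqP; rewrite eq_le Rintegral_ge0 ?andbT//.
  by move: h; rewrite mulNr oppr_ge0 pmulr_rle0.
have mf : measurable_fun setT (EFin \o (f : measurableTypeR R -> R)).
  by apply/measurable_EFinP; have [] := bf.
have [N [mN N0 fN]] := (ae_eq_integral_abs (nu i) measurableT mf).1 If.
exists N; split => //.
move=> x /= xA; apply: fN => /=; apply/not_implyP; split => //.
move=> [] /eqP; rewrite /f derive1_Nbump mulNr oppr_eq0 => /eqP hz.
have [K_lt _] := andP xA.
have u0 : 0 < `|x - c| := le_lt_trans K0 K_lt.
have hin := drift_inward m_gt0 W_adm lam_le x mass mom2 hD.
have pos : 0 < m i * drift W nu i x * (x - c).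
  apply: lt_le_trans hin; rewrite expr2 mulrA -mulrBl mulr_gt0// subr_gt0.
  by rewrite (le_lt_trans DK)// ltr_pM2l.
have neg := bump_derive_neg K0 xA.
have h0 : 0 = ((x - c) * derive1 (bump c K) x) * (m i * drift W nu i x * (x - c)).
  transitivity ((derive1 (bump c K) x * drift W nu i x) * (m i * (x - c) * (x - c))); last by ring.
  by rewrite hz mul0r.
have : ((x - c) * derive1 (bump c K) x) * (m i * drift W nu i x * (x - c)) < 0.
  by rewrite pmulr_llt0.
by rewrite -h0 ltxx.
Qed.

Lemma steady_supported i c : exists2 K, 0 <= K & supported (nu i) c K.
Proof.
pose D := m i * `|drift W nu i c|.
have D0 : 0 <= D by rewrite mulr_ge0// ltW.
pose K := D / lam.
have K0 : 0 <= K by rewrite divr_ge0// ltW.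
exists K => //.
(* Open annuli of width 1 shifted by 1/2 overlap, so they also cover each other's boundary
   circles. *)
have ann k : (nu i).-negligible [set x | K + k%:R / 2 < `|x - c| < K + k%:R / 2 + 1].
  apply: (steady_annulus (D := D)) => //; first by rewrite addr_ge0// divr_ge0.
  by rewrite mulrDr /K [lam * (D / _)]mulrC divfK ?gt_eqF// lerDl mulr_ge0 ?(ltW lam_gt0)// divr_ge0.
apply/negligibleP; first exact: measurable_off.
apply: negligibleS (negligible_bigcup ann) => x /= xK.
pose v := `|x - c| - K.
have v0 : 0 < v by rewrite subr_gt0.
have v2 : 0 <= 2 * v by rewrite mulr_ge0// ltW.
(* If 2 v >= 1, this k satisfies k + 1 <= 2 v < k + 2, hence k / 2 < v < k / 2 + 1; if 2 v < 1, the
   predecessor of 0 is 0 and the first annulus works. *)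
exists (Num.truncn (2 * v)).-1 => //=.
have := truncn_itv v2; rewrite /v; case: (Num.truncn _) => [|k] /= /andP[h1 h2].
  by rewrite mul0r addr0; apply/andP; split => //; lra.
by move: h1 h2; rewrite -[k.+2%:R]natr1 -[k.+1%:R]natr1 => h1 h2; apply/andP; split; lra.
Qed.

End steady.

(** * Curves in the Wasserstein space *)

Section transport.
Context d1 d2 {T1 : measurableType d1} {T2 : measurableType d2} {R : realType}.
Variables (g : {measure set T1 -> \bar R}) (a : {measure set T2 -> \bar R}).
Variable phi : T1 -> T2.
Hypothesis mphi : measurable_fun setT phi.
Hypothesis ga : forall A, measurable A -> g (phi @^-1` A) = a A.

Lemma ge0_integral_transport (f : T2 -> \bar R) :
  measurable_fun setT f -> (forall x, 0 <= f x)%E ->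
  (\int[a]_x f x = \int[g]_x f (phi x))%E.
Proof.
move=> mf f0.
have := @ge0_integral_pushforward _ _ _ _ R phi mphi g setT f measurableT mf
  (fun y _ => f0 y).
rewrite preimage_setT => <-.
by apply: eq_measure_integral => A mA _ /=; rewrite /pushforward ga.
Qed.

Variable f : T2 -> R.
Hypothesis intf : a.-integrable setT (EFin \o f).

Let mf : measurable_fun setT (EFin \o f).
Proof. by case/integrableP: intf. Qed.

Lemma integrable_transport : g.-integrable setT (EFin \o (f \o phi)).
Proof.
apply/integrableP; split; first exact: (measurableT_comp mf mphi).
have mabs : measurable_fun setT (abse \o (EFin \o f)) by exact: measurableT_comp.
have := ge0_integral_transport mabs (fun x => abse_ge0 _) => /= <-.
by case/integrableP: intf.
Qed.

Lemma Rintegral_transport : \int[a]_x f x = \int[g]_x f (phi x).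
Proof.
rewrite /Rintegral; congr fine.
have := @integral_pushforward _ _ _ _ R phi mphi g setT (EFin \o f) mf.
rewrite preimage_setT => /(_ integrable_transport measurableT) /= <-.
by apply: eq_measure_integral => A mA _ /=; rewrite /pushforward ga.
Qed.

End transport.

Section coupling.
Context {R : realType}.
Variables (al be : borelR R) (p : R) (g : borelRR R).
Hypothesis cg : couplings al be g.
Hypothesis mass : al setT = p%:E.

Let g1 A : measurable A -> g (fst @^-1` A) = al A.
Proof.
by have [_ h _] := cg => mA; rewrite -h//; congr (g _); apply/seteqP; split => z //= [].
Qed.

Let g2 A : measurable A -> g (snd @^-1` A) = be A.
Proof.
by have [_ _ h] := cg => mA; rewrite -h//; congr (g _); apply/seteqP; split => z //= [].
Qed.

Let g_mass : g setT = p%:E.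
Proof. by rewrite -mass -g1. Qed.

Let mdist : measurable_fun setT
  (fun z : measurableTypeR R * measurableTypeR R => `|z.1 - z.2| ^+ 2).
Proof.
apply: measurable_funX; apply: measurableT_comp => //.
by apply: measurable_funB; [exact: measurable_fst|exact: measurable_snd].
Qed.

Let msqr : measurable_fun setT (fun x : measurableTypeR R => x ^+ 2).
Proof. by apply: continuous_measurable_fun; exact: exprn_continuous. Qed.

Variable k : R.
Hypothesis cost : (\int[g]_z (`|z.1 - z.2| ^+ 2)%:E <= k%:E)%E.

Lemma coupling_second_moment :
  (\int[be]_x (x ^+ 2)%:E <= 2%:E * (\int[al]_x (x ^+ 2)%:E) + (2 * k)%:E)%E.
Proof.
have ms : measurable_fun setT (fun x : measurableTypeR R => (x ^+ 2)%:E).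
  exact/measurable_EFinP.
have s0 (x : measurableTypeR R) : (0 <= (x ^+ 2)%:E :> \bar R)%E by rewrite lee_fin sqr_ge0.
rewrite (ge0_integral_transport measurable_snd g2 ms s0).
rewrite (ge0_integral_transport measurable_fst g1 ms s0).
have m1 : measurable_fun setT (fun z : measurableTypeR R * measurableTypeR R => (z.1 ^+ 2)%:E : \bar R).
  exact: (measurableT_comp ms).
have m2 : measurable_fun setT (fun z : measurableTypeR R * measurableTypeR R => (`|z.1 - z.2| ^+ 2)%:E : \bar R).
  exact/measurable_EFinP.
apply: (@le_trans _ _ (\int[g]_z (2%:E * (z.1 ^+ 2)%:E + 2%:E * (`|z.1 - z.2| ^+ 2)%:E))%E).
  apply: integral_mono => z _.
  rewrite -!EFinM -EFinD lee_fin real_normK ?num_real//.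
  by have := sqr_ge0 (2 * z.1 - z.2); lra.
rewrite ge0_integralD//; try exact: measurable_funeM;
  try by move=> z _; apply: mule_ge0; rewrite lee_fin ?sqr_ge0.
rewrite !ge0_integralZl_EFin//; try by move=> z _; rewrite lee_fin sqr_ge0.
by rewrite leeD2l// EFinM; apply: lee_wpmul2l.
Qed.

(** The quadratic shape of the modulus is matched to the transport cost: integrated against a
    coupling, (x - y)^2 becomes the cost bounded by [k]. *)
Lemma coupling_modulus (h : R -> R) (e C : R) :
  (\int[al]_x (x ^+ 2)%:E < +oo)%E -> (\int[be]_x (x ^+ 2)%:E < +oo)%E ->
  be setT = p%:E -> continuous h -> 0 <= e -> 0 <= C ->
  (forall x y, `|h x - h y| <= e + C * (x - y) ^+ 2) ->
  `|\int[al]_x h x - \int[be]_x h x| <= e * p + C * k.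
Proof.
move=> al2 be2 bmass ch e0 C0 hC.
have hq x : `|h x| <= (`|h 0| + e + C) * (1 + x ^+ 2).
  have h1 : `|h x| <= `|h 0| + (e + C * x ^+ 2).
    have := hC x 0; rewrite subr0 => hx.
    by have := ler_normD (h x - h 0) (h 0); rewrite subrK; lra.
  apply: (le_trans h1); have := sqr_ge0 x; have := normr_ge0 (h 0); nra.
have ia := quadratic_integrable mass al2 ch hq.
have ib := quadratic_integrable bmass be2 ch hq.
have iga := integrable_transport measurable_fst g1 ia.
have igb := integrable_transport measurable_snd g2 ib.
rewrite (Rintegral_transport measurable_fst g1 ia) (Rintegral_transport measurable_snd g2 ib).
rewrite -RintegralB//.
have idiff : g.-integrable setT (EFin \o (fun z => h z.1 - h z.2)).
  by have := integrableB measurableT iga igb; apply: eq_integrable.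
rewrite (le_trans (le_normr_Rintegral measurableT idiff))//.
have id2 : g.-integrable setT (EFin \o (fun z : measurableTypeR R * measurableTypeR R => `|z.1 - z.2| ^+ 2)).
  apply/integrableP; split; first exact/measurable_EFinP.
  under eq_integral do rewrite /= ger0_norm ?exprn_ge0//.
  exact: le_lt_trans cost (ltry _).
have gfin : (g setT < +oo)%E by rewrite g_mass ltry.
have ie := bmeas_integrable gfin (bmeas_cst (d := _) (T := (measurableTypeR R * measurableTypeR R)%type) e).
have iC := integrableZl measurableT C id2.
apply: (@le_trans _ _ (\int[g]_z (e + C * `|z.1 - z.2| ^+ 2))).
  apply: le_Rintegral => //.
  - exact: integrable_norm idiff.
  - by have := integrableD measurableT ie iC; apply: eq_integrable.
  - by move=> z _; rewrite real_normK ?num_real.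
rewrite RintegralD// RintegralZl// Rintegral_cst// g_mass/= lerD2l ler_wpM2l//.
by rewrite -lee_fin -Rintegral_EFin.
Qed.

End coupling.

Section absolutely_continuous.
Context {R : realType} {n : nat}.
Variables (m p : 'I_n -> R) (E : R) (mu : R -> 'I_n -> borelR R).
Hypothesis m_gt0 : forall i, 0 < m i.
Hypothesis muP : forall t : R, 0 <= t -> in_P m p E (mu t).

(** The strict inequality a < d provides a nearly optimal coupling, so no optimal one has to be
    constructed. The weight 1 / m_j in the distance becomes the factor [m j]. *)
Lemma wasserstein_coupling (al be : 'I_n -> borelR R) (a d : R) : 0 <= a -> a < d ->
  (wassersteinP m al be <= a%:E)%E -> forall j,
  exists2 g, couplings (al j) (be j) g & (\int[g]_z (`|z.1 - z.2| ^+ 2)%:E <= (m j * d ^+ 2)%:E)%E.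
Proof.
move=> a0 ad Wa j.
pose I k := ereal_inf [set (\int[g]_z (`|z.1 - z.2| ^+ 2)%:E)%E | g in couplings (al k) (be k)].
have I0 k : (0 <= I k)%E.
  apply: le_ereal_inf_tmp => _ [g _ <-]; apply: integral_ge0 => z _.
  by rewrite lee_fin exprn_ge0.
have Ilt : (I j < (m j * d ^+ 2)%:E)%E.
  rewrite ltNge; apply/negP => h.
  have d0 : 0 <= d := ltW (le_lt_trans a0 ad).
  have S1 : ((d ^+ 2)%:E <= \sum_(k < n) ((m k)^-1)%:E * I k)%E.
    rewrite (bigD1 j)//=; apply: (@le_trans _ _ (((m j)^-1)%:E * I j)%E).
      apply: (@le_trans _ _ (((m j)^-1)%:E * (m j * d ^+ 2)%:E)%E).
        by rewrite -EFinM mulKf ?gt_eqF.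
      by apply: lee_wpmul2l => //; rewrite lee_fin invr_ge0 ltW.
    rewrite leeDl//; apply: sume_ge0 => k _.
    by rewrite mule_ge0// lee_fin invr_ge0 ltW.
  have S0 : (0 <= \sum_(k < n) ((m k)^-1)%:E * I k)%E.
    by apply: le_trans S1; rewrite lee_fin exprn_ge0.
  have h2 : 0 <= 2^-1 :> R by rewrite invr_ge0.
  have := @gt0_ler_poweR R _ h2 (d ^+ 2)%:E (\sum_(k < n) ((m k)^-1)%:E * I k)%E.
  rewrite !in_itv/= !leey !andbT S0 lee_fin exprn_ge0// => /(_ isT isT S1).
  rewrite powR12_sqrt ?exprn_ge0// sqrtr_sqr ger0_norm// => h3.
  by have := le_trans h3 Wa; rewrite lee_fin leNgt ad.
have [_ [g cg <-] /ltW hg] := ereal_inf_lt Ilt.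
by exists g.
Qed.

(** Young's inequality phi <= 1 / (4 e) + e phi^2. A small [e] makes the second term small on the
    whole horizon, after which a short interval makes the first one small. *)
Lemma AC2_bound (T : R) (phi : R -> R) (s t e : R) :
  measurable_fun `[0, T] phi ->
  (\int[lebesgue_measure]_(r in `[0%R, T]) (phi r ^+ 2)%:E < +oo)%E ->
  0 < e -> 0 <= s -> s <= t -> t <= T ->
  (\int[lebesgue_measure]_(r in `[s, t]) (phi r)%:E <=
   ((t - s) / (4 * e) + e * fine (\int[lebesgue_measure]_(r in `[0%R, T]) (phi r ^+ 2)%:E))%:E)%E.
Proof.
move=> mphi fin e0 s0 st tT.
have sub : `[s, t]%classic `<=` `[0, T]%classic.
  move=> x /=; rewrite !in_itv/= => /andP[sx xt].
  by rewrite (le_trans s0 sx) (le_trans xt tT).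
have mst : measurable_fun `[s, t] phi by apply: measurable_funS mphi.
have m2 : measurable_fun `[0, T] (fun r => (phi r ^+ 2)%:E).
  by apply/measurable_EFinP; exact: measurable_funX.
have m2st : measurable_fun `[s, t] (fun r => (phi r ^+ 2)%:E).
  by apply/measurable_EFinP; exact: measurable_funX.
have p0 : (0 <= \int[lebesgue_measure]_(r in `[0%R, T]) (phi r ^+ 2)%:E)%E.
  by apply: integral_ge0 => x _; rewrite lee_fin sqr_ge0.
apply: (@le_trans _ _ (\int[lebesgue_measure]_(r in `[s, t])
    ((4 * e)^-1%:E + e%:E * (phi r ^+ 2)%:E))%E).
  apply: integral_mono => r _; rewrite -EFinM -EFinD lee_fin.
  have e4 : 0 < 4 * e by rewrite mulr_gt0.
  rewrite -(ler_pM2l e4) mulrDr divff ?gt_eqF//.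
  by have := sqr_ge0 (2 * e * phi r - 1); lra.
rewrite ge0_integralD//; last 3 first.
- by move=> x _; rewrite lee_fin invr_ge0 mulr_ge0// ltW.
- by move=> x _; rewrite mule_ge0// lee_fin ?sqr_ge0// ltW.
- exact: measurable_funeM.
rewrite integral_cst// ge0_integralZl_EFin//; last 2 first.
- by move=> x _; rewrite lee_fin sqr_ge0.
- exact: ltW.
rewrite /= lebesgue_measure_itv/= EFinD; apply: leeD.
  case: ifPn => _; last by rewrite mule0 lee_fin divr_ge0 ?subr_ge0// mulr_ge0// ltW.
  by rewrite -EFinB -EFinM lee_fin mulrC.
rewrite EFinM fineK; last by rewrite ge0_fin_numE.
apply: lee_wpmul2l; first by rewrite lee_fin ltW.
by apply: ge0_subset_integral => // x _; rewrite lee_fin sqr_ge0.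
Qed.

Hypothesis AC : AC2loc (wassersteinP m) mu.

Lemma AC2_weakly_continuous : weakly_continuous p mu.
Proof.
move=> s rho s0 rho0.
pose M := 1 + \sum_k m k.
have M0 : 0 < M by rewrite ltr_wpDr// sumr_ge0// => k _; exact: ltW.
pose d := Num.sqrt (rho / M).
have d0 : 0 < d by rewrite sqrtr_gt0 divr_gt0.
have T0 : 0 < s + 1 by rewrite ltr_wpDl.
have [phi [mphi fin H]] := AC T0.
set A := fine (\int[lebesgue_measure]_(r in `[0%R, (s + 1)%R]) (phi r ^+ 2)%:E)%E.
have A0 : 0 <= A.
  by rewrite fine_ge0//; apply: integral_ge0 => x _; rewrite lee_fin sqr_ge0.
(* Each of the two terms of [AC2_bound] is then at most d / 4, so the distance is at most d / 2 < d.
   The resulting cost m_j d^2 is at most [rho] because d^2 = rho / M and m_j <= M. *)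
pose e := d / 4 / (A + 1).
have A1 : 0 < A + 1 by rewrite ltr_wpDl.
have e0 : 0 < e by rewrite !divr_gt0.
have e4 : 0 < 4 * e by rewrite mulr_gt0.
exists (Num.min 1 (d / 4 * (4 * e))); first by rewrite lt_min ltr01 mulr_gt0 ?divr_gt0.
move=> t j h e' C t0; rewrite le_min => /andP[ts1 ts] ch e'0 C0 hC.
have tT : t <= s + 1 by move: ts1; rewrite ler_norml => /andP[_]; lra.
have eA : e * A <= d / 4.
  rewrite /e -mulrA ler_piMr ?divr_ge0 ?(ltW d0)//.
  by rewrite mulrC ler_pdivrMr// mul1r lerDl.
have dist_small a b : 0 <= a -> a <= b -> b <= s + 1 -> `|b - a| <= d / 4 * (4 * e) ->
    (wassersteinP m (mu a) (mu b) <= (d / 2)%:E)%E.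
  move=> a0 ab bT ab_small.
  apply: (le_trans (H a b a0 ab bT)); apply: (le_trans (AC2_bound mphi fin e0 a0 ab bT)).
  rewrite lee_fin -/A; have : (b - a) / (4 * e) <= d / 4.
    by rewrite ler_pdivrMr// -[leLHS]ger0_norm ?subr_ge0.
  by move: eA; lra.
have d2 : d / 2 < d by rewrite ltr_pdivrMr// mulr_natr mulr2n ltrDl.
have d20 : 0 <= d / 2 by rewrite divr_ge0// ltW.
have md : m j * d ^+ 2 <= rho.
  have rM : 0 <= rho / M by rewrite divr_ge0// ltW.
  rewrite sqr_sqrtr// mulrCA ler_piMr ?(ltW rho0)// ler_pdivrMr// mul1r.
  rewrite /M (bigD1 j)//= addrCA lerDl addr_ge0// sumr_ge0// => k _; exact: ltW.
have final : e' * p j + C * (m j * d ^+ 2) <= e' * p j + C * rho by rewrite lerD2l ler_wpM2l.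
apply: le_trans final.
have [[ms2 mt2] [mss mtt]] : ((\int[mu s j]_x (x ^+ 2)%:E < +oo)%E /\ (\int[mu t j]_x (x ^+ 2)%:E < +oo)%E)
    /\ (mu s j setT = (p j)%:E /\ mu t j setT = (p j)%:E).
  by have [a1 a2 _] := muP s0; have [b1 b2 _] := muP t0; split; split.
have [st|/ltW st] := leP s t.
  have [g cg hg] := wasserstein_coupling d20 d2 (dist_small s t s0 st tT ts) j.
  rewrite distrC; exact: (coupling_modulus cg mss hg ms2 mt2 mtt ch e'0 C0 hC).
have sT : s <= s + 1 by rewrite lerDl.
rewrite distrC in ts.
have [g cg hg] := wasserstein_coupling d20 d2 (dist_small t s t0 st sT ts) j.
exact: (coupling_modulus cg mtt hg mt2 ms2 mss ch e'0 C0 hC).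
Qed.

Lemma AC2_second_moment (T : R) : exists B, forall (t : R) j, 0 <= t -> t <= T ->
  \int[mu t j]_x (x ^+ 2) <= B.
Proof.
(* [AC2loc] provides a density for positive horizons only. *)
pose T' := Num.max T 1.
have T'0 : 0 < T' by rewrite lt_max ltr01 orbT.
have [phi [mphi fin H]] := AC T'0.
set A := fine (\int[lebesgue_measure]_(r in `[0%R, T']) (phi r ^+ 2)%:E)%E.
have A0 : 0 <= A.
  by rewrite fine_ge0//; apply: integral_ge0 => x _; rewrite lee_fin sqr_ge0.
pose L := T' / 4 + A.
have L0 : 0 <= L by rewrite addr_ge0// divr_ge0// ltW.
have LL : L < L + 1 by rewrite ltrDl.
pose B j := 2 * \int[mu 0 j]_x (x ^+ 2) + 2 * (m j * (L + 1) ^+ 2).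
have B0 j : 0 <= B j.
  apply: addr_ge0; apply: mulr_ge0 => //.
    by apply: Rintegral_ge0 => x _; exact: sqr_ge0.
  by apply: mulr_ge0; [exact: ltW|exact: sqr_ge0].
exists (\sum_k B k); move=> t j t0 tT.
have tT' : t <= T' by rewrite le_max tT.
have W : (wassersteinP m (mu 0) (mu t) <= L%:E)%E.
  apply: (le_trans (H 0 t (lexx 0) t0 tT')).
  apply: (le_trans (AC2_bound mphi fin ltr01 (lexx 0) t0 tT')).
  by rewrite lee_fin -/A mul1r mulr1 subr0 lerD2r ler_wpM2r.
have [g cg hg] := wasserstein_coupling L0 LL W j.
have [_ a2 _] := muP (lexx 0); have [_ b2 _] := muP t0.
have := coupling_second_moment cg hg.
have fE (nu : borelR R) : (\int[nu]_x (x ^+ 2)%:E < +oo)%E ->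
    (\int[nu]_x (x ^+ 2)%:E)%E = (\int[nu]_x (x ^+ 2))%:E.
  move=> h; rewrite /Rintegral fineK// ge0_fin_numE//.
  by apply: integral_ge0 => x _; rewrite lee_fin sqr_ge0.
rewrite (fE _ (b2 j)) (fE _ (a2 j)) -EFinM -EFinD lee_fin => h.
apply: (le_trans h); rewrite (bigD1 j)//= -/(B j) lerDl.
by apply: sumr_ge0 => k _; exact: B0.
Qed.

End absolutely_continuous.

(** * The limit state *)

Section push.
Context d1 d2 {T1 : measurableType d1} {T2 : measurableType d2} {R : realType}.
Variables (g : {measure set T1 -> \bar R}) (phi : T1 -> T2).
Hypothesis mphi : measurable_fun setT phi.

Definition push : {measure set T2 -> \bar R}.
Proof. by refine (pushforward g phi : {measure set T2 -> \bar R}); exact: mphi. Defined.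

End push.

Lemma continuous_pair {T U V : topologicalType} (f : T -> U) (g : T -> V) :
  continuous f -> continuous g -> continuous (fun t => (f t, g t)).
Proof. by move=> cf cg t; apply: (cvg_pair (cf t) (cg t)). Qed.

Section limit_state.
Context {R : realType} {n : nat}.
Variables (m p : 'I_n.+1 -> R) (E : R) (W : R -> 'M[R]_n.+1) (kappa : 'M[R]_n.+1).
Hypothesis m_gt0 : forall i, 0 < m i.
Variable p_gt0 : forall i, 0 < p i.
Hypothesis W_adm : admissible W kappa.
Notation c := (x_oo m p E).
Notation mu_lim := (mu_oo m p_gt0 E).

Lemma mu_ooE i A : mu_lim i A = ((p i)%:E * (\1_A c)%:E)%E.
Proof. by []. Qed.

Lemma mu_oo_mass i : mu_lim i setT = (p i)%:E.
Proof. by rewrite mu_ooE indicT mule1. Qed.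

Lemma supported_mu_oo i : supported (mu_lim i) c 0.
Proof.
rewrite /supported mu_ooE indicE memNset ?mule0//=.
by rewrite subrr normr0 ltxx.
Qed.

Lemma mu_oo_integrable i (f : R -> R) : continuous f ->
  (mu_lim i).-integrable setT (EFin \o f).
Proof. exact: (supported_integrable (mu_oo_mass i) (lexx 0) (@supported_mu_oo i)). Qed.

Lemma Rintegral_mu_oo i (f : R -> R) : continuous f ->
  \int[mu_lim i]_x f x = f c * p i.
Proof.
move=> cf; rewrite -(Rintegral_cst_mass (mu_oo_mass i)).
apply: (supported_eq (@supported_mu_oo i)).
- exact: continuous_measurable_fun.
- exact: measurable_cst.
- by move=> x; rewrite normr_le0 subr_eq0 => /eqP ->.
Qed.

Lemma in_P_mu_oo : in_P m p E mu_lim.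
Proof.
split.
- exact: mu_oo_mass.
- move=> j; have := mu_oo_integrable j (@exprn_continuous R 2).
  by move=> /(integrable_fin_num measurableT); rewrite fin_numElt => /andP[].
- under eq_bigr => j _ do rewrite (Rintegral_mu_oo j (fun x => @cvg_id _ _)).
  under eq_bigr => j _ do rewrite mulrCA mulrC.
  rewrite -mulr_suml /x_oo.
  have -> : \sum_(i < n.+1) (m i)^-1 * p i = \sum_(j < n.+1) p j / m j.
    by apply: eq_bigr => i _; rewrite mulrC.
  rewrite mulrC mulfVK// gt_eqF//.
  by rewrite big_ord_recl ltr_wpDr ?divr_gt0// sumr_ge0// => j _; rewrite divr_ge0// ltW.
Qed.

Lemma test_function_section (phi : R * R -> R) x : test_function phi ->
  exists a b : R, [/\ 0 < a, a < b & forall t, ~ (a <= t <= b) -> phi (t, x) = 0].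
Proof.
move=> [_ cpt sub].
set S := closure _ in cpt sub.
have [S0|/set0P Sne] := eqVneq S set0.
  exists 1, 2; split => [//||t _]; first by rewrite ltr1n.
  apply/eqP; apply: contraT => h.
  have : S (t, x) by apply: subset_closure.
  by rewrite S0.
have cf : {within S, continuous (fst : R * R -> R)}.
  by apply: continuous_subspaceT => z; exact: cvg_fst.
have [z0 Sz0 hmin] := compact_EVT_min Sne cpt cf.
have [z1 Sz1 hmax] := compact_EVT_max Sne cpt cf.
have z00 : 0 < z0.1 by apply: sub; rewrite inE in Sz0.
exists z0.1, (z1.1 + 1); split => //.
  by rewrite (le_lt_trans (hmax _ Sz0))// ltrDl.
move=> t nt; apply/eqP; apply: contraT => h; exfalso; apply: nt.
have St : (t, x) \in S by rewrite inE; apply: subset_closure.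
rewrite (hmin _ St)/=; have := hmax _ St => /= h1.
by rewrite (le_trans h1)// lerDl.
Qed.

Lemma test_function_time_integral (phi : R * R -> R) x (q : R) : test_function phi ->
  (\int[lebesgue_measure]_(t in `]0%R, +oo[) ('D_(1, 0) phi (t, x) * q)%:E = 0)%E.
Proof.
move=> tphi; have [a [b [a0 ab off]]] := test_function_section x tphi.
have [smooth_phi _ _] := tphi.
have [cphi dphi cD] := smooth_phi 1%N.
pose g t := phi (t, x) * q.
have dg (t : R) : is_derive t 1 g ('D_(1, 0) phi (t, x) * q).
  have d0 : is_derive t 1 (fun t => phi (t, x)) ('D_(1, 0) phi (t, x)).
    have eqq : (fun h : R => h^-1 *: (phi (h *: (1, 0) + (t, x)) - phi (t, x))) =
      (fun h : R => h^-1 *: (((fun t => phi (t, x)) \o shift t) (h *: 1) - phi (t, x))).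
      have pE (h : R) : h *: ((1, 0) : R * R) + (t, x) = (h *: 1 + t, x).
        apply: (etrans (_ : _ = (h * 1 + t, h * 0 + x))); first by [].
        by rewrite mulr0 add0r.
      by apply/funext => h; rewrite pE.
    have dv := dphi (1, 0) (t, x).
    split; first by move: dv; rewrite /derivable eqq.
    by rewrite /derive eqq.
  have h := @is_deriveZ _ _ R _ q t 1 _ d0.
  have -> : g = q \*: (fun t => phi (t, x)) by apply/funext => s; rewrite /g mulrC.
  by apply: (is_derive_eq h); rewrite /GRing.scale/= mulrC.
have a20 : 0 < a / 2 by rewrite divr_gt0.
have a2a : a / 2 < a by rewrite ltr_pdivrMr// mulr_natr mulr2n ltrDl.
have bb : b < b + 1 by rewrite ltrDl.
have a2b : a / 2 < b + 1 by rewrite (lt_trans a2a)// (lt_trans ab).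
(* The interval is taken larger than [a, b] so that [phi] vanishes at both of its endpoints. *)
rewrite (@integral_off _ `[a / 2, b + 1] `]0%R, +oo[); first last.
- move=> t t0 nt; congr EFin; rewrite /=.
  have [_ vE] := dg t; rewrite -vE.
  have nab : ~ (a <= t <= b).
    move=> /andP[h1 h2]; apply: nt; rewrite /= in_itv/=.
    by rewrite (le_trans (ltW a2a) h1) (le_trans h2 (ltW bb)).
  have nh : \near t, g t = cst 0 t.
    move/negP: nab; rewrite negb_and -!ltNge => /orP[ta|bt].
      have : \forall y \near t, y < a by exact: lt_nbhsl.
      move=> [e /= e0 he]; exists e => // y ye; rewrite /g off ?mul0r// => /andP[h1 _].
      by have := he y ye; rewrite ltNge h1.
    have : \forall y \near t, b < y by exact: lt_nbhsr.
    move=> [e /= e0 he]; exists e => // y ye; rewrite /g off ?mul0r// => /andP[_ h1].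
    by have := he y ye; rewrite ltNge h1.
  by rewrite (near_eq_derive _ nh) derive_cst.
- by move=> t /=; rewrite !in_itv/= andbT => /andP[h _]; exact: lt_le_trans h.
rewrite (@continuous_FTC2 _ _ g)//.
- rewrite /g !off ?mul0r ?sube0//.
  + by move=> /andP[h _]; move: h; rewrite leNgt a2a.
  + by move=> /andP[_ h]; move: h; rewrite leNgt bb.
- apply: continuous_subspaceT => t.
  apply: (@continuousM R R (fun t => 'D_(1, 0) phi (t, x)) (cst q)); last exact: cvg_cst.
  apply: (@continuous_comp R _ R (fun t : R => (t, x)) (fun z => 'D_(1, 0) phi z)).
    by apply: continuous_pair => s; [exact: cvg_id|exact: cvg_cst].
  exact: (cD (1, 0)).
- have cg := is_derive_continuous dg.
  split; first by move=> t _; have [] := dg t.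
  + by apply: cvg_at_right_filter; exact: cg.
  + by apply: cvg_at_left_filter; exact: cg.
- by move=> t _; exact: (congr1 (fun f => f t) (is_derive_derive1 dg)).
Qed.

(** At [c] the drift is a combination of the forces at 0, which vanish. Only the time derivative of
    the test function remains, and it integrates to zero. *)
Lemma steady_mu_oo : steady_state m p E W mu_lim.
Proof.
split; first exact: in_P_mu_oo.
move=> i phi tphi.
have [mass mom2 _] := in_P_mu_oo.
have [smooth_phi _ _] := tphi.
have [cphi dphi cD] := smooth_phi 1%N.
rewrite -[RHS](test_function_time_integral c (p i) tphi).
apply: eq_integral => t _.
pose f x := 'D_(1, 0) phi (t, x) - m i * 'D_(0, 1) phi (t, x) * drift W mu_lim i x.
have cslice v : continuous (fun x => 'D_v phi (t, x)).
  move=> x; apply: (@continuous_comp R _ R (fun x : R => (t, x)) (fun z => 'D_v phi z)).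
    by apply: continuous_pair => s; [exact: cvg_cst|exact: cvg_id].
  exact: (cD v).
have cf : continuous f.
  move=> x; apply: (@continuousB _ _ _ (fun x => 'D_(1, 0) phi (t, x))
     (fun x => m i * 'D_(0, 1) phi (t, x) * drift W mu_lim i x)); first exact: cslice.
  apply: (@continuousM R R (fun x => m i * 'D_(0, 1) phi (t, x)) (drift W mu_lim i)).
    by apply: (@continuousM R R (cst (m i)) (fun x => 'D_(0, 1) phi (t, x)));
      [exact: cvg_cst|exact: cslice].
  exact: (drift_continuous W_adm mass mom2).
have dr0 : drift W mu_lim i c = 0.
  rewrite /drift big1// => j _.
  rewrite (Rintegral_mu_oo j (@force_sub_continuous _ _ _ _ W_adm i j c)).
  by rewrite subrr (force0 W_adm) mul0r.
transitivity (\int[mu_lim i]_x (f x)%:E)%E; first by [].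
rewrite (Rintegral_EFin (mu_oo_integrable i cf)) (Rintegral_mu_oo i cf) /f dr0.
by rewrite mulr0 subr0.
Qed.

(** The upper bound uses the image of [al] under x -> (x, c) as coupling. For the lower bound, the
    positive mass p_i of a coupling keeps the essential supremum of a nonnegative function
    nonnegative. *)
Lemma wasserstein_oo_le (al : borelR R) i (e : R) : al setT = (p i)%:E ->
  supported al c e -> (0 <= wasserstein_oo al (mu_lim i) <= e%:E)%E.
Proof.
move=> mass sup; apply/andP; split.
  apply: le_ereal_inf_tmp => _ [g [_ g1 _] <-].
  apply: ess_sup_gee; last by apply: aeW => z; rewrite lee_fin.
  have := g1 setT measurableT; rewrite setXTT mass => ->.
  by rewrite lte_fin.
have mphi : measurable_fun setT
    (fun x : measurableTypeR R => (x, c) : measurableTypeR R * measurableTypeR R).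
  by apply: measurable_fun_pair; [exact: measurable_id|exact: measurable_cst].
apply: ge_ereal_inf; exists (ess_sup (push al mphi) (fun z => (`|z.1 - z.2|)%:E)).
  exists (push al mphi) => //; split.
  - by rewrite /= /pushforward preimage_setT mass ltry.
  - move=> A mA; rewrite /= /pushforward; congr (al _).
    by apply/seteqP; split => x //= [].
  - move=> B mB; rewrite /= /pushforward mu_ooE indicE.
    have [cB|cB] := boolP (c \in B).
      rewrite mule1 -mass; congr (al _); apply/seteqP; split => x //= _; split => //.
      exact: set_mem.
    rewrite mule0 (_ : _ @^-1` _ = set0) ?measure0//.
    apply/seteqP; split => x //= [_ Bc].
    by move/negP: cB; apply; rewrite inE.
apply/ess_supP.
have mN : measurable ([set z : R * R | e < `|z.1 - z.2|] :
    set (measurableTypeR R * measurableTypeR R)).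
  have mdist : measurable_fun setT (fun z : measurableTypeR R * measurableTypeR R => `|z.1 - z.2|).
    apply: measurableT_comp => //.
    by apply: measurable_funB; [exact: measurable_fst|exact: measurable_snd].
  have := mdist measurableT _ (measurable_itv `]e, +oo[).
  by rewrite setTI; congr measurable; apply/seteqP; split => z /=; rewrite in_itv/= andbT.
exists [set z : R * R | e < `|z.1 - z.2|]; split => //.
by move=> z /= /negP; rewrite lee_fin -ltNge.
Qed.

Lemma concentrated_eq (al : borelR R) i A : al setT = (p i)%:E ->
  (forall e, 0 < e -> supported al c e) -> measurable A -> al A = mu_lim i A.
Proof.
move=> mass sup mA.
have N0 : al.-negligible [set x | x != c].
  have ann k : al.-negligible [set x | k.+1%:R^-1 < `|x - c|].
    apply/negligibleP; first exact: measurable_off.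
    by apply: sup; rewrite invr_gt0 ltr0n.
  apply: negligibleS (negligible_bigcup ann) => x /= xc.
  have u0 : 0 < `|x - c| by rewrite normr_gt0 subr_eq0.
  (* With this k, 1 / |x - c| < k + 1. *)
  exists (Num.truncn (`|x - c|^-1)) => //=.
  by rewrite invf_plt ?posrE// truncnS_gt.
have mc : measurable ([set c] : set (measurableTypeR R)) by exact: measurable_set1.
have mNc : measurable ([set x | x != c] : set (measurableTypeR R)).
  rewrite (_ : [set x | x != c] = ~` [set c]); first exact: measurableC.
  by apply/seteqP; split => x /= /eqP.
have Nc : al [set x | x != c] = 0%E by apply/negligibleP.
rewrite mu_ooE indicE; have [cA|cA] := boolP (c \in A).
  rewrite mule1 -mass; apply/eqP; rewrite eq_le le_measure ?inE//=.
  rewrite (@le_trans _ _ (al (A `|` [set x | x != c])))//.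
    rewrite le_measure ?inE//; first exact: measurableU.
    move=> x _; have [->|xc] := eqVneq x c; first by left; exact: set_mem.
    by right.
  have U2 : (al (A `|` [set x | x != c]) <= al A + al [set x | x != c])%E.
    exact: (measureU2 _ mA mNc).
  by rewrite (le_trans U2)// Nc adde0.
rewrite mule0; apply: (subset_measure0 mA mNc) Nc.
by move=> x Ax /=; apply/eqP => xc; move/negP: cA; apply; rewrite inE -xc.
Qed.

End limit_state.

Theorem proposition3p9 (R : realType) (n : nat) (m p : 'I_n.+1 -> R)
    (m_gt0 : forall i, 0 < m i) (p_gt0 : forall i, 0 < p i) (E : R)
    (W : R -> 'M[R]_n.+1) (kappa : 'M[R]_n.+1)
    (W_adm : admissible W kappa) (lambda0_gt0 : 0 < lambda0 m p kappa) :
  [/\ steady_state m p E W (mu_oo m p_gt0 E),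
      forall nu, steady_state m p E W nu ->
        forall i, measure_eq (nu i) (mu_oo m p_gt0 E i) &
      forall (mu0 : 'I_n.+1 -> borelR R) (mu : R -> 'I_n.+1 -> borelR R),
        in_P m p E mu0 ->
        (forall i, compact (msupport (mu0 i))) ->
        gradient_flow m p E W mu0 mu ->
        forall i, wasserstein_oo (mu t i) (mu_oo m p_gt0 E i)
                    @[t --> +oo] --> (0 : \bar R)].
Proof.
have lam_le i := lambda0_le_sum m_gt0 p_gt0 (adm_kappa_sym W_adm) i.
split.
- exact: (steady_mu_oo E m_gt0 p_gt0 W_adm).
- move=> nu [nuP weak] i A mA.
  have [mass _ _] := nuP.
  have sup0 j : exists2 K, 0 <= K & supported (nu j) (x_oo m p E) K.
    exact: (steady_supported m_gt0 p_gt0 W_adm lambda0_gt0 lam_le nuP weak).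
  have m2 (T : R) : exists B, forall (t : R) j, 0 <= t -> t <= T ->
      \int[nu j]_x (x ^+ 2) <= B.
    exists (\sum_j \int[nu j]_x (x ^+ 2)) => _ j _ _.
    rewrite (bigD1 j)//= lerDl sumr_ge0// => k _.
    by apply: Rintegral_ge0 => x _; exact: sqr_ge0.
  have sup (e : R) : 0 < e -> supported (nu i) (x_oo m p E) e.
    move=> e0.
    (* Along the constant curve the estimate at the single time T already concerns [nu], for every
       radius [e]. *)
    have [T _ h] := eventually_supported m_gt0 p_gt0 W_adm lambda0_gt0
      (fun _ _ => nuP) weak (weakly_continuous_cst p_gt0 nu) m2 sup0 e0.
    exact: (h T i (lexx T)).
  exact: (concentrated_eq p_gt0 (mass i) sup mA).
- move=> mu0 mu mu0P cpt [muP AC init weak] i.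
  have sup0 j : exists2 K, 0 <= K & supported (mu 0 j) (x_oo m p E) K.
    have [K K0 h] := compact_msupport (x_oo m p E) (cpt j).
    exists K => //; rewrite /supported init//; exact: measurable_off.
  have wc := AC2_weakly_continuous m_gt0 muP AC.
  have m2 := AC2_second_moment m_gt0 muP AC.
  have H (e : R) : 0 < e -> exists2 T : R, 0 <= T & forall t : R, T <= t ->
      (0 <= wasserstein_oo (mu t i) (mu_oo m p_gt0 E i) <= e%:E)%E.
    move=> e0.
    have [T T0 h] := eventually_supported m_gt0 p_gt0 W_adm lambda0_gt0 muP weak wc m2 sup0 e0.
    exists T => // t Tt; have [mass _ _] := muP t (le_trans T0 Tt).
    by have := wasserstein_oo_le p_gt0 (mass i) (h t i Tt).
  (* The distance takes values in the extended reals; once it is eventually finite, the limit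
     reduces to one of real numbers. *)
  have fin : \forall t \near +oo, wasserstein_oo (mu t i) (mu_oo m p_gt0 E i) \is a fin_num.
    have [T T0 h] := H 1 ltr01.
    near=> t; have /andP[h1 h2] : (0 <= wasserstein_oo (mu t i) (mu_oo m p_gt0 E i) <= 1%:E)%E.
      by apply: h; near: t; apply: nbhs_pinfty_ge; exact: num_real.
    by rewrite ge0_fin_numE// (le_lt_trans h2)// ltry.
  apply: cvg_EFin => //; apply/cvgrPdist_le => e e0.
  have [T T0 h] := H e e0.
  near=> t; have /andP[h1 h2] : (0 <= wasserstein_oo (mu t i) (mu_oo m p_gt0 E i) <= e%:E)%E.
    by apply: h; near: t; apply: nbhs_pinfty_ge; exact: num_real.
  have ft : wasserstein_oo (mu t i) (mu_oo m p_gt0 E i) \is a fin_num.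
    by rewrite ge0_fin_numE// (le_lt_trans h2)// ltry.
  rewrite sub0r normrN /= ger0_norm ?fine_ge0//.
  by rewrite -lee_fin fineK.
Unshelve. all: by end_near. Qed.
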